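(* The few-vertex solutions of the factorisation problem $[\![\mathcal{P},\mathcal{Q}(\mathcal{P})]\!] = \Diamond\bigl(\mathcal{P},\mathrm{Jac}(\mathcal{P})\bigr)$, with $\mathcal{Q}(\mathcal{P})$ a sum of Kontsevich bi-vector graphs on $k$ internal vertices and $\Diamond$ a sum of Leibniz graphs, are these (disconnected Kontsevich graphs in $\mathcal{Q}(\mathcal{P})$ are allowed): $\bullet$ $k=1$: The dilation $\dot{\mathcal{P}} = \mathcal{P}$ is a unique, nontrivial and proper solution. $\bullet$ $k=2$: No solutions exist (in particular, neither trivial nor improper). $\bullet$ $k=3$: There are no solutions: neither Poisson-trivial nor Leibniz bi-vectors. $\bullet$ $k=4$: A unique nontrivial and proper solution is the Kontsevich tetrahedral flow $\mathcal{Q}_{1:\frac{6}{2}}(\mathcal{P}) = \mathsf{2\ 4\ 1\ \ \ 0\ 1\ \ 2\ 4\ \ 2\ 5\ \ 2\ 3} - 3(\mathsf{2\ 4\ 1\ \ \ 0\ 3\ \ 1\ 4\ \ 2\ 5\ \ 2\ 3} + \mathsf{2\ 4\ 1\ \ \ 0\ 3\ \ 4\ 5\ \ 1\ 2\ \ 2\ 4})$, obtained by orienting the tetrahedron graph $\boldsymbol{\gamma}_3 = \mathsf{12}\wedge\mathsf{13}\wedge\mathsf{14}\wedge\mathsf{23}\wedge\mathsf{24}\wedge\mathsf{34}$. There is a one-dimensional space of Poisson-trivial (still proper) solutions $[\![\mathcal{P},X]\!]$, where $X$ is a Kontsevich $1$-vector graph on three internal vertices. Intersecting with the former by $\{0\}$,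 there is a three-dimensional space of improper (still Poisson-nontrivial) solutions of the form $\nabla\bigl(\mathcal{P},\mathrm{Jac}(\mathcal{P})\bigr)$. None of the solutions $\mathcal{Q}(\mathcal{P})$ known so far contains any $2$-cycles (''eyes'' $\bullet\rightleftarrows\bullet$).
   Context: Let $\mathcal{P}$ be a Poisson bi-vector on an affine real manifold, i.e. $[\![\mathcal{P},\mathcal{P}]\!]=0$ for the Schouten bracket $[\![\cdot,\cdot]\!]$. A Kontsevich graph of type $(n,k)$ is an oriented graph on $n$ sinks $0,\ldots,n-1$ and $k$ internal vertices $n,\ldots,n+k-1$, each internal vertex being the source of exactly two ordered edges (Left $\prec$ Right); placing a copy of $\mathcal{P}$ at each internal vertex, each edge acting as a derivation $\partial/\partial x^i$ on its arrowhead, it encodes a polydifferential operator; multi-vector graphs have exactly one arrow into each sink and are totally skew-symmetrised over the sinks. A graph is encoded as ($n$, $k$, sign; list of ordered pairs of targets of edges issued from internal vertices $n,\ldots,n+k-1$). The Jacobiator $\mathrm{Jac}(\mathcal{P})$ is the left-hand side of the Jacobi identity, a skew sum of three Kontsevich tri-vector graphs on two internal vertices; a Leibniz graph is a graph containing at least one Jacobiator vertex (source of three arrows to distinct vertices, edges falling on it acting by the Leibniz rule). The problem is to find infinitesimal deformations $\mathcal{P}\mapsto\mathcal{P}+\varepsilon\mathcal{Q}(\mathcal{P})+\bar{o}(\varepsilon)$ preserving the Poisson property on all affine manifolds, i.e. to solve $[\![\mathcal{P},\mathcal{Q}(\mathcal{P})]\!] = \Diamond\bigl(\mathcal{P},\mathrm{Jac}(\mathcal{P})\bigr)$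 for Kontsevich bi-vector graphs $\mathcal{Q}(\mathcal{P})$ on $k$ internal vertices and Leibniz tri-vector graphs $\Diamond$. A solution is Poisson-trivial if $\mathcal{Q}(\mathcal{P}) = [\![\mathcal{P},X]\!]$ for a Kontsevich one-vector graph $X$ (on $k-1$ internal vertices), and improper if $\mathcal{Q}(\mathcal{P}) = \nabla\bigl(\mathcal{P},\mathrm{Jac}(\mathcal{P})\bigr)$ for a Leibniz bi-vector graph $\nabla$ (such bi-vectors vanish identically at every Poisson $\mathcal{P}$); nontrivial and proper solutions are considered modulo these.
   Formalization: Kontsevich and Leibniz graphs are taken without tadpoles (otherwise X = ∂_i P^{ij} gives a nonzero trivial solution at k=2), and the absence of 2-cycles is claimed only for the nontrivial proper solutions P and the tetrahedral flow, since the trivial solution at k=4 contains them. *)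

(* Defs.v *)
(* Graphs are taken at the level of the Kontsevich graph calculus: a sum of
   graphs is an element of a free vector space, considered up to the sign rules
   below; P is the wedge graph with one internal vertex. *)
From HB Require Import structures.
From mathcomp Require Import all_boot all_order all_fingroup all_algebra.

Set Implicit Arguments.
Unset Strict Implicit.
Unset Printing Implicit Defensive.

Import GRing.Theory Num.Theory.
Local Open Scope ring_scope.

(* inl s = sink s, carrying label s; inr i = internal vertex, carrying label
   n + i. *)
Definition vertex (n k : nat) := ('I_n + 'I_k)%type.

(* The value at i is the pair (Left target, Right target). *)
Definition kgraph (n k : nat) := {ffun 'I_k -> vertex n k * vertex n k}.

Notation gsum R n k := {ffun kgraph n k -> R^o}.

Definition gen (R : realFieldType) n k (g : kgraph n k) : gsum R n k :=
  [ffun h => (h == g)%:R].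

(* The list of ordered pairs of targets, in the labels 0, ..., n + k; here the
   number of sinks is n.+1. *)
Definition encoded n k (c : seq (nat * nat)) : kgraph n.+1 k :=
  let lab x : vertex n.+1 k := @split n.+1 k (inord x) in
  [ffun i : 'I_k => let p := nth (0, 0)%N c i in (lab p.1, lab p.2)].

Definition target n k (g : kgraph n k) (a : 'I_k * bool) : vertex n k :=
  if a.2 then (g a.1).2 else (g a.1).1.

Definition one_arrow_per_sink n k (g : kgraph n k) : bool :=
  [forall s : 'I_n, #|[set a | target g a == inl s]| == 1%N].

Definition tadpole_free n k (g : kgraph n k) : bool :=
  [forall a : 'I_k * bool, target g a != inr a.1].

Definition is_multivector n k (g : kgraph n k) : bool :=
  one_arrow_per_sink g && tadpole_free g.

Definition has_2cycle n k (g : kgraph n k) : bool :=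
  [exists a : 'I_k * bool, exists b : 'I_k * bool,
    [&& a.1 != b.1, target g a == inr b.1 & target g b == inr a.1]].

Definition rename n k (s : 'S_n) (t : 'S_k) (v : vertex n k) : vertex n k :=
  match v with inl x => inl (s x) | inr i => inr (t i) end.

Definition flip (T : Type) (b : bool) (p : T * T) : T * T :=
  if b then (p.2, p.1) else p.

Definition transform n k (s : 'S_n) (t : 'S_k) (f : {ffun 'I_k -> bool})
    (g : kgraph n k) : kgraph n k :=
  [ffun i : 'I_k => let j := (t^-1)%g i in
    let p := flip (f j) (g j) in (rename s t p.1, rename s t p.2)].

(* The projector onto totally skew-symmetrised sums. Permuting sinks costs the
   sign of the permutation, swapping Left and Right at an internal vertex costs
   -1, relabelling internal vertices is free; two sums of graphs are the same
   multi-vector iff they have the same image. *)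
Definition skew_graph (R : realFieldType) n k (g : kgraph n k) : gsum R n k :=
  (n`! * k`! * 2 ^ k)%:R^-1 *:
  \sum_(s : 'S_n) \sum_(t : 'S_k) \sum_(f : {ffun 'I_k -> bool})
     ((-1) ^+ s * \prod_(i < k) (-1) ^+ f i) *: gen R (transform s t f g).

Definition skew (R : realFieldType) n k (v : gsum R n k) : gsum R n k :=
  \sum_(g : kgraph n k) v g *: skew_graph R g.

Definition multivectors (R : realFieldType) n k : {vspace gsum R n k} :=
  <<[seq skew (gen R g) | g <- enum (@is_multivector n k)]>>%VS.

(* Disjoint union of g and h, the vertices of each sent along fg and fh. *)
Definition glue a k b l n (fg : vertex a k -> vertex n (k + l))
    (fh : vertex b l -> vertex n (k + l)) (g : kgraph a k) (h : kgraph b l) :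
    kgraph n (k + l) :=
  [ffun i : 'I_(k + l) => match split i with
    | inl i => (fg (g i).1, fg (g i).2)
    | inr j => (fh (h j).1, fh (h j).2)
    end].

(* The arrow into sink s of g now falls on the internal vertex v of h. *)
Definition graft_l a k b l (g : kgraph a.+1 k) (h : kgraph b.+1 l)
    (s : 'I_a.+1) (v : 'I_l) : kgraph (a + b).+1 (k + l) :=
  glue
    (fun x : vertex a.+1 k => match x with
      | inl r => if unlift s r is Some r'
                 then inl (cast_ord (addnS a b) (lshift b.+1 r'))
                 else inr (rshift k v)
      | inr i => inr (lshift l i)
      end)
    (fun x : vertex b.+1 l => match x with
      | inl r => inl (cast_ord (addnS a b) (rshift a r))
      | inr i => inr (rshift k i)
      end) g h.

(* The arrow into sink s of h now falls on the internal vertex v of g. *)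
Definition graft_r a k b l (g : kgraph a.+1 k) (h : kgraph b.+1 l)
    (s : 'I_b.+1) (v : 'I_k) : kgraph (a + b).+1 (k + l) :=
  glue
    (fun x : vertex a.+1 k => match x with
      | inl r => inl (lshift b r : 'I_(a.+1 + b))
      | inr i => inr (lshift l i)
      end)
    (fun x : vertex b.+1 l => match x with
      | inl r => if unlift s r is Some r'
                 then inl (rshift a.+1 r' : 'I_(a.+1 + b))
                 else inr (lshift l v)
      | inr i => inr (rshift k i)
      end) g h.

(* [[A, B]] = (A)<-d/dxi_i . d/dx^i->(B) - (A)<-d/dx^i . d/dxi_i->(B), where
   the sinks, read in increasing order, are the anticommuting factors xi.
   Removing sink s from the right of A gives (-1)^(a - s), removing sink s from
   the left of B gives (-1)^s. *)
Definition schouten_graph (R : realFieldType) a k b l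
    (g : kgraph a.+1 k) (h : kgraph b.+1 l) : gsum R (a + b).+1 (k + l) :=
  \sum_(s < a.+1) \sum_(v < l) (-1) ^+ (a - s) *: gen R (graft_l g h s v)
  - \sum_(s < b.+1) \sum_(v < k) (-1) ^+ s *: gen R (graft_r g h s v).

Definition schouten (R : realFieldType) a k b l
    (u : gsum R a.+1 k) (w : gsum R b.+1 l) : gsum R (a + b).+1 (k + l) :=
  skew (\sum_(g : kgraph a.+1 k) \sum_(h : kgraph b.+1 l)
          (u g * w h) *: schouten_graph R g h).

Lemma skew_is_linear (R : realFieldType) n k : linear (@skew R n k).
Proof.
move=> c u v; rewrite /skew scaler_sumr -big_split /=; apply: eq_bigr => g _.
by rewrite !ffunE scalerDl; congr (_ + _); rewrite [RHS]scalerA.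
Qed.

HB.instance Definition _ (R : realFieldType) n k :=
  GRing.isLinear.Build R (gsum R n k) (gsum R n k) _ (@skew R n k)
    (@skew_is_linear R n k).

Lemma schouten_is_linear (R : realFieldType) a k b l (u : gsum R a.+1 k) :
  linear (@schouten R a k b l u).
Proof.
move=> c v w; rewrite /schouten -linearP; congr skew.
rewrite scaler_sumr -big_split /=; apply: eq_bigr => g _.
rewrite scaler_sumr -big_split /=; apply: eq_bigr => h _.
by rewrite !ffunE scalerA mulrDr scalerDl; congr (_ *: _ + _); rewrite mulrCA.
Qed.

HB.instance Definition _ (R : realFieldType) a k b l (u : gsum R a.+1 k) :=
  GRing.isLinear.Build R (gsum R b.+1 l) (gsum R (a + b).+1 (k + l)) _
    (@schouten R a k b l u) (@schouten_is_linear R a k b l u).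

Definition wedge (R : realFieldType) : gsum R 2 1 :=
  skew (gen R (encoded 1 1 [:: (0, 1)%N])).

Definition bracket_P (R : realFieldType) n k :
    'Hom(gsum R n.+1 k, gsum R n.+2 k.+1) :=
  linfun (@schouten R 1 1 n k (wedge R)).

(* Leibniz graphs: n sinks, m vertices with two outgoing arrows, j Jacobiator
   vertices with three. *)
Definition lvertex (n m j : nat) := ('I_n + ('I_m + 'I_j))%type.
Definition larrow (m j : nat) := ('I_m * 'I_2 + 'I_j * 'I_3)%type.
Definition lgraph (n m j : nat) := {ffun larrow m j -> lvertex n m j}.

Definition is_leibniz_multivector n m j (L : lgraph n m j) : bool :=
  [&& (0 < j)%N,
      [forall s : 'I_n, #|[set a | L a == inl s]| == 1%N],
      [forall p : 'I_m, forall b : 'I_2, L (inl (p, b)) != inr (inl p)],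
      [forall q : 'I_j, injectiveb (fun b : 'I_3 => L (inr (q, b)))]
    & [forall q : 'I_j, forall b : 'I_3, L (inr (q, b)) != inr (inr q)]].

(* Each Jacobiator q is made of two internal vertices of the expanded graph. *)
Definition inner m j (q : 'I_j) : 'I_(m + (j + j)) := rshift m (lshift j q).
Definition outer m j (q : 'I_j) : 'I_(m + (j + j)) := rshift m (rshift j q).

Definition contract n m j (v : vertex n (m + (j + j))) : lvertex n m j :=
  match v with
  | inl s => inl s
  | inr i => inr (match split i with
                  | inl p => inl p
                  | inr q => inr (match split q with inl q | inr q => q end)
                  end)
  end.

(* Given targets t of all the arrows, the term of the cyclic sum
     Jac^{abc} = sum_cyc P^{ic} d_i P^{ab}:  inner -> (a, b), outer -> (inner, c)
   selected by r at each Jacobiator (indices in 'I_3 add modulo 3). *)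
Definition jac_term n m j (t : {ffun larrow m j -> vertex n (m + (j + j))})
    (r : {ffun 'I_j -> 'I_3}) : kgraph n (m + (j + j)) :=
  [ffun i : 'I_(m + (j + j)) => match split i with
    | inl p => (t (inl (p, 0)), t (inl (p, 1)))
    | inr i' => match split i' with
      | inl q => (t (inr (q, r q)), t (inr (q, r q + 1)))
      | inr q => (inr (inner m q), t (inr (q, r q + 2)))
      end
    end].

(* Leibniz rule: an arrow falling on a Jacobiator falls, in turn, on its inner
   and on its outer vertex. *)
Definition expand (R : realFieldType) n m j (L : lgraph n m j) :
    gsum R n (m + (j + j)) :=
  \sum_(t : {ffun larrow m j -> vertex n (m + (j + j))}
        | [forall a, contract (t a) == L a])
    \sum_(r : {ffun 'I_j -> 'I_3}) gen R (jac_term t r).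

Definition leibniz_type (R : realFieldType) n m j :
    {vspace gsum R n (m + (j + j))} :=
  <<[seq skew (expand R L) | L <- enum (@is_leibniz_multivector n m j)]>>%VS.

(* All Leibniz n-vectors whose expansion has k internal vertices. *)
Definition leibniz (R : realFieldType) n k : {vspace gsum R n k} :=
  (\sum_(j < k.+1)
     if (k - (j + j) + (j + j) =P k)%N is ReflectT e
     then ecast k' {vspace gsum R n k'} e (leibniz_type R n (k - (j + j)) j)
     else 0)%VS.

Definition solutions (R : realFieldType) k : {vspace gsum R 2 k} :=
  (multivectors R 2 k :&: (bracket_P R 1 k @^-1: leibniz R 3 k.+1))%VS.

(* [[P, X]] for 1-vectors X on k internal vertices. *)
Definition poisson_trivial (R : realFieldType) k : {vspace gsum R 2 k.+1} :=
  (bracket_P R 0 k @: multivectors R 1 k)%VS.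

Definition improper (R : realFieldType) k : {vspace gsum R 2 k} :=
  leibniz R 2 k.

Definition tetrahedral_flow (R : realFieldType) : gsum R 2 4 :=
  skew (gen R (encoded 1 4 [:: (0, 1); (2, 4); (2, 5); (2, 3)]%N)
        - 3 *: (gen R (encoded 1 4 [:: (0, 3); (1, 4); (2, 5); (2, 3)]%N)
                + gen R (encoded 1 4 [:: (0, 3); (4, 5); (1, 2); (2, 4)]%N))).

(* Orientation of an unoriented graph E (a wedge product of edges) on k
   vertices: the arrows to the two sinks and a direction of every edge are
   chosen in all ways that leave two arrows at each vertex. Arrows are listed
   in the order S0 ^ S1 ^ E, which orders Left < Right at each vertex; the sign
   is that of the (stable) sorting of this list by the sources. *)
Definition arrows k (E : seq ('I_k * 'I_k)) (s : 'I_k * 'I_k)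
    (o : (size E).-tuple bool) : seq ('I_k * vertex 2 k) :=
  [:: (s.1, inl ord0); (s.2, inl ord_max)] ++
  [seq (let e := flip x.2 x.1 in (e.1, inr e.2)) | x <- zip E o].

Definition outgoing k (A : seq ('I_k * vertex 2 k)) (i : 'I_k) :
    seq (vertex 2 k) := [seq a.2 | a <- A & a.1 == i].

Definition inversions (s : seq nat) : nat :=
  \sum_(p < size s) \sum_(q < size s | (p < q)%N)
     (nth 0 s q < nth 0 s p)%N.

Definition oriented k (A : seq ('I_k * vertex 2 k)) : kgraph 2 k :=
  [ffun i : 'I_k => (nth (inl ord0) (outgoing A i) 0,
                     nth (inl ord0) (outgoing A i) 1)].

Definition orient (R : realFieldType) k (E : seq ('I_k * 'I_k)) : gsum R 2 k :=
  skew (\sum_(s : 'I_k * 'I_k) \sum_(o : (size E).-tuple bool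
            | [forall i, size (outgoing (arrows s o) i) == 2%N])
     (-1) ^+ inversions [seq nat_of_ord a.1 | a <- arrows s o]
       *: gen R (oriented (arrows s o))).

(* 12 ^ 13 ^ 14 ^ 23 ^ 24 ^ 34, with vertices numbered from 0. *)
Definition gamma3 : seq ('I_4 * 'I_4) :=
  [seq (inord e.1, inord e.2)
     | e <- [:: (0, 1); (0, 2); (0, 3); (1, 2); (1, 3); (2, 3)]%N].

Definition without_2cycles (R : realFieldType) n k (v : gsum R n k) : Prop :=
  forall g : kgraph n k, has_2cycle g -> v g = 0.

(* Main.v *)
(* A multi-vector graph has one arrow into each sink, so up to sign it is determined by
   its shadow: the list of pairs of targets in which the sinks are not distinguished.
   The least shadow over relabellings of the internal vertices, with its sign, decides
   when two graphs define proportional classes and when a class vanishes. In terms of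
   shadows, [[P, -]] and the expansion of Leibniz graphs are computable.
   For the upper bound on the solutions, certificates give linear functionals phi_i on
   tri-vectors that vanish on all Leibniz graphs, together with bi-vectors b_i such that
   Q - sum_i phi_i([[P, Q]]) b_i lies in the span of the claimed solutions for every
   basis graph Q; if [[P, Q]] is Leibniz, the correction terms vanish. Conversely, each
   claimed solution comes with an explicit factorisation of its bracket through the
   Jacobiator, and explicit dual functionals prove linear independence. *)

(* The vector spaces consist of functions on all encoded graphs, about 10^9 of them for tri-vectors
   on five internal vertices, so neither they nor the projector can be enumerated. Hence everything
   is moved to integer combinations of lists of natural numbers, which the kernel can evaluate. Of
   the search for least shadows only soundness enters: its answer is a signed member of the orbit.
   The functionals and the independence proofs rest instead on genuine coefficients of classes at
   chosen graphs, obtained from the full orbit through the self-adjointness of the projector. The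
   field is arbitrary, but all certificates are integral: one integer per certificate clears the
   denominators. *)
From HB Require Import structures.
From mathcomp Require Import all_boot all_order all_fingroup all_algebra.
From mathcomp Require Import zify.
Require Import Defs.

Set Implicit Arguments.
Unset Strict Implicit.
Unset Printing Implicit Defensive.

Import GRing.Theory Num.Theory.
Local Open Scope ring_scope.

(** * Skew-symmetrisation and its compatibility with the Schouten bracket *)

Section SkewSymmetry.
Variable R : realFieldType.

(** The character by which the symmetries of [transform] act on multi-vectors; relabelling internal
    vertices has sign 1, hence no argument for it. *)
Definition tsign n k (s : 'S_n) (f : {ffun 'I_k -> bool}) : R :=
  (-1) ^+ s * \prod_(i < k) (-1) ^+ f i.

Lemma skew_gen n k (g : kgraph n k) : skew (gen R g) = skew_graph R g.
Proof.
rewrite /skew (bigD1 g) //= ffunE eqxx scale1r big1 ?addr0 // => h /negPf hg.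
by rewrite ffunE hg scale0r.
Qed.

Lemma skewZ n k (c : R) (v : gsum R n k) : skew (c *: v) = c *: skew v.
Proof. exact: linearZ. Qed.

Lemma skewB n k (u v : gsum R n k) : skew (u - v) = skew u - skew v.
Proof. exact: linearB. Qed.

Lemma skew_sum n k I (r : seq I) (P : pred I) (F : I -> gsum R n k) :
  skew (\sum_(i <- r | P i) F i) = \sum_(i <- r | P i) skew (F i).
Proof. exact: linear_sum. Qed.

Lemma flip_flip (T : Type) (a b : bool) (p : T * T) :
  flip a (flip b p) = flip (b (+) a) p.
Proof. by case: a b p => [] [] []. Qed.

(** Permutations compose from left to right, so [s'] and [t'] act first; the later flip at the
    vertex that was [j] is read at its new name [t' j]. *)
Lemma transform_transform n k (s s' : 'S_n) (t t' : 'S_k) f f' (g : kgraph n k) :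
  transform s t f (transform s' t' f' g) =
  transform (s' * s) (t' * t) [ffun j => f' j (+) f (t' j)] g.
Proof.
apply/ffunP => i; rewrite !ffunE /= !ffunE !invMg !permM permKV -flip_flip.
have flipR b (p : vertex n k * vertex n k) : flip b (rename s' t' p.1, rename s' t' p.2) =
    (rename s' t' (flip b p).1, rename s' t' (flip b p).2) by case: b.
have renR v : rename (s' * s) (t' * t) v = rename s t (rename s' t' v).
  by case: v => x /=; rewrite permM.
by rewrite flipR /= -!renR.
Qed.

Lemma tsign_sq n k (s : 'S_n) (f : {ffun 'I_k -> bool}) :
  tsign s f * tsign s f = 1.
Proof.
rewrite /tsign mulrACA -expr2 sqrr_sign mul1r -big_split /= big1 // => i _.
by rewrite -expr2 sqrr_sign.
Qed.

Lemma tsignM n k (s s' : 'S_n) (t' : 'S_k) (f f' : {ffun 'I_k -> bool}) :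
  tsign (s' * s) [ffun j => f' j (+) f (t' j)] = tsign s' f' * tsign s f.
Proof.
rewrite /tsign odd_permM signr_addb mulrACA; congr (_ * _).
rewrite [X in _ = _ * X](reindex_inj (@perm_inj _ t')) -big_split /=.
by apply: eq_bigr => i _; rewrite ffunE signr_addb.
Qed.

(** Translating the orbit sum by a group element reindexes it and changes all signs by one common
    factor, because [tsign] is multiplicative. *)
Lemma skew_transform n k s t f (g : kgraph n k) :
  skew (gen R (transform s t f g)) = tsign s f *: skew (gen R g).
Proof.
rewrite !skew_gen /skew_graph scalerA mulrC -scalerA; congr (_ *: _).
rewrite scaler_sumr [RHS](reindex_inj (mulgI s)); apply: eq_bigr => s2 _.
rewrite scaler_sumr [RHS](reindex_inj (mulgI t)); apply: eq_bigr => t2 _.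
pose F (f2 : {ffun 'I_k -> bool}) := [ffun j => f j (+) f2 (t j)].
have FI : injective F.
  move=> f1 f2 /ffunP e; apply/ffunP => j.
  by have := e ((t^-1)%g j); rewrite !ffunE permKV => /addbI.
rewrite scaler_sumr [RHS](reindex_inj FI); apply: eq_bigr => f2 _.
by rewrite transform_transform -!/(tsign _ _) tsignM scalerA mulrA tsign_sq mul1r.
Qed.


Lemma sum_gen n k (V : lmodType R) (F : kgraph n k -> V) (g : kgraph n k) :
  \sum_h gen R g h *: F h = F g.
Proof.
rewrite (bigD1 g) //= ffunE eqxx scale1r big1 ?addr0 // => h /negPf hg.
by rewrite ffunE hg scale0r.
Qed.

(** Each of the n! k! 2^k terms of the projector contributes [F g], since its sign occurs twice.
    This is what removes the projectors inside the arguments of the bracket. *)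
Lemma skew_average n k (V : lmodType R) (F : kgraph n k -> V) (g : kgraph n k) :
  (forall s t f, F (transform s t f g) = tsign s f *: F g) ->
  \sum_h skew (gen R g) h *: F h = F g.
Proof.
move=> FE; rewrite skew_gen /skew_graph.
set N := (_ * _)%:R.
transitivity (N^-1 *: \sum_(s : 'S_n) \sum_(t : 'S_k) \sum_(f : {ffun 'I_k -> bool})
   F g).
  under eq_bigr => h _ do rewrite ffunE -scalerA.
  rewrite -scaler_sumr; congr (_ *: _).
  under eq_bigr => h _ do rewrite sum_ffunE scaler_suml.
  rewrite exchange_big; apply: eq_bigr => s _.
  under eq_bigr => h _ do rewrite sum_ffunE scaler_suml.
  rewrite exchange_big; apply: eq_bigr => t _.
  under eq_bigr => h _ do rewrite sum_ffunE scaler_suml.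
  rewrite exchange_big; apply: eq_bigr => f _.
  under eq_bigr => h _ do rewrite -/(tsign s f) ffunE -scalerA.
  by rewrite /= -scaler_sumr sum_gen FE scalerA tsign_sq scale1r.
rewrite !sumr_const -!mulrnA -scaler_nat scalerA.
rewrite card_ffun card_bool card_ord.
have cardS m : #|'S_m| = m`! by exact: card_Sn.
rewrite !cardS (_ : (_ * _)%N = (n`! * k`! * 2 ^ k)%N).
  rewrite mulVf ?scale1r // pnatr_eq0 -lt0n !muln_gt0 !fact_gt0 /=.
  by rewrite expn_gt0.
by rewrite [RHS]mulnC [(n`! * _)%N]mulnC mulnA.
Qed.

(** Splits off the image of one point: the parity of [s] is that of [r] changed by [x + s x]. *)
Lemma perm_eq_lift n (s : 'S_n.+1) (x : 'I_n.+1) :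
  exists r : 'S_n, s = lift_perm x (s x) r.
Proof.
pose r y := odflt y (unlift (s x) (s (lift x y))).
have rE y : lift (s x) (r y) = s (lift x y).
  rewrite /r; case: unliftP => //= /perm_inj /eqP.
  by rewrite eq_sym (negPf (neq_lift _ _)).
have rI : injective r.
  by move=> y z e; apply: (@lift_inj _ x); apply: (@perm_inj _ s); rewrite -!rE e.
exists (perm rI); apply/permP => y; case: (unliftP x y) => [z|] ->.
  by rewrite lift_perm_lift permE rE.
by rewrite lift_perm_id.
Qed.

Definition lift_flips k (f : {ffun 'I_k -> bool}) : {ffun 'I_k.+1 -> bool} :=
  [ffun i => if unlift ord0 i is Some j then f j else false].

Lemma prod_lift_flips k (f : {ffun 'I_k -> bool}) :
  \prod_(i < k.+1) (-1) ^+ lift_flips f i = \prod_(i < k) (-1) ^+ f i :> R.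
Proof.
rewrite big_ord_recl ffunE unlift_none mul1r.
by apply: eq_bigr => i _; rewrite ffunE liftK.
Qed.

Lemma splitE1 l (i : 'I_l.+1) : @split 1 l i =
  if unlift ord0 i is Some j then inr j else inl ord0.
Proof.
case: unliftP => [j|] ->; last by rewrite (_ : ord0 = lshift l (ord0 : 'I_1)) ?(unsplitK (inl _)) //; apply: val_inj.
by rewrite (_ : lift _ _ = rshift 1 j) ?(unsplitK (inr _)) //; apply: val_inj.
Qed.

(** The wedge vertex and its surviving sink both get number 0 in the glued graph, so a symmetry of
    [h] extends by fixing them, while the grafting vertex moves along with [t]. *)
Lemma graft_l_transform b l (w : kgraph 2 1) s t f (h : kgraph b.+1 l) x v :
  graft_l w (transform s t f h) x (t v) =
  transform (lift_perm ord0 ord0 s) (lift_perm ord0 ord0 t) (lift_flips f)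
    (graft_l w h x v).
Proof.
have sinkE (r : 'I_b.+1) : cast_ord (addnS 1 b) (rshift 1 r) = lift ord0 r.
  exact: val_inj.
have intE (i : 'I_l) : rshift 1 i = lift ord0 i :> 'I_l.+1 by apply: val_inj.
have int0 (i : 'I_1) : lshift l i = ord0 :> 'I_l.+1.
  by apply: val_inj; rewrite ord1.
have sink0 (r : 'I_1) : cast_ord (addnS 1 b) (lshift b.+1 r) = ord0.
  by apply: val_inj; rewrite ord1.
apply/ffunP => i; rewrite !ffunE /= !ffunE lift_permV !splitE1.
case: (unliftP ord0 i) => [j|] ->; last first.
  rewrite lift_perm_id !unlift_none /=.
  have A (y : vertex 2 1) : match y with
    | inl r => if unlift x r is Some r' then inl (cast_ord (addnS 1 b) (lshift b.+1 r'))
               else inr (rshift 1 (t v))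
    | inr i0 => inr (lshift l i0) end =
    rename (lift_perm ord0 ord0 s) (lift_perm ord0 ord0 t)
     (match y with
    | inl r => if unlift x r is Some r' then inl (cast_ord (addnS 1 b) (lshift b.+1 r'))
               else inr (rshift 1 v)
    | inr i0 => inr (lshift l i0) end).
    case: y => [r|i0] /=; last by rewrite int0 lift_perm_id.
    case: unliftP => [r'|] _ /=; first by rewrite sink0 lift_perm_id.
    by rewrite !intE lift_perm_lift.
  by rewrite !A.
rewrite lift_perm_lift !liftK /= !ffunE.
set p := h _.
have B (y : vertex b.+1 l) : match rename s t y with
   | inl r => inl (cast_ord (addnS 1 b) (rshift 1 r))
   | inr i0 => inr (rshift 1 i0) end =
   rename (lift_perm ord0 ord0 s) (lift_perm ord0 ord0 t)
     (match y with
   | inl r => inl (cast_ord (addnS 1 b) (rshift 1 r))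
   | inr i0 => inr (rshift 1 i0) end).
  by case: y => r /=; rewrite ?sinkE ?intE lift_perm_lift.
by rewrite !B /p; case: (f _).
Qed.

(** Grafting consumes the sink [x], renamed [y], so only the permutation [r] of the other sinks
    survives, placed behind the two sinks of the wedge. *)
Lemma graft_r_transform b l (w : kgraph 2 1) x y (r : 'S_b) t f
    (h : kgraph b.+1 l) v :
  graft_r w (transform (lift_perm x y r) t f h) y v =
  transform (lift_perm ord0 ord0 (lift_perm ord0 ord0 r))
    (lift_perm ord0 ord0 t) (lift_flips f) (graft_r w h x v).
Proof.
have sinkE (z : 'I_b) : rshift 2 z = lift ord0 (lift ord0 z) :> 'I_(2 + b).
  exact: val_inj.
have sinkl (z : 'I_2) : (lift_perm ord0 ord0 (lift_perm ord0 ord0 r)) (lshift b z) = lshift b z.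
  case: (unliftP ord0 z) => [z'|] ->.
    rewrite (_ : @lshift 2 b _ = (lift ord0 ord0 : 'I_b.+2)); last by apply: val_inj; rewrite ord1.
    by rewrite lift_perm_lift lift_perm_id.
  by rewrite (_ : @lshift 2 b _ = (ord0 : 'I_b.+2)) ?lift_perm_id //; apply: val_inj.
have intE (i : 'I_l) : rshift 1 i = lift ord0 i :> 'I_l.+1 by apply: val_inj.
have int0 (i : 'I_1) : lshift l i = ord0 :> 'I_l.+1.
  by apply: val_inj; rewrite ord1.
apply/ffunP => i; rewrite !ffunE /= !ffunE lift_permV !splitE1.
case: (unliftP ord0 i) => [j|] ->; last first.
  rewrite lift_perm_id !unlift_none /=.
  have A (z : vertex 2 1) : match z with
    | inl q => inl (lshift b q : 'I_(2 + b))
    | inr i0 => inr (lshift l i0) end =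
    rename (lift_perm ord0 ord0 (lift_perm ord0 ord0 r)) (lift_perm ord0 ord0 t)
     (match z with
    | inl q => inl (lshift b q : 'I_(2 + b))
    | inr i0 => inr (lshift l i0) end).
    by case: z => [q|i0] /=; rewrite ?sinkl // int0 lift_perm_id.
  by rewrite -!A.
rewrite lift_perm_lift !liftK /= !ffunE.
set p := h _.
have B (z : vertex b.+1 l) : match rename (lift_perm x y r) t z with
   | inl q => if unlift y q is Some q' then inl (rshift 2 q' : 'I_(2 + b))
              else inr (lshift l v)
   | inr i0 => inr (rshift 1 i0) end =
   rename (lift_perm ord0 ord0 (lift_perm ord0 ord0 r)) (lift_perm ord0 ord0 t)
     (match z with
   | inl q => if unlift x q is Some q' then inl (rshift 2 q' : 'I_(2 + b))
              else inr (lshift l v)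
   | inr i0 => inr (rshift 1 i0) end).
  case: z => [q|i0] /=; last by rewrite !intE lift_perm_lift.
  case: (unliftP x q) => [q'|] ->.
    by rewrite lift_perm_lift liftK /= !sinkE !lift_perm_lift.
  by rewrite lift_perm_id unlift_none /= int0 lift_perm_id.
by rewrite !B /p; case: (f _).
Qed.

Lemma skew_schouten_transform b l (w : kgraph 2 1) s t f (h : kgraph b.+1 l) :
  skew (schouten_graph R w (transform s t f h)) =
  tsign s f *: skew (schouten_graph R w h).
Proof.
rewrite /schouten_graph !skewB scalerBr; congr (_ - _).
  rewrite !skew_sum scaler_sumr; apply: eq_bigr => x _.
  rewrite !skew_sum scaler_sumr /= (reindex_inj (@perm_inj _ t)).
  apply: eq_bigr => v _ /=.
  rewrite !skewZ graft_l_transform skew_transform.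
  rewrite /tsign odd_lift_perm prod_lift_flips addbb.
  by rewrite !scalerA mulrC.
rewrite !skew_sum scaler_sumr (reindex_inj (@perm_inj _ s)).
apply: eq_bigr => x _; rewrite !skew_sum scaler_sumr /=.
apply: eq_bigr => v _.
(* Deleting the sink [x] and its image changes the parity of [s] by [x + s x], which is exactly the
   discrepancy between the two Schouten signs. *)
have [r sE] := perm_eq_lift s x.
rewrite !skewZ {2}sE graft_r_transform skew_transform !scalerA.
congr (_ *: _); rewrite /tsign !odd_lift_perm !addbb /= prod_lift_flips.
rewrite [in RHS]sE odd_lift_perm !signr_addb !signr_odd.
rewrite mulrA [RHS]mulrC !mulrA; congr (_ * _).
by rewrite -expr2 sqrr_sign mul1r.
Qed.

Definition wedge_graph : kgraph 2 1 := [ffun=> (inl ord0, inl ord_max)].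

Lemma schouten_flip b l (h : kgraph b.+1 l) :
  skew (schouten_graph R (transform 1 1 [ffun=> true] wedge_graph) h) =
  - skew (schouten_graph R wedge_graph h).
Proof.
pose F : {ffun 'I_(1 + l) -> bool} := [ffun i => if unlift ord0 i is Some _ then false else true].
have FE : tsign (1 : 'S_b.+2) F = -1.
  rewrite /tsign odd_perm1 mul1r big_ord_recl ffunE unlift_none expr1 big1 ?mulr1 // => i _.
  by rewrite ffunE liftK.
have idR n k (y : vertex n k) : rename 1 1 y = y by case: y => z /=; rewrite perm1.
have E1 x v : graft_l (transform 1 1 [ffun=> true] wedge_graph) h x v =
   transform 1 1 F (graft_l wedge_graph h x v).
  apply/ffunP => i; rewrite !ffunE /= !ffunE invg1 !perm1 !splitE1 !idR.
  by case: unliftP => [j|] _; rewrite /= ?ffunE //= ?invg1 ?perm1 ?ffunE ?idR.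
have E2 x v : graft_r (transform 1 1 [ffun=> true] wedge_graph) h x v =
   transform 1 1 F (graft_r wedge_graph h x v).
  apply/ffunP => i; rewrite !ffunE /= !ffunE invg1 !perm1 !splitE1 !idR.
  by case: unliftP => [j|] _; rewrite /= ?ffunE //= ?invg1 ?perm1 ?ffunE ?idR.
rewrite /schouten_graph !skewB opprD; congr (_ - _).
  rewrite !skew_sum -sumrN; apply: eq_bigr => x _.
  rewrite !skew_sum -sumrN; apply: eq_bigr => v _.
  by rewrite !skewZ E1 skew_transform FE scaleN1r scalerN.
rewrite !skew_sum -sumrN; apply: eq_bigr => x _.
rewrite !skew_sum -sumrN; apply: eq_bigr => v _.
by rewrite !skewZ E2 skew_transform FE scaleN1r scalerN.
Qed.

Lemma perm2E (s : 'S_2) :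
  (s ord0 = if s then ord_max else ord0) *
  (s ord_max = if s then ord0 else ord_max).
Proof.
have [r sE] := perm_eq_lift s ord0.
have r1 : odd_perm r = false.
  by rewrite (_ : r = 1%g) ?odd_perm1 //; apply/permP => i; rewrite [LHS]ord1 [RHS]ord1.
have o : (s : bool) = odd (s ord0) by rewrite {1}sE odd_lift_perm r1 addbF.
have : s ord0 != s ord_max by rewrite (inj_eq perm_inj).
by rewrite o; case: (s ord0) (s ord_max) => [[|[|?]] ?] // [[|[|?]] ?] // _ /=;
  split; apply: val_inj.
Qed.

(** For the wedge, exchanging the sinks and exchanging Left with Right are the same operation. Its
    orbit has two elements, so [schouten_flip] settles the sign rule in the first argument of the
    bracket. *)
Lemma transform_wedge s t f :
  transform s t f wedge_graph =
  if s (+) f ord0 then transform 1 1 [ffun=> true] wedge_graph else wedge_graph.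
Proof.
apply/ffunP => i; rewrite ffunE /= [(t^-1)%g i]ord1 (ord1 i).
case: (f ord0) (perm2E s); case: (odd_perm s) => -[s0 s1];
  rewrite /= ?ffunE /= ?ffunE /= ?s0 ?s1 ?perm1 //.
Qed.

Lemma wedgeE : wedge R = skew (gen R wedge_graph).
Proof.
rewrite /wedge; congr (skew (gen R _)); apply/ffunP => i.
rewrite !ffunE [i]ord1 /=; congr (_, _).
  by rewrite (_ : inord 0 = lshift 1 (ord0 : 'I_2)) ?(unsplitK (inl _)) //;
    apply: val_inj; rewrite /= inordK.
by rewrite (_ : inord 1 = lshift 1 (ord_max : 'I_2)) ?(unsplitK (inl _)) //;
  apply: val_inj; rewrite /= inordK.
Qed.

(** [skew_average] in each argument drops both inner projectors: the bracket can be computed from a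
    single representative of each class. *)
Lemma bracket_skew n k (g : kgraph n.+1 k) :
  bracket_P R n k (skew (gen R g)) = skew (schouten_graph R wedge_graph g).
Proof.
transitivity (@schouten R 1 1 n k (wedge R) (skew (gen R g))).
  exact: (lfunE (@schouten R 1 1 n k (wedge R))).
rewrite /schouten wedgeE.
transitivity (\sum_w skew (gen R wedge_graph) w *: \sum_h skew (gen R g) h *:
   skew (schouten_graph R w h)).
  rewrite skew_sum; apply: eq_bigr => w _.
  rewrite skew_sum scaler_sumr; apply: eq_bigr => h _.
  by rewrite skewZ scalerA.
transitivity (\sum_w skew (gen R wedge_graph) w *: skew (schouten_graph R w g)).
  apply: eq_bigr => w _; congr (_ *: _).
  apply: (skew_average (F := fun h => skew (schouten_graph R w h))) => s t f.
  exact: skew_schouten_transform.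
have := @skew_average 2 1 _ (fun w => skew (schouten_graph R w g)) wedge_graph.
apply => s t f.
rewrite transform_wedge /tsign big_ord_recl big_ord0 mulr1 -signr_addb.
case: (_ (+) _); first by rewrite schouten_flip scaleN1r.
by rewrite scale1r.
Qed.

End SkewSymmetry.

(** * Codes and shadows *)

(* A shadow forgets which sink is which: target 0 stands for any sink and i.+1 for
   the internal vertex i. Up to sign, a multi-vector depends only on the shadow. *)
Definition vx := (nat + nat)%type.
Definition code := seq (vx * vx).
Definition shadow := seq (nat * nat).

Definition vx0 : vx * vx := (inl 0%N, inl 0%N).
Definition shv (v : vx) : nat := if v is inr i then i.+1 else 0%N.
Definition shadow_of (c : code) : shadow := [seq (shv p.1, shv p.2) | p <- c].
Definition sink_of (v : vx) : option nat := if v is inl s then Some s else None.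
Definition targets (c : code) : seq vx := flatten [seq [:: p.1; p.2] | p <- c].
Definition sinks (c : code) : seq nat := pmap sink_of (targets c).
Definition map_pair (S T : Type) (h : S -> T) (p : S * S) : T * T := (h p.1, h p.2).

Definition in_range k (v : vx) : bool := if v is inr i then (i < k)%N else true.
Definition valid n k (c : code) : bool :=
  [&& size c == k, all (in_range k) (targets c) & perm_eq (sinks c) (iota 0 n)].

Definition relab (o : seq nat) (v : vx) : vx :=
  match v with inl s => inl s | inr i => inr (index i o) end.
Definition relab_code (o : seq nat) (c : code) : code :=
  [seq map_pair (relab o) (nth vx0 c j) | j <- o].
Definition relab_sinks (l : seq nat) (v : vx) : vx :=
  match v with inl s => inl (index s l) | inr i => inr i end.

Definition unsorted (p : vx * vx) : bool := (shv p.2 < shv p.1)%N.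
Definition sort_pair (p : vx * vx) : vx * vx := flip (unsorted p) p.
Definition flip_parity (c : code) : bool := foldr (fun p => addb (unsorted p)) false c.

Fixpoint perm_parity (l : seq nat) : bool :=
  if l is x :: l' then odd (count (fun y => y < x)%N l') (+) perm_parity l' else false.

(** The chosen representative of a shadow: taking the sinks in reading order gives its class a
    definite sign. *)
Fixpoint fill (r : nat) (s : shadow) : code :=
  match s with
  | [::] => [::]
  | (a, b) :: s' =>
    let: (va, r1) := if a is i.+1 then (inr i, r) else (inl r : vx, r.+1) in
    let: (vb, r2) := if b is i.+1 then (inr i, r1) else (inl r1 : vx, r1.+1) in
    (va, vb) :: fill r2 s'
  end.

(** Here [o] lists the old vertices in their new order. The sign collects the flips that sort the
    pairs and the permutation that brings the sinks into reading order. *)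
Definition normal_form (o : seq nat) (c : code) : bool * shadow :=
  let c2 := [seq sort_pair p | p <- relab_code o c] in
  (flip_parity (relab_code o c) (+) perm_parity (sinks c2), shadow_of c2).

Definition to_vertex n k (v : vx) : vertex n.+1 k.+1 :=
  match v with inl s => inl (inord s) | inr i => inr (inord i) end.
Definition to_graph n k (c : code) : kgraph n.+1 k.+1 :=
  [ffun i : 'I_k.+1 => map_pair (@to_vertex n k) (nth vx0 c i)].

Definition of_vertex n k (v : vertex n k) : vx :=
  match v with inl s => inl (s : nat) | inr i => inr (i : nat) end.
Definition of_graph n k (g : kgraph n k) : code :=
  [seq map_pair (@of_vertex n k) (g i) | i <- enum 'I_k].

Lemma of_vertexK n k : cancel (@of_vertex n.+1 k.+1) (@to_vertex n k).
Proof. by case=> x /=; rewrite inord_val. Qed.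

Lemma nth_of_graph n k (g : kgraph n k) (i : 'I_k) :
  nth vx0 (of_graph g) i = map_pair (@of_vertex n k) (g i).
Proof. by rewrite (nth_map i) ?size_enum_ord // nth_ord_enum. Qed.

Lemma of_graphK n k : cancel (@of_graph n.+1 k.+1) (@to_graph n k).
Proof.
move=> g; apply/ffunP => i; rewrite ffunE nth_of_graph /map_pair /= !of_vertexK.
by case: (g i).
Qed.

Lemma list_perm n (l : seq nat) : perm_eq l (iota 0 n) ->
  exists p : 'S_n, forall i : 'I_n, nth 0 l i = p i :> nat.
Proof.
move=> pl; have sl : size l = n by rewrite (perm_size pl) size_iota.
case: n pl sl => [|n] pl sl; first by exists 1%g => -[].
have lt (i : 'I_n.+1) : (nth 0 l i < n.+1)%N.
  have: nth 0%N l i \in l by apply: mem_nth; rewrite sl.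
  by rewrite (perm_mem pl) mem_iota.
have pI : injective (fun i : 'I_n.+1 => Ordinal (lt i)).
  move=> i j /(congr1 val) /= /eqP; rewrite nth_uniq ?sl //; first by move/eqP/val_inj.
  by rewrite (perm_uniq pl) iota_uniq.
by exists (perm pI) => i; rewrite permE.
Qed.

Lemma index_list_perm n (l : seq nat) (p : 'S_n) :
    perm_eq l (iota 0 n) -> (forall i : 'I_n, nth 0 l i = p i :> nat) ->
  forall i : 'I_n, index (i : nat) l = (p^-1)%g i :> nat.
Proof.
move=> pl pE i; have sl : size l = n by rewrite (perm_size pl) size_iota.
rewrite -{1}(permKV p i) -pE index_uniq ?sl //.
by rewrite (perm_uniq pl) iota_uniq.
Qed.

Lemma count_iota_lt n x : (x <= n)%N -> count (fun y => y < x)%N (iota 0 n) = x.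
Proof.
move=> xn; rewrite -{1}(subnKC xn) iotaD count_cat (_ : count _ (iota 0 x) = x).
  rewrite (_ : count _ _ = 0%N) ?addn0 //; apply/eqP; rewrite -leqn0 leqNgt -has_count.
  by apply/hasPn => y; rewrite mem_iota => /andP[xy _]; rewrite -leqNgt.
by apply/eqP; rewrite -[X in _ == X](size_iota 0 x) -all_count; apply/allP => y; rewrite mem_iota.
Qed.

(** Splitting off the first entry [x] contributes the parity of [x], which is the number of smaller
    entries after it; [unbump x] closes the gap left among the others. *)
Lemma odd_list_perm n (l : seq nat) (p : 'S_n) :
    perm_eq l (iota 0 n) -> (forall i : 'I_n, nth 0 l i = p i :> nat) ->
  odd_perm p = perm_parity l.
Proof.
elim: n l p => [|n IH] l p pl pE.
  have -> : p = 1%g by apply/permP => -[].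
  by rewrite odd_perm1; move/perm_nilP: pl => ->.
case: l pl pE => [|x l] pl pE; first by move/perm_size: pl; rewrite size_iota.
have [r pr] := perm_eq_lift p ord0.
have x0 : x = p ord0 by rewrite -pE.
have ux : uniq (x :: l) by rewrite (perm_uniq pl) iota_uniq.
have xl : x \notin l by move: ux => /andP[].
have sl : size l = n by move/perm_size: pl; rewrite /= size_iota => -[].
have rE (i : 'I_n) : nth 0 [seq unbump x y | y <- l] i = r i :> nat.
  rewrite (nth_map 0%N) ?sl //; have := pE (lift ord0 i).
  by rewrite lift0 {1}pr lift_perm_lift /= -x0 => ->; rewrite bumpK.
have pr' : perm_eq [seq unbump x y | y <- l] (iota 0 n).
  have -> : [seq unbump x y | y <- l] = [seq val (r i) | i <- enum 'I_n].
    apply: (@eq_from_nth _ 0%N); first by rewrite [LHS]size_map [RHS]size_map size_enum_ord.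
    rewrite size_map sl => i li.
    rewrite (nth_map (Ordinal li)) ?size_enum_ord //  (nth_ord_enum _ (Ordinal li)).
    exact: (rE (Ordinal li)).
  have -> : iota 0 n = [seq val i | i <- enum 'I_n] by rewrite val_enum_ord.
  rewrite (map_comp val r); apply: perm_map; apply: uniq_perm.
  - by rewrite (map_inj_uniq perm_inj) enum_uniq.
  - exact: enum_uniq.
  move=> i; rewrite mem_enum; apply/mapP; exists ((r^-1)%g i); rewrite ?mem_enum //.
  by rewrite permKV.
rewrite pr odd_lift_perm (IH _ _ pr' rE) /= -x0; congr (_ (+) _).
  have -> : count (fun y => y < x)%N l = count (fun y => y < x)%N (x :: l).
    by rewrite /= ltnn.
  by rewrite (seq.permP pl) count_iota_lt // x0 ltnW.
(* Closing the gap at [x] preserves the order of all entries other than [x], hence the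
   inversions. *)
elim: {ux sl rE pr' pE pl} l xl => //= y l IHl; rewrite inE negb_or => /andP[xy xl].
rewrite IHl // count_map; congr (odd _ (+) _).
apply: eq_in_count => z zl /=.
have xz : x != z by apply: contraNneq xl => ->.
by rewrite /unbump; lia.
Qed.

(** * Signs of normal forms *)

Section NormalForm.
Variable R : realFieldType.

Definition vec n k (c : code) : gsum R n.+1 k.+1 := skew (gen R (to_graph n k c)).
Definition class n k (s : shadow) : gsum R n.+1 k.+1 := vec n k (fill 0 s).

Lemma all_targets (P : pred vx) c :
  all P (targets c) = all (fun p => P p.1 && P p.2) c.
Proof. by elim: c => //= p c <-; rewrite andbA. Qed.

Lemma sinks_cons p c : sinks (p :: c) = pmap sink_of [:: p.1; p.2] ++ sinks c.
Proof. by rewrite /sinks -pmap_cat. Qed.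

Lemma nth_in_range k c i : all (in_range k) (targets c) ->
  in_range k (nth vx0 c i).1 && in_range k (nth vx0 c i).2.
Proof.
rewrite all_targets => /allP h; have [lt|ge] := ltnP i (size c).
  exact: (h _ (mem_nth vx0 lt)).
by rewrite nth_default.
Qed.

(** New vertex [i] is old vertex [p i], so that labels move by the inverse of [p]. *)
Lemma to_graph_relab n k o c (p : 'S_k.+1) :
    perm_eq o (iota 0 k.+1) -> (forall i : 'I_k.+1, nth 0 o i = p i :> nat) ->
    all (in_range k.+1) (targets c) ->
  to_graph n k (relab_code o c) = transform 1 (p^-1)%g [ffun=> false] (to_graph n k c).
Proof.
move=> po pE cin.
have so : size o = k.+1 by rewrite (perm_size po) size_iota.
have vE v : in_range k.+1 v -> to_vertex n k (relab o v) =
    rename 1 (p^-1)%g (to_vertex n k v).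
  case: v => [s|i] /=; first by rewrite perm1.
  move=> ik; have := index_list_perm po pE (inord i).
  rewrite inordK // => e; congr inr; apply: ord_inj; rewrite -e inordK //.
  by rewrite -so index_mem (perm_mem po) mem_iota.
apply/ffunP => i.
rewrite !ffunE /= invgK ffunE (nth_map 0%N) ?so // pE /map_pair.
by have /andP[a b] := nth_in_range (p i) cin; rewrite ?ffunE /= !vE.
Qed.

Lemma vec_relab n k o c :
    perm_eq o (iota 0 k.+1) -> all (in_range k.+1) (targets c) ->
  vec n k (relab_code o c) = vec n k c.
Proof.
move=> po cin; have [p pE] := list_perm po.
rewrite /vec (to_graph_relab n po pE cin) skew_transform.
rewrite /tsign odd_perm1 mul1r big1 ?scale1r // => i _.
by rewrite ffunE.
Qed.

Lemma vec_flip n k (F : vx * vx -> bool) c : size c = k.+1 ->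
  vec n k [seq flip (F p) p | p <- c] =
  (-1) ^+ foldr (fun p => addb (F p)) false c *: vec n k c.
Proof.
move=> sc.
have -> : vec n k [seq flip (F p) p | p <- c] =
    skew (gen R (transform 1 1 [ffun i : 'I_k.+1 => F (nth vx0 c i)] (to_graph n k c))).
  congr (skew (gen R _)); apply/ffunP => i.
  rewrite !ffunE /= invg1 perm1 !ffunE (nth_map vx0) ?sc //.
  have idR (y : vertex n.+1 k.+1) : rename 1 1 y = y by case: y => z /=; rewrite perm1.
  by case: (F _); rewrite /= !idR.
rewrite skew_transform /tsign odd_perm1 mul1r; congr (_ *: _).
transitivity (\prod_(p <- c) (-1) ^+ F p : R).
  rewrite (big_nth vx0) sc big_mkord; apply: eq_bigr => i _.
  by rewrite ffunE.
elim: {sc} c => [|p c IH]; first by rewrite big_nil.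
by rewrite big_cons IH /= signr_addb.
Qed.

(** Flipping a vertex whose two arrows coincide fixes the graph and negates its class; 2 is
    invertible in [R]. *)
Lemma vec_zero n k c i : size c = k.+1 -> (i < k.+1)%N ->
  (nth vx0 c i).1 = (nth vx0 c i).2 -> vec n k c = 0.
Proof.
move=> sc ik e.
have : vec n k c = - vec n k c.
  rewrite -scaleN1r {1}/vec (_ : to_graph n k c =
      transform 1 1 [ffun j => j == Ordinal ik] (to_graph n k c)); last first.
    apply/ffunP => j.
    rewrite !ffunE /= invg1 perm1 !ffunE.
    have idR (y : vertex n.+1 k.+1) : rename 1 1 y = y by case: y => z /=; rewrite perm1.
    by case: eqP => [->|_] /=; rewrite !idR /map_pair /= ?e.
  rewrite skew_transform; congr (_ *: _).
  rewrite /tsign odd_perm1 mul1r (bigD1 (Ordinal ik)) //= ffunE eqxx big1 ?mulr1 // => j.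
  by rewrite ffunE => /negPf ->.
by move/eqP; rewrite -addr_eq0 -mulr2n -scaler_nat scaler_eq0 pnatr_eq0 /= => /eqP.
Qed.

Lemma to_graph_sinks n k l c (p : 'S_n.+1) :
    perm_eq l (iota 0 n.+1) -> (forall i : 'I_n.+1, nth 0 l i = p i :> nat) ->
    all (fun s => s < n.+1)%N (sinks c) -> size c = k.+1 ->
  to_graph n k [seq map_pair (relab_sinks l) q | q <- c] =
  transform (p^-1)%g 1 [ffun=> false] (to_graph n k c).
Proof.
move=> pl pE cin sc.
have sl : size l = n.+1 by rewrite (perm_size pl) size_iota.
have {}cin : all (fun v : vx => if v is inl s then (s < n.+1)%N else true) (targets c).
  rewrite /sinks in cin; elim: (targets c) cin => //= -[s|i] t IH //=.
  by case/andP=> -> /IH.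
have vE (v : vx) : (if v is inl s then (s < n.+1)%N else true) ->
    to_vertex n k (relab_sinks l v) = rename (p^-1)%g 1 (to_vertex n k v).
  case: v => [s|i] /=; last by rewrite perm1.
  move=> ik; have := index_list_perm pl pE (inord s).
  rewrite inordK // => e; congr inl; apply: ord_inj.
  by rewrite -e inordK // -sl index_mem (perm_mem pl) mem_iota.
apply/ffunP => i.
rewrite !ffunE /= invg1 perm1 ffunE (nth_map vx0) ?sc // /map_pair /=.
have ic : (i < size c)%N by rewrite sc.
rewrite all_targets in cin; have /andP[a b] := allP cin _ (mem_nth vx0 ic).
by rewrite ?ffunE /= !vE.
Qed.

Lemma vec_sinks n k l c :
    perm_eq l (iota 0 n.+1) -> all (fun s => s < n.+1)%N (sinks c) -> size c = k.+1 ->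
  vec n k [seq map_pair (relab_sinks l) p | p <- c] =
  (-1) ^+ perm_parity l *: vec n k c.
Proof.
move=> pl cin sc; have [p pE] := list_perm pl.
rewrite /vec (to_graph_sinks pl pE cin sc) skew_transform.
rewrite /tsign odd_permV (odd_list_perm pl pE) big1 ?mulr1 // => i _.
by rewrite ffunE.
Qed.

(** Generalised for induction: [l] holds the sinks met so far, and the number that [fill] gives to a
    sink is its position in [l ++ sinks c]. *)
Lemma fill_shadow_of l c : uniq (l ++ sinks c) ->
  fill (size l) (shadow_of c) =
  [seq map_pair (relab_sinks (l ++ sinks c)) p | p <- c].
Proof.
have fresh (m r : seq nat) (s : nat) : uniq (m ++ s :: r) -> index s (m ++ s :: r) = size m.
  rewrite cat_uniq => /and3P[_ /hasPn h _].
  by rewrite index_cat (negPf (h s _)) ?mem_head //= eqxx addn0.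
elim: c l => // -[a b] c IH l; rewrite sinks_cons /=.
have IHr m : uniq (m ++ sinks c) -> fill (size m) (shadow_of c) = _ := IH m.
case: a b => [s|i] [t|j] /= u.
- have := IHr (l ++ [:: s; t]); rewrite -catA size_cat addn2 => -> //.
  rewrite {2 3}/map_pair /= fresh //.
  have := fresh (l ++ [:: s]) (sinks c) t; rewrite -catA size_cat addn1 => -> //.
- have := IHr (l ++ [:: s]); rewrite -catA size_cat addn1 => -> //.
  by rewrite {2 3}/map_pair /= fresh.
- have := IHr (l ++ [:: t]); rewrite -catA size_cat addn1 => -> //.
  by rewrite {2 3}/map_pair /= fresh.
by rewrite IHr.
Qed.

Lemma sinks_flatten c :
  sinks c = flatten [seq pmap sink_of [:: p.1; p.2] | p <- c].
Proof. by elim: c => // p c IH; rewrite sinks_cons IH. Qed.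

Lemma perm_sinks c c' : perm_eq c c' -> perm_eq (sinks c) (sinks c').
Proof. by move=> h; rewrite !sinks_flatten perm_flatten // perm_map. Qed.

Lemma sinks_flip (F : vx * vx -> bool) c :
  perm_eq (sinks [seq flip (F p) p | p <- c]) (sinks c).
Proof.
elim: c => // p c IH; rewrite /= !sinks_cons perm_cat //.
by case: p => -[s|i] [t|j]; case: (F _) => //=; rewrite (perm_catC [:: t] [:: s]).
Qed.

Lemma sinks_relab o c : perm_eq o (iota 0 (size c)) ->
  perm_eq (sinks (relab_code o c)) (sinks c).
Proof.
move=> po.
have -> : sinks (relab_code o c) = sinks [seq nth vx0 c j | j <- o].
  rewrite /relab_code; elim: {2 3}o => // j o' IH; rewrite /= !sinks_cons IH; congr (_ ++ _).
  by case: (nth vx0 c j) => -[s|i] [t|i'].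
apply: perm_sinks; apply: perm_trans (perm_map _ po) _.
by rewrite -/(mkseq _ _) mkseq_nth.
Qed.

Lemma class_normal_form n k o c :
    perm_eq o (iota 0 k.+1) -> valid n.+1 k.+1 c ->
  vec n k c = (-1) ^+ (normal_form o c).1 *: class n k (normal_form o c).2.
Proof.
move=> po /and3P[/eqP sc cin ps].
have pr := sinks_relab (c := c); rewrite sc in pr; have {}pr := pr _ po.
have so : size o = k.+1 by rewrite (perm_size po) size_iota.
set c1 := relab_code o c in pr.
set c2 := [seq sort_pair p | p <- c1].
have p2 : perm_eq (sinks c2) (iota 0 n.+1).
  exact: perm_trans (sinks_flip _ _) (perm_trans pr ps).
have s1 : size c1 = k.+1 by rewrite size_map.
rewrite /class [(normal_form o c).2]/(shadow_of c2).
have -> : fill 0 (shadow_of c2) = fill (size (Nil nat)) (shadow_of c2) by [].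
rewrite fill_shadow_of ?(perm_uniq p2) ?iota_uniq // vec_sinks ?size_map //; last first.
  by apply/allP => x; rewrite (perm_mem p2) mem_iota.
rewrite vec_flip // vec_relab // !scalerA -!signr_addb /normal_form /= -/c1 -/c2.
by rewrite addbAC -addbA !addbb scale1r.
Qed.

End NormalForm.

(** * Canonical forms and integer combinations of shadows *)

Definition loop (p : vx * vx) : bool :=
  match p with (inr i, inr j) => eqn i j | _ => false end.

Fixpoint eqsh (s t : shadow) : bool :=
  match s, t with
  | [::], [::] => true
  | (a, b) :: s', (c, d) :: t' => [&& eqn a c, eqn b d & eqsh s' t']
  | _, _ => false
  end.

Fixpoint ltsh (s t : shadow) : bool :=
  match s, t with
  | (a, b) :: s', (c, d) :: t' =>
    if eqn a c then (if eqn b d then ltsh s' t' else Nat.ltb b d) else Nat.ltb a c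
  | _, _ => false
  end.

(** Encodes the pair formed by the in-degree and the number of arrows to sinks; the latter is at
    most 2, hence the factor 3. *)
Definition key (ts : seq nat) (i : nat) (p : nat * nat) : nat :=
  (3 * count (eqn i.+1) ts + (eqn p.1 0 + eqn p.2 0))%N.

Definition keyed (s : shadow) : seq (nat * nat) :=
  let ts := flatten [seq [:: p.1; p.2] | p <- s] in
  [seq (key ts i (nth (0, 0)%N s i), i) | i <- iota 0 (size s)].

(* The orderings of the vertices by nondecreasing key; the key is invariant under
   relabelling, so the least normal form over these orderings is canonical. *)
Fixpoint orders (fuel : nat) (r : seq (nat * nat)) : seq (seq nat) :=
  if fuel is fuel'.+1 then
    let m := foldr (fun x => minn x.1) (head (0, 0)%N r).1 r in
    flatten [seq [seq x.2 :: o | o <- orders fuel' [seq y <- r | ~~ eqn y.2 x.2]]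
            | x <- r & eqn x.1 m]
  else [:: unzip2 r].

(** [None] signals a vanishing class, for one of two reasons: a double edge into an internal vertex
    (this is what [loop] detects, not a tadpole), or an odd automorphism, seen as two orderings that
    reach the same least shadow with opposite signs. *)
Definition canon (c : code) : option (bool * shadow) :=
  if has loop c then None else
  let x := normal_form (iota 0 (size c)) c in
  let cs := [seq normal_form o c | o <- orders (size c) (keyed (shadow_of c))] in
  if cs is y :: cs' then
    let b := foldl (fun b z => if ltsh z.2 b.2 then z else b) y cs' in
    if has (fun z => (z.1 (+) b.1) && eqsh z.2 b.2) cs then None else Some b
  else Some x.

Definition poly := seq (int * shadow).

Fixpoint padd (c : int) (s : shadow) (p : poly) : poly :=
  if p is (d, t) :: q then
    if eqsh s t then (intZmod.addz c d, t) :: q else (d, t) :: padd c s q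
  else [:: (c, s)].

Definition reduce (ts : seq (int * code)) : poly :=
  foldr (fun x p => if canon x.2 is Some (b, s) then
                      padd (if b then intZmod.oppz x.1 else x.1) s p else p)
        [::] ts.

Definition shift_vx (a k : nat) (v : vx) : vx :=
  match v with inl s => inl (a + s)%N | inr i => inr (k + i)%N end.

Definition graft_sink (s : nat) (v : vx) : vx :=
  match v with
  | inl r => if eqn r s then inr 0%N else inl (unbump s r).+2
  | inr i => inr i.+1
  end.

(** The terms of [schouten_graph] with the wedge as first argument, its vertex being the new vertex
    0. With a = 1 the signs are -1 and 1 for the two sinks of the wedge, and minus (-1)^s for sink s
    of the graph. *)
Definition bracket_terms (n : nat) (c : code) : seq (int * code) :=
  let c1 := [seq map_pair (shift_vx 1 1) p | p <- c] in
  [seq (-1, (inr v.+1, inl 0%N) :: c1) | v <- iota 0 (size c)] ++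
  [seq (1, (inl 0%N, inr v.+1) :: c1) | v <- iota 0 (size c)] ++
  [seq (if odd s then 1 else -1 : int, (inl 0%N, inl 1%N) :: [seq map_pair (graft_sink s) p | p <- c])
  | s <- iota 0 n].

Fixpoint seqprod (T : Type) (ls : seq (seq T)) : seq (seq T) :=
  if ls is l :: ls' then
    let r := seqprod ls' in flatten [seq [seq x :: y | y <- r] | x <- l]
  else [:: [::]].

Definition leibniz_choices (m j : nat) (v : vx) : seq vx :=
  if v is inr i then if (i < m)%N then [:: v] else [:: v; inr (i + j)%N] else [:: v].

(* In the flat list of targets [l], those of the ordinary vertex p start at 2p and
   those of the Jacobiator q at 2m + 3q. *)
Definition jac_code (m j : nat) (l : seq vx) (r : seq nat) : code :=
  let x := nth (inl 0%N : vx) l in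
  [seq (x (2 * p)%N, x (2 * p).+1) | p <- iota 0 m] ++
  [seq (let b := nth 0%N r q in
        (x (2 * m + 3 * q + b)%N, x (2 * m + 3 * q + (b + 1) %% 3)%N)) | q <- iota 0 j] ++
  [seq (let b := nth 0%N r q in
        (inr (m + q)%N : vx, x (2 * m + 3 * q + (b + 2) %% 3)%N)) | q <- iota 0 j].

Definition expand_terms (m j : nat) (l : seq vx) : seq code :=
  let rs := seqprod (nseq j [:: 0; 1; 2]%N) in
  flatten [seq [seq jac_code m j t r | r <- rs]
          | t <- seqprod [seq leibniz_choices m j v | v <- l]].

(** Since 0 stands for any sink, the pair (0, 0) means two different sinks and is allowed. Other
    repetitions are double edges, and the target [i.+1] would be a tadpole. *)
Definition sorted_pairs (v i : nat) : seq (seq nat) :=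
  [seq l <- seqprod [:: iota 0 v.+1; iota 0 v.+1] |
    if l is [:: a; b] then [&& a != i.+1, b != i.+1 & (a < b)%N || (a == 0%N) && (b == 0%N)] else false].

Definition sorted_triples (v i : nat) : seq (seq nat) :=
  [seq l <- seqprod [:: iota 0 v.+1; iota 0 v.+1; iota 0 v.+1] |
    if l is [:: a; b; c] then
      [&& a != i.+1, b != i.+1, c != i.+1, (a < b)%N || (a == 0%N) && (b == 0%N)
        & (b < c)%N || (b == 0%N) && (c == 0%N)] else false].

Definition lshadows (n m j : nat) : seq (seq nat) :=
  [seq s <- [seq flatten l | l <- seqprod ([seq sorted_pairs (m + j) i | i <- iota 0 m] ++
                     [seq sorted_triples (m + j) i | i <- iota m j])]
   | count (eqn 0) s == n].

Fixpoint fill_flat (r : nat) (s : seq nat) : seq vx :=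
  if s is a :: s' then
    if a is i.+1 then inr i :: fill_flat r s' else inl r :: fill_flat r.+1 s'
  else [::].

Definition shadows (n k : nat) : seq (seq nat) :=
  [seq s <- [seq flatten l | l <- seqprod [seq sorted_pairs k i | i <- iota 0 k]]
   | count (eqn 0) s == n].

Fixpoint pair_up (T : Type) (l : seq T) : seq (T * T) :=
  if l is a :: b :: l' then (a, b) :: pair_up l' else [::].

Definition leibniz_poly m j (s : seq nat) : poly :=
  reduce [seq (1 : int, c) | c <- expand_terms m j (fill_flat 0 s)].
Definition bracket_poly n (s : shadow) : poly := reduce (bracket_terms n (fill 0 s)).

Lemma eqshP : Equality.axiom eqsh.
Proof.
elim=> [|[a b] s IH] [|[c d] t] /=; try by constructor.
rewrite !eqnE; case: eqP => [->|ac] /=; last by constructor=> -[/ac].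
case: eqP => [->|bd] /=; last by constructor=> -[/bd].
by apply: (iffP (IH t)) => [->|[]].
Qed.

Lemma orders_perm f r o :
  uniq (unzip2 r) -> o \in orders f r -> perm_eq o (unzip2 r).
Proof.
elim: f r o => [|f IH] r o ur /=; first by rewrite inE => /eqP ->.
case/flatten_mapP => x; rewrite mem_filter => /andP[_ xr] /mapP[o' o'in ->].
have xr2 : x.2 \in unzip2 r by apply: map_f.
have e : unzip2 [seq y <- r | ~~ eqn y.2 x.2] = rem x.2 (unzip2 r).
  by rewrite rem_filter // filter_map.
have := IH _ _ _ o'in; rewrite e rem_uniq // => /(_ isT) po.
by rewrite perm_sym (perm_trans (perm_to_rem xr2)) // perm_cons perm_sym.
Qed.

Lemma unzip2_keyed s : unzip2 (keyed s) = iota 0 (size s).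
Proof. by rewrite /unzip2 -map_comp map_id_in. Qed.

Lemma sum_iota (V : nmodType) m (F : nat -> V) :
  \sum_(i <- iota 0 m) F i = \sum_(i < m) F i.
Proof. by rewrite -(big_mkord xpredT) /index_iota subn0. Qed.

(** * Soundness of the integer computations *)

Section Evaluation.
Variable R : realFieldType.

Definition ev n k (p : poly) : gsum R n.+1 k.+1 :=
  \sum_(x <- p) x.1%:~R *: class R n k x.2.
Definition evc n k (ts : seq (int * code)) : gsum R n.+1 k.+1 :=
  \sum_(x <- ts) x.1%:~R *: vec R n k x.2.

Lemma canon_sound n k c : valid n.+1 k.+1 c ->
  vec R n k c = if canon c is Some (b, s) then (-1) ^+ b *: class R n k s else 0.
Proof.
move=> vc; have /and3P[/eqP sc _ _] := vc; rewrite /canon.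
case: ifP => [/(has_nthP vx0) [i]|_].
  rewrite sc => ik; case e: (nth vx0 c i) => [[?|a] [?|b]] //= /eqnP ab.
  by apply: (@vec_zero _ _ _ _ i) => //; rewrite e /= ab.
pose good (z : bool * shadow) := vec R n k c = (-1) ^+ z.1 *: class R n k z.2.
have gn o : perm_eq o (iota 0 k.+1) -> good (normal_form o c).
  by move=> po; apply: class_normal_form.
set os := orders _ _.
have go z : z \in [seq normal_form o c | o <- os] -> good z.
  case/mapP => o oin ->; apply: gn.
  have := orders_perm _ oin; rewrite unzip2_keyed size_map sc; apply.
  exact: iota_uniq.
case: [seq _ | _ <- _] go => [|y cs] go; first by have := gn _ (perm_refl _); rewrite sc /good; case: normal_form.
set b := foldl _ _ _.
have gb : good b.
  suff: b \in y :: cs by apply: go.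
  rewrite /b; elim: cs y {go b} => [|z cs IH] y /=; first by rewrite mem_head.
  have := IH (if ltsh z.2 y.2 then z else y).
  by rewrite !inE; case: ifP => _ /orP[->|->]; rewrite ?orbT.
(* If two orderings give the same shadow with opposite signs, the class equals its own negative. *)
case: ifP => [/hasP[z zin /andP[zb /eqshP e]]|_]; last by case: b gb.
have := go _ zin; rewrite /good e; move: gb; rewrite /good.
have -> : (-1) ^+ z.1 = - (-1) ^+ b.1 :> R.
  by case: (z.1) (b.1) zb => [] [] //; rewrite ?opprK.
move=> e1; rewrite scaleNr -e1 => /eqP.
by rewrite -addr_eq0 -mulr2n -scaler_nat scaler_eq0 pnatr_eq0 /= => /eqP.
Qed.

Lemma ev_padd n k c s p : ev n k (padd c s p) = c%:~R *: class R n k s + ev n k p.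
Proof.
elim: p => [|[d t] p IH] /=; first by rewrite /ev big_seq1 big_nil addr0.
case: eqshP => [->|_]; rewrite /ev !big_cons -/(ev n k _) /=.
  by rewrite -[intZmod.addz c d]/(c + d) intrD scalerDl addrA.
by rewrite IH addrCA.
Qed.

Lemma reduce_sound n k ts : all (fun x => valid n.+1 k.+1 x.2) ts ->
  evc n k ts = ev n k (reduce ts).
Proof.
elim: ts => [|[c x] ts IH] /=; first by rewrite /evc /ev !big_nil.
case/andP=> vx /IH {}IH; rewrite /evc big_cons -/(evc n k ts) IH (canon_sound vx) /=.
case: (canon x) => [[b s]|]; last by rewrite scaler0 add0r.
rewrite ev_padd; congr (_ + _); rewrite scalerA; congr (_ *: _).
case: b; last by rewrite mulr1.
by rewrite -[intZmod.oppz c]/(- c) intrN mulrN1.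
Qed.

Lemma vec_bracket n k c : valid n.+1 k.+1 c ->
  bracket_P R n k.+1 (vec R n k c) = evc n.+1 k.+1 (bracket_terms n.+1 c).
Proof.
case/and3P=> /eqP sc cin psk.
have {}psk : all (fun v : vx => if v is inl s then (s < n.+1)%N else true) (targets c).
  have : all (fun s => s < n.+1)%N (sinks c).
    by apply/allP => x; rewrite (perm_mem psk) mem_iota.
  rewrite /sinks; elim: (targets c) => //= -[s|i] t IH //=.
  by case/andP=> -> /IH.
have rng (i : 'I_k.+1) : (in_range k.+1 (nth vx0 c i).1 && in_range k.+1 (nth vx0 c i).2)
   * ((if (nth vx0 c i).1 is inl s then (s < n.+1)%N else true) &&
      (if (nth vx0 c i).2 is inl s then (s < n.+1)%N else true)).
  split; first exact: nth_in_range.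
  by rewrite all_targets in psk; apply: (allP psk); rewrite mem_nth ?sc.
have vE (y : vx) : in_range k.+1 y -> (if y is inl s then (s < n.+1)%N else true) ->
    match to_vertex n k y with
    | inl r => inl (cast_ord (addnS 1 n) (rshift 1 r))
    | inr i => inr (rshift 1 i) end = to_vertex n.+1 k.+1 (shift_vx 1 1 y).
  by case: y => s /= a b; [congr inl|congr inr]; apply: ord_inj; rewrite /= !inordK.
have gE (y : vx) (s : 'I_n.+1) (v : 'I_1) :
    in_range k.+1 y -> (if y is inl s then (s < n.+1)%N else true) ->
    match to_vertex n k y with
    | inl r => if unlift s r is Some r' then inl (rshift 2 r' : 'I_(2 + n))
               else inr (lshift k.+1 v)
    | inr i => inr (rshift 1 i) end = to_vertex n.+1 k.+1 (graft_sink s y).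
  case: y => [r|i] /= a b; last by congr inr; apply: ord_inj; rewrite /= !inordK.
  case: unliftP => [r'|] e.
    have er : r = bump s r' by rewrite -[LHS](@inordK n) // e.
    rewrite er eqnE eq_sym (negPf (neq_bump _ _)) bumpK /=.
    by congr inl; apply: ord_inj; rewrite /= inordK //; exact: (ltn_ord r').
  rewrite (_ : eqn r s) /=; last by rewrite -e eqnE inordK.
  by congr inr; apply: ord_inj; rewrite /= inordK // ord1.
rewrite bracket_skew /schouten_graph skewB /evc /bracket_terms !big_cat.
rewrite -[RHS]/(_ + (_ + _)) addrA; congr (_ + _).
  (* The arrow into sink 0, then sink 1, of the wedge is redirected to a vertex of [c]. *)
  rewrite skew_sum (@big_ord_recl _ _ _ 1) (@big_ord_recl _ _ _ 0) big_ord0 addr0.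
  congr (_ + _); rewrite skew_sum big_map sc sum_iota;
    apply: eq_bigr => v _; rewrite skewZ; congr (_ *: skew (gen R _)) => //.
  - apply/ffunP => i; rewrite !ffunE !splitE1; case: unliftP => [j|] ->.
      rewrite lift0 /= ffunE /= (nth_map vx0) ?sc //.
      have [/andP[a b] /andP[a' b']] := rng j.
      by rewrite /map_pair /= !vE.
    rewrite /wedge_graph ffunE /= unlift_none /map_pair /=; congr (_, _).
      by congr inr; apply: ord_inj; rewrite /= inordK // ltnS.
    rewrite (_ : ord_max = lift ord0 ord0); last exact: val_inj.
    by rewrite liftK; congr inl; apply: ord_inj; rewrite /= inordK.
  apply/ffunP => i; rewrite !ffunE !splitE1; case: unliftP => [j|] ->.
    rewrite lift0 /= ffunE /= (nth_map vx0) ?sc //.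
    have [/andP[a b] /andP[a' b']] := rng j.
    by rewrite /map_pair /= !vE.
  rewrite /wedge_graph ffunE /= /map_pair /=; congr (_, _).
    case: unliftP => [j|//] e; congr inl; apply: ord_inj; rewrite /= inordK //.
    by rewrite ord1.
  rewrite (_ : ord_max = lift ord0 ord0); last exact: val_inj.
  by rewrite unlift_none; congr inr; apply: ord_inj; rewrite /= inordK // ltnS.
(* The other half of the bracket: sink s of [c] falls on the wedge, and the minus sign is absorbed
   into the coefficient. *)
rewrite skew_sum -sumrN big_map sum_iota.
apply: eq_bigr => s _; rewrite skew_sum big_ord_recl big_ord0 addr0 skewZ.
rewrite -scaleNr; congr (_ *: skew (gen R _)).
  by rewrite -signr_odd; case: (odd s); rewrite ?opprK.
apply/ffunP => i; rewrite !ffunE !splitE1; case: unliftP => [j|] ->.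
  rewrite lift0 /= ffunE /= (nth_map vx0) ?sc //.
  have [/andP[a b] /andP[a' b']] := rng j.
  by rewrite /map_pair /= !gE.
rewrite /wedge_graph ffunE /= /map_pair /=; congr (_, _);
  by congr inl; apply: ord_inj; rewrite /= inordK.
Qed.

End Evaluation.

(** * Coefficients of classes and coordinate functionals *)

Definition eqvx (u v : vx) : bool :=
  match u, v with inl a, inl b | inr a, inr b => eqn a b | _, _ => false end.
Definition eqpair (p q : vx * vx) : bool := eqvx p.1 q.1 && eqvx p.2 q.2.

(** The product over the vertices of delta(p, q) minus delta(swapped p, q), that is, the signed sum
    over all flips done vertex by vertex. *)
Fixpoint dprod (c d : code) : int :=
  match c, d with
  | p :: c', q :: d' =>
    let sw := eqpair (p.2, p.1) q in
    if eqpair p q then (if sw then 0 else dprod c' d')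
    else if sw then intZmod.oppz (dprod c' d') else 0
  | _, _ => 1
  end.

Definition sumz (T : Type) (F : T -> int) (s : seq T) : int :=
  foldr (fun x => intZmod.addz (F x)) 0 s.

(** Up to the normalising factor of the projector, the coefficient of the graph of [d] in the
    skew-symmetrisation of that of [c]. *)
Definition pairing n k (c d : code) : int :=
  let ls := [seq (perm_parity l, l) | l <- permutations (iota 0 n)] in
  sumz (fun o => let c1 := relab_code o c in
    sumz (fun x : bool * seq nat =>
      let y := dprod [seq map_pair (relab_sinks x.2) p | p <- c1] d in
      if x.1 then intZmod.oppz y else y) ls) (permutations (iota 0 k)).

Definition eqcanon (x : option (bool * shadow)) (s : shadow) : bool :=
  if x is Some (false, t) then eqsh t s else false.

Definition canonical n k (s : shadow) : bool :=
  [&& valid n k (fill 0 s), all (fun p => p.1 <= p.2)%N s & eqcanon (canon (fill 0 s)) s].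

(* The class of [s] is nonzero at its own representative and no other canonical
   shadow occurs in its orbit, so that the coefficient at [s] reads off the coordinate
   of [class s] in a sum of canonical classes. *)
Definition separating n k (s : shadow) : bool :=
  let c := fill 0 s in
  [&& canonical n k s, pairing n k c c != 0
    & all (fun o => let t := (normal_form o c).2 in
             eqsh t s || ~~ eqcanon (canon (fill 0 t)) t) (permutations (iota 0 k))].

Lemma oppzE (x : int) : intZmod.oppz x = - x.
Proof. by []. Qed.

Lemma sumzE (T : Type) (F : T -> int) s : sumz F s = \sum_(x <- s) F x.
Proof. by elim: s => [|x s IH]; rewrite ?big_nil // big_cons -IH. Qed.

Lemma eqvxP : Equality.axiom eqvx.
Proof.
move=> [a|a] [b|b] /=; rewrite ?eqnE; try by constructor.
  by apply: (iffP eqP) => [->|[]].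
by apply: (iffP eqP) => [->|[]].
Qed.

Lemma eqpairE p q : eqpair p q = (p == q).
Proof.
case: p q => [a b] [c d]; rewrite /eqpair xpair_eqE /=.
by congr (_ && _); apply/eqvxP/eqP.
Qed.

Definition perm_list n (p : 'S_n) : seq nat := [seq val (p i) | i <- enum 'I_n].

Lemma nth_perm_list n (p : 'S_n) (i : 'I_n) : nth 0 (perm_list p) i = p i :> nat.
Proof. by rewrite /perm_list (nth_map i) ?size_enum_ord // nth_ord_enum. Qed.

Lemma perm_list_iota n (p : 'S_n) : perm_eq (perm_list p) (iota 0 n).
Proof.
have -> : iota 0 n = [seq val i | i <- enum 'I_n] by rewrite val_enum_ord.
rewrite /perm_list (map_comp val p); apply: perm_map.
apply: uniq_perm; rewrite ?enum_uniq //; first by rewrite (map_inj_uniq perm_inj) enum_uniq.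
move=> i; rewrite mem_enum; apply/mapP; exists ((p^-1)%g i); rewrite ?mem_enum //.
by rewrite permKV.
Qed.

Lemma sum_perm_list (V : nmodType) n (F : seq nat -> V) :
  \sum_(p : 'S_n) F (perm_list p) = \sum_(l <- permutations (iota 0 n)) F l.
Proof.
rewrite -(big_map (@perm_list n) xpredT F).
apply: perm_big; apply: uniq_perm; last first.
- move=> l; rewrite mem_permutations; apply/mapP/idP => [[p _ ->]|pl].
    exact: perm_list_iota.
  have [p pE] := list_perm pl; exists p; rewrite ?mem_index_enum //.
  have sl : size l = n by rewrite (perm_size pl) size_iota.
  apply: (@eq_from_nth _ 0%N); first by rewrite [RHS]size_map size_enum_ord.
  rewrite sl => i li.
  by rewrite -[i]/(val (Ordinal li)) (pE (Ordinal li)) nth_perm_list.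
- exact: permutations_uniq.
rewrite map_inj_uniq ?index_enum_uniq // => p q e; apply/permP => i; apply: ord_inj.
by rewrite -!nth_perm_list e.
Qed.

Section Pairing.
Variable R : realFieldType.

Lemma transform_inv n k (s : 'S_n) (t : 'S_k) (f : {ffun 'I_k -> bool}) (g : kgraph n k) :
  transform (s^-1)%g (t^-1)%g [ffun j => f ((t^-1)%g j)] (transform s t f g) = g.
Proof.
rewrite transform_transform !mulgV; apply/ffunP => i.
rewrite !ffunE /= invg1 perm1 !ffunE permK addbb /=.
have idR (y : vertex n k) : rename 1 1 y = y by case: y => z /=; rewrite perm1.
by rewrite !idR; case: (g i).
Qed.

(** The projector is self-adjoint: inverting the group elements exchanges the two graphs and keeps
    the signs. *)
Lemma skew_gen_sym n k (g h : kgraph n k) : skew (gen R g) h = skew (gen R h) g.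
Proof.
rewrite !skew_gen /skew_graph !ffunE; congr (_ * _).
rewrite !sum_ffunE (reindex_inj invg_inj); apply: eq_bigr => s _.
rewrite !sum_ffunE (reindex_inj invg_inj); apply: eq_bigr => t _.
pose F (f : {ffun 'I_k -> bool}) := [ffun j => f (t j)].
have FI : injective F.
  move=> f1 f2 /ffunP e; apply/ffunP => j.
  by have := e ((t^-1)%g j); rewrite !ffunE permKV.
rewrite !sum_ffunE [RHS](reindex_inj FI); apply: eq_bigr => f _.
rewrite !ffunE odd_permV; congr (_ * _ * _%:R).
  rewrite [LHS](reindex_inj (@perm_inj _ t)); apply: eq_bigr => i _.
  by rewrite ffunE.
congr nat_of_bool; apply/eqP/eqP => ->.
  have := transform_inv (s^-1)%g (t^-1)%g f g; rewrite !invgK => e.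
  by rewrite -[LHS]e; congr transform; apply/ffunP => j; rewrite !ffunE.
rewrite -[LHS](transform_inv s t (F f)); congr transform.
by apply/ffunP => j; rewrite !ffunE permKV.
Qed.

(** Flips at different vertices are independent, so by distributivity the sum over them is a product
    of two-term factors. *)
Lemma skew_gen_prod n k (g h : kgraph n k) :
  skew (gen R g) h = (n`! * k`! * 2 ^ k)%:R^-1 *
    \sum_(s : 'S_n) \sum_(t : 'S_k) (-1) ^+ s *
      \prod_(i < k) ((transform s t [ffun=> false] g i == h i)%:R
         - (flip true (transform s t [ffun=> false] g i) == h i)%:R).
Proof.
rewrite skew_gen /skew_graph ffunE; congr (_ * _).
rewrite sum_ffunE; apply: eq_bigr => s _.
rewrite sum_ffunE; apply: eq_bigr => t _.
rewrite sum_ffunE.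
pose G i (b : bool) : R := (-1) ^+ b * (flip b (transform s t [ffun=> false] g i) == h i)%:R.
transitivity (\sum_(f : {ffun 'I_k -> bool}) (-1) ^+ s * \prod_j G (t j) (f j)).
  apply: eq_bigr => f _; rewrite ffunE /= -[X in X = _]/(_ * _) -mulrA; congr (_ * _).
  rewrite big_split /=; congr (_ * _).
  rewrite ffunE.
  have tE j : transform s t f g (t j) = flip (f j) (transform s t [ffun=> false] g (t j)).
    by rewrite !ffunE /= permK !ffunE; case: (f j).
  case: eqP => [->|ne].
    by rewrite big1 // => j _; rewrite tE eqxx.
  have [j hj] : exists j, h (t j) != transform s t f g (t j).
    apply/existsP; apply: contraT; rewrite negb_exists => /forallP e; case: ne.
    by apply/ffunP => i; have := e ((t^-1)%g i); rewrite permKV negbK => /eqP.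
  by rewrite (bigD1 j) //= -tE eq_sym (negPf hj) mul0r.
rewrite -mulr_sumr -(bigA_distr_bigA (fun j b => G (t j) b)); congr (_ * _).
rewrite [RHS](reindex_inj (@perm_inj _ t)); apply: eq_bigr => j _.
by rewrite big_bool /G expr0 expr1 mul1r mulN1r addrC.
Qed.

Definition ok_vx n k (v : vx) : bool :=
  match v with inl s => (s < n)%N | inr i => (i < k)%N end.

Lemma valid_ok n k c : valid n k c -> all (ok_vx n k) (targets c).
Proof.
case/and3P=> _ cin ps.
have : all (fun s => s < n)%N (sinks c).
  by apply/allP => x; rewrite (perm_mem ps) mem_iota.
rewrite /sinks; elim: (targets c) cin => //= -[s|i] t IH /=.
  by move=> h /andP[-> /(IH h)].
by case/andP=> -> h /(IH h).
Qed.

Lemma to_vertex_inj n k : {in ok_vx n.+1 k.+1 &, injective (to_vertex n k)}.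
Proof.
move=> [a|a] [b|b] //; rewrite -!topredE /= => ha hb [e].
  by congr inl; rewrite -[LHS](inordK ha) e inordK.
by congr inr; rewrite -[LHS](inordK ha) e inordK.
Qed.

Lemma prod_dprod n k (c d : code) : size c = k.+1 -> size d = k.+1 ->
    all (ok_vx n.+1 k.+1) (targets c) -> all (ok_vx n.+1 k.+1) (targets d) ->
  \prod_(i < k.+1) ((to_graph n k c i == to_graph n k d i)%:R
     - (flip true (to_graph n k c i) == to_graph n k d i)%:R) = (dprod c d)%:~R :> R.
Proof.
move=> sc sd okc okd.
have pE p q : ok_vx n.+1 k.+1 p.1 && ok_vx n.+1 k.+1 p.2 ->
    ok_vx n.+1 k.+1 q.1 && ok_vx n.+1 k.+1 q.2 ->
    (map_pair (to_vertex n k) p == map_pair (to_vertex n k) q) = eqpair p q.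
  case: p q => [a b] [a' b'] /= /andP[ha hb] /andP[ha' hb'].
  rewrite eqpairE !xpair_eqE.
  by rewrite !(inj_in_eq (@to_vertex_inj n k)).
pose T (p q : vx * vx) : R :=
  (map_pair (to_vertex n k) p == map_pair (to_vertex n k) q)%:R
  - (map_pair (to_vertex n k) (p.2, p.1) == map_pair (to_vertex n k) q)%:R.
transitivity (\prod_(x <- zip c d) T x.1 x.2).
  rewrite (big_nth (vx0, vx0)) size_zip sc sd minnn big_mkord; apply: eq_bigr => i _.
  by rewrite nth_zip ?sc ?sd // !ffunE.
move: okc okd; rewrite !all_targets.
elim: c d {sc sd} => [|p c IH] [|q d] /=; rewrite ?big_nil //.
case/andP=> okp okc /andP[okq okd]; rewrite big_cons IH // /T !pE //=; last by rewrite andbC.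
case: (eqpair p q); case: (eqpair _ q) => /=.
- by rewrite subrr mul0r.
- by rewrite subr0 mul1r.
- by rewrite sub0r mulN1r oppzE intrN.
by rewrite subrr mul0r.
Qed.

Lemma ok_relab n k o c : size c = k -> perm_eq o (iota 0 k) ->
  all (ok_vx n k) (targets c) -> all (ok_vx n k) (targets (relab_code o c)).
Proof.
move=> sc po; rewrite !all_targets all_map => /allP h; apply/allP => j jo /=.
have so : size o = k by rewrite (perm_size po) size_iota.
have r1 v : ok_vx n k v -> ok_vx n k (relab o v).
  by case: v => //= i ik; rewrite -so index_mem (perm_mem po) mem_iota.
have lt : (j < size c)%N by move: jo; rewrite (perm_mem po) mem_iota sc.
by have /andP[a b] := h _ (mem_nth vx0 lt); rewrite !r1.
Qed.

Lemma ok_sinks n k l c : perm_eq l (iota 0 n) -> all (ok_vx n k) (targets c) ->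
  all (ok_vx n k) (targets [seq map_pair (relab_sinks l) p | p <- c]).
Proof.
move=> pl; rewrite !all_targets all_map => /allP h; apply/allP => p pc /=.
have sl : size l = n by rewrite (perm_size pl) size_iota.
have r1 v : ok_vx n k v -> ok_vx n k (relab_sinks l v).
  by case: v => //= s sn; rewrite -sl index_mem (perm_mem pl) mem_iota.
by have /andP[a b] := h _ pc; rewrite !r1.
Qed.

(** By self-adjointness the orbit of [d] may be compared with the fixed code [c]. Relabelling by a
    list realises the inverse permutation, hence the reindexing by inverses. *)
Lemma vec_at n k c d : valid n.+1 k.+1 c -> valid n.+1 k.+1 d ->
  vec R n k c (to_graph n k d) =
  (n.+1`! * k.+1`! * 2 ^ k.+1)%:R^-1 * (pairing n.+1 k.+1 d c)%:~R.
Proof.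
move=> vc vd; have okc := valid_ok vc; have okd := valid_ok vd.
have /and3P[/eqP sc _ _] := vc; have /and3P[/eqP sd din psd] := vd.
rewrite /vec skew_gen_sym skew_gen_prod; congr (_ * _).
rewrite exchange_big /pairing sumzE rmorph_sum /=.
rewrite -[RHS](@sum_perm_list _ k.+1) (reindex_inj invg_inj).
apply: eq_bigr => q _ /=.
rewrite sumzE big_map rmorph_sum /=.
rewrite -[RHS](@sum_perm_list _ n.+1) (reindex_inj invg_inj).
apply: eq_bigr => p _ /=.
have po := perm_list_iota q; have qE := nth_perm_list q.
have pl := perm_list_iota p; have pE := nth_perm_list p.
set c1 := relab_code _ d; set c2 := [seq _ | _ <- c1].
have s1 : size c1 = k.+1 by rewrite size_map (perm_size po) size_iota.
have ok1 : all (ok_vx n.+1 k.+1) (targets c1) by apply: ok_relab.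
have -> : transform (p^-1)%g (q^-1)%g [ffun=> false] (to_graph n k d) = to_graph n k c2.
  rewrite (to_graph_sinks pl pE) // ?(to_graph_relab n po qE din); last first.
    have := sinks_relab (c := d); rewrite sd => /(_ _ po) ps1.
    by apply/allP => x; rewrite (perm_mem ps1) (perm_mem psd) mem_iota.
  rewrite transform_transform mul1g mulg1; congr transform.
  by apply/ffunP => j; rewrite !ffunE.
have s2 : size c2 = k.+1 by rewrite size_map.
rewrite (@prod_dprod n k c2 c) //; last exact: ok_sinks.
rewrite odd_permV (odd_list_perm pl pE).
by case: (perm_parity _); rewrite ?mul1r // mulN1r oppzE intrN.
Qed.


Lemma fact_scale_neq0 n k : (n`! * k`! * 2 ^ k)%:R != 0 :> R.
Proof. by rewrite pnatr_eq0 -lt0n !muln_gt0 !fact_gt0 expn_gt0. Qed.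

Lemma dprod_shadow c d : size c = size d -> dprod c d != 0 ->
  shadow_of [seq sort_pair p | p <- c] = shadow_of [seq sort_pair p | p <- d].
Proof.
elim: c d => [|p c IH] [|q d] //= [sz].
have sw (x y : vx) : (shv (sort_pair (y, x)).1, shv (sort_pair (y, x)).2) =
    (shv (sort_pair (x, y)).1, shv (sort_pair (x, y)).2).
  by rewrite /sort_pair /unsorted /=; case: ltngtP => //= ->.
rewrite !eqpairE; case: (p =P q) => [-> {p}|_].
  by case: ifP => // _ /(IH _ sz) ->.
case: ((p.2, p.1) =P q) => // <-; rewrite oppzE oppr_eq0 => /(IH _ sz) ->.
by case: p => x y /=; rewrite sw.
Qed.

Lemma shadow_fill r s : shadow_of (fill r s) = s.
Proof.
by elim: s r => // -[[|a] [|b]] s IH r /=; congr (_ :: _); apply: IH.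
Qed.

Lemma shadow_sort_fill s : all (fun p => p.1 <= p.2)%N s ->
  shadow_of [seq sort_pair p | p <- fill 0 s] = s.
Proof.
move=> h; rewrite -[RHS](shadow_fill 0); congr shadow_of; rewrite map_id_in //.
move=> p pin; have : (shv p.1, shv p.2) \in s by rewrite -(shadow_fill 0 s); apply: map_f.
by move/(allP h) => /=; rewrite /sort_pair /unsorted ltnNge => ->.
Qed.

Lemma shadow_sort_sinks l c :
  shadow_of [seq sort_pair p | p <- [seq map_pair (relab_sinks l) p | p <- c]] =
  shadow_of [seq sort_pair p | p <- c].
Proof.
rewrite /shadow_of -!map_comp; apply: eq_map => -[a b] /=.
have e (v : vx) : shv (relab_sinks l v) = shv v by case: v.
by rewrite /sort_pair /unsorted /= !e; case: ltnP => _ /=; rewrite !e.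
Qed.

(** A nonzero coefficient would make some relabelling of the representative of [s] agree, up to
    flips and sinks, with that of [t]. Then [t] would be a normal form of [s], which [separating]
    rules out for a canonical [t] other than [s]. *)
Lemma class_separated n k s t :
    separating n.+1 k.+1 s -> canonical n.+1 k.+1 t -> s != t ->
  class R n k t (to_graph n k (fill 0 s)) = 0.
Proof.
case/and3P=> /and3P[vs _ _] _ /allP sep /and3P[vt st ct] st'.
rewrite /class vec_at //; apply/eqP; rewrite mulf_eq0 intr_eq0; apply/orP; right; apply/eqP.
rewrite /pairing sumzE big1_seq // => o /andP[_ oin]; rewrite sumzE big_map big1 // => l _ /=.
suff -> : dprod [seq map_pair (relab_sinks l) p | p <- relab_code o (fill 0 s)] (fill 0 t) = 0.
  by case: ifP.
apply/eqP; apply: contraT => /dprod_shadow; rewrite shadow_sort_sinks shadow_sort_fill //.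
have /and3P[/eqP szs _ _] := vs; have /and3P[/eqP szt _ _] := vt.
have po : perm_eq o (iota 0 k.+1) by rewrite -mem_permutations.
rewrite !size_map szt (perm_size po) size_iota => /(_ erefl) e.
have := sep _ oin; rewrite /normal_form /= e ct orbF => /eqshP ts.
by rewrite ts eqxx in st'.
Qed.

Lemma class_diag n k s : separating n.+1 k.+1 s ->
  class R n k s (to_graph n k (fill 0 s)) != 0.
Proof.
case/and3P=> /and3P[vs _ _] d _; rewrite /class vec_at //.
by rewrite mulf_neq0 ?invr_eq0 ?fact_scale_neq0 // intr_eq0.
Qed.

(** Dividing by the value of the class at its own representative turns evaluation into a coordinate,
    so that the values on integer combinations of canonical classes are integers. *)
Definition functional n k (phi : poly) (v : gsum R n.+1 k.+1) : R :=
  \sum_(x <- phi) x.1%:~R * (v (to_graph n k (fill 0 x.2)) /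
                             class R n k x.2 (to_graph n k (fill 0 x.2))).

Lemma functional_is_linear n k phi : linear (@functional n k phi : _ -> R^o).
Proof.
move=> a u v; rewrite /functional scaler_sumr -big_split; apply: eq_bigr => x _ /=.
rewrite !ffunE mulrDl mulrDr; congr (_ + _).
by rewrite -[a *: _]/(a * _) -[a *: (_ * _)]/(a * (_ * _)) -mulrA mulrCA.
Qed.

HB.instance Definition _ n k phi :=
  GRing.isLinear.Build R (gsum R n.+1 k.+1) R^o _ (@functional n k phi)
    (@functional_is_linear n k phi).

End Pairing.

Definition dot (p phi : poly) : int :=
  sumz (fun x => sumz (fun y => if eqsh x.2 y.2 then intRing.mulz x.1 y.1 else 0) phi) p.

Lemma functional_ev (R : realFieldType) n k phi p :
    all (fun x => separating n.+1 k.+1 x.2) phi ->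
    all (fun x => canonical n.+1 k.+1 x.2) p ->
  functional phi (ev R n k p) = (dot p phi)%:~R.
Proof.
move=> sep can; rewrite /dot sumzE rmorph_sum /ev (linear_sum (@functional R n k phi)) /=.
apply: eq_big_seq => x xp; rewrite sumzE rmorph_sum /functional.
apply: eq_big_seq => y yphi; have sy := allP sep _ yphi; have cx := allP can _ xp.
rewrite ffunE; case: eqshP => [e|/eqP ne].
  rewrite (_ : intRing.mulz x.1 y.1 = x.1 * y.1) // rmorphM /= e.
  by rewrite -[_ *: _]/(_ * _) mulfK ?class_diag // mulrC.
by rewrite (class_separated R sy cx) 1?eq_sym // scaler0 mul0r mulr0.
Qed.

(** * Expansion of Leibniz graphs on lists *)

Lemma mem_seqprod (T : eqType) (ls : seq (seq T)) (l : seq T) :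
  (l \in seqprod ls) = all2 (fun x s => x \in s) l ls.
Proof.
elim: ls l => [|s ls IH] [|x l] //=.
  by apply/negbTE/flatten_mapP => -[y _ /mapP[]].
apply/flatten_mapP/andP => [[y ys /mapP[l' l'in [-> ->]]]|[xs lin]].
  by rewrite -IH.
by exists x => //; apply: map_f; rewrite IH.
Qed.

Lemma seqprod_uniq (T : eqType) (ls : seq (seq T)) :
  all uniq ls -> uniq (seqprod ls).
Proof.
elim: ls => //= s ls IH /andP[us /IH ul].
elim: s us => //= x s IHs /andP[xs us]; rewrite cat_uniq IHs // andbT.
rewrite map_inj_uniq ?ul; last by move=> ? ? [].
apply/hasPn => l /flatten_mapP[y ys /mapP[l' _ ->]].
by apply/mapP => -[l'' _ [e _]]; rewrite -e ys in xs.
Qed.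

Lemma map_seqprod (S T : Type) (h : S -> T) (ls : seq (seq S)) :
  [seq map h l | l <- seqprod ls] = seqprod [seq map h s | s <- ls].
Proof.
elim: ls => //= s ls IH; rewrite -IH map_flatten -!map_comp; congr flatten.
by apply: eq_map => x /=; rewrite -!map_comp; apply: eq_map.
Qed.

(** The bridge from sums over finite functions to lists that evaluate; [idx] and [arr] fix the order
    of the coordinates. *)
Lemma sum_ffun_seqprod (V : nmodType) (A T : finType) N (idx : A -> 'I_N) (arr : 'I_N -> A)
    (x0 : T) (ch : A -> seq T) (G : {ffun A -> T} -> V) :
    cancel idx arr -> cancel arr idx -> (forall a, uniq (ch a)) ->
  \sum_(t : {ffun A -> T} | [forall a, t a \in ch a]) G t =
  \sum_(l <- seqprod [seq ch (arr i) | i <- enum 'I_N]) G [ffun a => nth x0 l (idx a)].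
Proof.
move=> idxK arrK uch.
pose toL (t : {ffun A -> T}) := [seq t (arr i) | i <- enum 'I_N].
have nthL t i : nth x0 (toL t) (i : 'I_N) = t (arr i).
  by rewrite /toL (nth_map i) ?size_enum_ord // nth_ord_enum.
have toLK t : [ffun a => nth x0 (toL t) (idx a)] = t.
  by apply/ffunP => a; rewrite ffunE nthL idxK.
rewrite -big_filter; set ts := filter _ _.
transitivity (\sum_(l <- [seq toL t | t <- ts]) G [ffun a => nth x0 l (idx a)]).
  by rewrite big_map; apply: eq_bigr => t _; rewrite toLK.
apply: perm_big; apply: uniq_perm.
- rewrite map_inj_uniq ?filter_uniq ?index_enum_uniq // => t t' e.
  by rewrite -[t]toLK e toLK.
- by apply: seqprod_uniq; apply/allP => s /mapP[i _ ->].
move=> l; rewrite mem_seqprod; apply/mapP/idP => [[t]|lin].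
  rewrite mem_filter => /andP[/forallP tin _] ->; rewrite /toL.
  by elim: (enum 'I_N) => //= i s ->; rewrite tin.
have sl : size l = N.
  by move: lin; rewrite all2E size_map size_enum_ord => /andP[/eqP].
pose t := [ffun a => nth x0 l (idx a)].
exists t; last first.
  apply: (@eq_from_nth _ x0); first by rewrite size_map size_enum_ord.
  by rewrite sl => i li; rewrite -[i]/(val (Ordinal li)) nthL ffunE arrK.
rewrite mem_filter mem_index_enum andbT; apply/forallP => a.
have -> : t a = nth x0 l (idx a) by rewrite ffunE.
move: lin; rewrite all2E => /andP[_ /(all_nthP (x0, [::]))].
rewrite size_zip sl size_map size_enum_ord minnn => /(_ (idx a) (ltn_ord _)).
rewrite nth_zip /=; last by rewrite sl size_map size_enum_ord.
by rewrite (nth_map (idx a)) ?size_enum_ord // nth_ord_enum idxK.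
Qed.

Section LeibnizCodes.
Variables (n m j : nat).
Implicit Type L : lgraph n m j.

Definition arrow_index (a : larrow m j) : nat :=
  match a with inl (p, b) => (2 * p + b)%N | inr (q, b) => (2 * m + 3 * q + b)%N end.

Lemma arrow_index_lt a : (arrow_index a < 2 * m + 3 * j)%N.
Proof.
case: a => -[p b] /=; have := ltn_ord p; have := ltn_ord b; lia.
Qed.

Definition arrow_ord a : 'I_(2 * m + 3 * j) := Ordinal (arrow_index_lt a).

Lemma arrow_ord_inj : injective arrow_ord.
Proof.
move=> [[p b]|[p b]] [[q c]|[q c]] /(congr1 val) /=;
  have := ltn_ord p; have := ltn_ord q; have := ltn_ord b; have := ltn_ord c => h1 h2 h3 h4 e.
- have e1 : p = q by apply: ord_inj; lia.
  have e2 : b = c by apply: ord_inj; move: e; rewrite e1; lia.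
  by rewrite e1 e2.
- lia.
- lia.
- have e1 : p = q by apply: ord_inj; lia.
  have e2 : b = c by apply: ord_inj; move: e; rewrite e1; lia.
  by rewrite e1 e2.
Qed.

Lemma arrow_ord_bij : bijective arrow_ord.
Proof.
apply: (inj_card_bij arrow_ord_inj).
by rewrite card_ord card_sum !card_prod !card_ord; lia.
Qed.

Definition of_lvertex (v : lvertex n m j) : vx :=
  match v with
  | inl s => inl (s : nat)
  | inr (inl p) => inr (p : nat)
  | inr (inr q) => inr (m + q)%N
  end.


(** The [pick] inverts the bijection [arrow_ord], so its default is never reached. *)
Definition lcode L : seq vx :=
  [seq (if [pick a | arrow_ord a == i] is Some a then of_lvertex (L a) else inl 0%N)
  | i <- enum 'I_(2 * m + 3 * j)].

Lemma size_lcode L : size (lcode L) = (2 * m + 3 * j)%N.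
Proof. by rewrite size_map size_enum_ord. Qed.

Lemma nth_lcode L a : nth (inl 0%N) (lcode L) (arrow_index a) = of_lvertex (L a).
Proof.
rewrite -[arrow_index a]/(val (arrow_ord a)) (nth_map (arrow_ord a)); last first.
  by rewrite size_enum_ord; apply: arrow_index_lt.
rewrite nth_ord_enum; case: pickP => [b /eqP/arrow_ord_inj -> //|/(_ a)].
by rewrite eqxx.
Qed.

Lemma lcodeE (arr : 'I_(2 * m + 3 * j) -> larrow m j) L :
  cancel arrow_ord arr -> cancel arr arrow_ord ->
  lcode L = [seq of_lvertex (L (arr i)) | i <- enum 'I_(2 * m + 3 * j)].
Proof.
move=> idxK arrK; apply: eq_map => i; case: pickP => [a /eqP <-|/(_ (arr i))].
  by rewrite idxK.
by rewrite arrK eqxx.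
Qed.

Definition lchoices (v : lvertex n m j) : seq (vertex n (m + (j + j))) :=
  match v with
  | inl s => [:: inl s]
  | inr (inl p) => [:: inr (lshift (j + j) p)]
  | inr (inr q) => [:: inr (inner m q); inr (outer m q)]
  end.

Lemma splitl a b (p : 'I_a) : split (lshift b p) = inl p.
Proof. exact: (unsplitK (inl p)). Qed.

Lemma splitr a b (p : 'I_b) : split (rshift a p) = inr p.
Proof. exact: (unsplitK (inr p)). Qed.

Let inrE (S T : eqType) (x y : T) : (inr x == inr y :> S + T) = (x == y).
Proof. by []. Qed.

Let inlE (S T : eqType) (x y : S) : (inl x == inl y :> S + T) = (x == y).
Proof. by []. Qed.

Let inlrE (S T : eqType) (x : S) (y : T) :
  ((inl x == inr y :> S + T) = false) * ((inr y == inl x :> S + T) = false).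
Proof. by []. Qed.

Lemma mem_lchoices v y : (y \in lchoices v) = (contract y == v).
Proof.
case: y => [s|i]; first by case: v => [x|[p|q]] //=; rewrite ?inE.
rewrite /contract; case: (split_ordP i) => [p|i'] ->.
  case: v => [x|[p'|q']] //; rewrite !inE !inrE ?inlE ?inlrE -!val_eqE /=.
    by have := ltn_ord p; lia.
  by have := ltn_ord p; lia.
case: (split_ordP i') => [q|q] ->;
  case: v => [x|[p'|q']] //; rewrite !inE !inrE ?inlrE -!val_eqE /=.
- by have := ltn_ord p'; lia.
- by have := ltn_ord q; lia.
- by have := ltn_ord p'; lia.
by have := ltn_ord q'; lia.
Qed.

Lemma lchoices_uniq v : uniq (lchoices v).
Proof.
case: v => [x|[p|q]] //=; rewrite inE inrE -val_eqE /=.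
by have := ltn_ord q; lia.
Qed.

Lemma map_lchoices v :
  [seq of_vertex y | y <- lchoices v] = leibniz_choices m j (of_lvertex v).
Proof.
case: v => [x|[p|q]] //=; first by rewrite ltn_ord.
by rewrite ltnNge leq_addr /= -addnA [(q + j)%N]addnC.
Qed.

Lemma of_jac_term (t : {ffun larrow m j -> vertex n (m + (j + j))})
    (r : {ffun 'I_j -> 'I_3}) l rl :
    (forall a, nth (inl 0%N) l (arrow_index a) = of_vertex (t a)) ->
    (forall q : 'I_j, nth 0%N rl q = r q) ->
  of_graph (jac_term t r) = jac_code m j l rl.
Proof.
move=> tE rE; apply: (@eq_from_nth _ vx0).
  by rewrite size_map size_enum_ord !size_cat !size_map !size_iota.
rewrite size_map size_enum_ord => i iK; rewrite -[i]/(val (Ordinal iK)) nth_of_graph.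
rewrite ffunE; case: (split_ordP (Ordinal iK)) => [p|i'] ->; rewrite ?splitl ?splitr.
  rewrite nth_cat !size_map size_iota /= ltn_ord (nth_map 0%N) ?size_iota // nth_iota //.
  by rewrite add0n /map_pair /= -!tE /= addn0 addn1.
case: (split_ordP i') => [q|q] ->; rewrite ?splitl ?splitr.
  rewrite nth_cat !size_map size_iota /= ltnNge leq_addr /= addKn.
  rewrite nth_cat !size_map size_iota /= ltn_ord (nth_map 0%N) ?size_iota // nth_iota //.
  by rewrite add0n rE /map_pair /= -!tE.
rewrite nth_cat !size_map size_iota /= ltnNge leq_addr /= addKn.
rewrite nth_cat !size_map size_iota /= ltnNge leq_addr /= addKn.
rewrite (nth_map 0%N) ?size_iota // nth_iota // add0n rE /map_pair /= -!tE /=.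
by [].
Qed.
End LeibnizCodes.

Lemma map_const_nseq (S T : Type) (c : T) (s : seq S) : [seq c | _ <- s] = nseq (size s) c.
Proof. by elim: s => //= x s ->. Qed.

(** Stated through a list of graphs because [to_graph] requires a vertex count of successor form,
    which [m + (j + j)] is not by conversion. *)
Lemma expand_codes (R : realFieldType) n m j (L : lgraph n.+1 m j) :
  exists2 gs : seq (kgraph n.+1 (m + (j + j))),
    expand R L = \sum_(g <- gs) gen R g
  & [seq of_graph g | g <- gs] = expand_terms m j (lcode L).
Proof.
have [arr idxK arrK] := arrow_ord_bij m j.
pose x0 : vertex n.+1 (m + (j + j)) := inl ord0.
pose tf l : {ffun larrow m j -> vertex n.+1 (m + (j + j))} := [ffun a => nth x0 l (arrow_ord a)].
pose rf (l : seq 'I_3) : {ffun 'I_j -> 'I_3} := [ffun q : 'I_j => nth (0 : 'I_3) l q].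
pose ls := seqprod [seq lchoices (L (arr i)) | i <- enum 'I_(2 * m + 3 * j)].
pose rs := seqprod [seq enum 'I_3 | _ <- enum 'I_j].
exists (flatten [seq [seq jac_term (tf l) (rf rl) | rl <- rs] | l <- ls]).
  rewrite /expand (eq_bigl (fun t : {ffun _ -> _} => [forall a, t a \in lchoices (L a)])); last first.
    by move=> t; apply: eq_forallb => a; rewrite mem_lchoices.
  rewrite (sum_ffun_seqprod x0 _ idxK arrK) => [|a]; last exact: lchoices_uniq.
  rewrite big_flatten big_map /=; apply: eq_bigr => l _; rewrite big_map /=.
  rewrite (eq_bigl (fun r : {ffun _ -> _} => [forall a, r a \in enum 'I_3])); last first.
    by move=> r; apply/esym/forallP => q; rewrite mem_enum.
  have idid : cancel (@id 'I_j) id by [].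
  by rewrite (sum_ffun_seqprod (0 : 'I_3) _ idid idid) => // a; exact: enum_uniq.
rewrite /expand_terms map_flatten -map_comp.
have -> : seqprod [seq leibniz_choices m j v | v <- lcode L] =
    [seq map (@of_vertex n.+1 _) l | l <- ls].
  rewrite map_seqprod (lcodeE _ idxK arrK) -!map_comp; congr seqprod.
  by apply: eq_map => i /=; rewrite map_lchoices.
have -> : seqprod (nseq j [:: 0; 1; 2]%N) = [seq map val rl | rl <- rs].
  rewrite map_seqprod -map_comp /= -[in LHS](size_enum_ord j) -map_const_nseq.
  by congr seqprod; apply: eq_map => i /=; rewrite val_enum_ord.
congr flatten; rewrite -[RHS]map_comp; apply/eq_in_map => l lin /=.
rewrite -[LHS]map_comp -[RHS]map_comp; apply/eq_in_map => rl rin /=.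
have sl : size l = (2 * m + 3 * j)%N.
  by move: lin; rewrite mem_seqprod all2E size_map size_enum_ord => /andP[/eqP].
have sr : size rl = j.
  by move: rin; rewrite mem_seqprod all2E size_map size_enum_ord => /andP[/eqP].
apply: of_jac_term => [a|q].
  by rewrite ffunE (nth_map x0) // sl arrow_index_lt.
by rewrite ffunE (nth_map (0 : 'I_3)) // sr.
Qed.

(** * Skew symmetry of Leibniz graphs *)

Definition rev3 (s : 'S_3) : bool := s 1 != s 0 + 1.

(** An even permutation of Z/3 is a rotation, recognised by s 1 = s 0 + 1, and respects the cyclic
    order. An odd one reverses it, and with it the pair left over by the image of [r + 2]. *)
Lemma perm3E (s : 'S_3) (r : 'I_3) :
  (s r, s (r + 1)) = flip (rev3 s) (s (r + 2) + 1, s (r + 2) + 1 + 1).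
Proof.
have s01 : s 0 != s 1 by rewrite (inj_eq perm_inj).
have s02 : s 0 != s 2 by rewrite (inj_eq perm_inj).
have s12 : s 1 != s 2 by rewrite (inj_eq perm_inj).
have key (x y z : 'I_3) : x != y -> x != z -> y != z ->
  [/\ (x, y) = flip (y != x + 1) (z + 1, z + 1 + 1),
      (y, z) = flip (y != x + 1) (x + 1, x + 1 + 1)
    & (z, x) = flip (y != x + 1) (y + 1, y + 1 + 1)].
  by case: x y z => [[|[|[|//]]] ?] [[|[|[|//]]] ?] [[|[|[|//]]] ?] //= _ _ _;
    split; congr (_, _); apply: val_inj.
have [k0 k1 k2] := key _ _ _ s01 s02 s12.
have : [\/ r = 0, r = 1 | r = 2].
  by case: r => [[|[|[|//]]] ?]; [constructor 1|constructor 2|constructor 3]; apply: val_inj.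
case=> ->; rewrite /rev3.
- by rewrite !add0r.
- rewrite (_ : 1 + 1 = 2 :> 'I_3); last exact: val_inj.
  by rewrite (_ : 1 + 2 = 0 :> 'I_3); last exact: val_inj.
rewrite (_ : 2 + 1 = 0 :> 'I_3); last exact: val_inj.
by rewrite (_ : 2 + 2 = 1 :> 'I_3); last exact: val_inj.
Qed.

Section LeibnizSymmetry.
Variables (R : realFieldType) (n m j : nat).
Variables (s : 'S_n) (f : {ffun 'I_m -> bool}) (pi : {ffun 'I_j -> 'S_3}).

Definition act_arrow (a : larrow m j) : larrow m j :=
  match a with
  | inl (p, b) => inl (p, if f p then b + 1 else b)
  | inr (q, b) => inr (q, pi q b)
  end.

Definition act_lvertex (v : lvertex n m j) : lvertex n m j :=
  if v is inl x then inl (s x) else v.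

Definition act_lgraph (L : lgraph n m j) : lgraph n m j :=
  [ffun a => act_lvertex (L (act_arrow a))].

(** An odd permutation of the three arguments of a Jacobiator shows up as a flip of its inner
    vertex, the one carrying two of them. *)
Definition act_flips : {ffun 'I_(m + (j + j)) -> bool} :=
  [ffun i => match split i with
    | inl p => f p
    | inr i' => match split i' with inl q => rev3 (pi q) | inr _ => false end
    end].

Lemma act_arrow_inj : injective act_arrow.
Proof.
move=> [[p b]|[p b]] [[q c]|[q c]] //= [e]; rewrite e; first by case: (f q) => [/addIr ->|->].
by move/perm_inj ->.
Qed.

Lemma act_lvertex_inj : injective act_lvertex.
Proof. by move=> [x|v] [y|w] //= [/perm_inj ->]. Qed.

(** The cyclic sum defining the Jacobiator is totally skew in its arguments. Both the Leibniz
    choices and the cyclic choices are merely reindexed, with one sign common to all terms. *)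
Lemma skew_expand_act (L : lgraph n m j) :
  skew (expand R (act_lgraph L)) = tsign R s act_flips *: skew (expand R L).
Proof.
pose phi (t : {ffun larrow m j -> vertex n (m + (j + j))}) :=
  [ffun a => rename s 1 (t (act_arrow a))] : {ffun larrow m j -> vertex n (m + (j + j))}.
(* Chosen so that the outer argument of term [rho r], at position [rho r + 2], is the image of
   [r + 2]. *)
pose rho (r : {ffun 'I_j -> 'I_3}) := [ffun q => pi q (r q + 2) + 1] : {ffun 'I_j -> 'I_3}.
have [barr arrK barrK] : bijective act_arrow by apply: injF_bij; apply: act_arrow_inj.
have renI : injective (rename s (1 : 'S_(m + (j + j)))).
  by move=> [x|x] [y|y] //= [] /perm_inj ->.
have phiI : injective phi.
  move=> t t' /ffunP e; apply/ffunP => a; have := e (barr a).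
  by rewrite !ffunE barrK => /renI.
have rhoI : injective rho.
  move=> r r' /ffunP e; apply/ffunP => q; have := e q.
  by rewrite !ffunE => /addIr/perm_inj/addIr.
have conE v : contract (rename s (1 : 'S_(m + (j + j))) v) = act_lvertex (contract v).
  by case: v => [x|i] //=; rewrite perm1.
have two1 : 2 + 1 = 0 :> 'I_3 by apply: val_inj.
have termE t r : jac_term (phi t) r = transform s 1 act_flips (jac_term t (rho r)).
  apply/ffunP => i; rewrite !ffunE /= invg1 perm1 !ffunE.
  case: (split_ordP i) => [p|i'] _.
    by rewrite !ffunE /= add0r; case: (f p) => //=;
      rewrite (_ : 1 + 1 = 0 :> 'I_2) //; apply: val_inj.
  case: (split_ordP i') => [q|q] _.
    have := perm3E (pi q) (r q); rewrite !ffunE /=.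
    by case: (rev3 _) => -[-> ->].
  by rewrite !ffunE /= perm1 -addrA [1 + 2]addrC two1 addr0.
rewrite /expand !skew_sum scaler_sumr (reindex_inj phiI) /=.
apply: eq_big => [t|t _].
  apply/forallP/forallP => [h a|h a].
    by have := h (barr a); rewrite !ffunE barrK conE (inj_eq act_lvertex_inj).
  by rewrite !ffunE conE (inj_eq act_lvertex_inj).
rewrite !skew_sum scaler_sumr [RHS](reindex_inj rhoI) /=.
by apply: eq_bigr => r _; rewrite termE skew_transform.
Qed.

End LeibnizSymmetry.

(** * Reduction of graphs and Leibniz graphs to sorted shadows *)

Lemma perm_iota_count n (l : seq nat) :
    all (fun x => x < n)%N l -> (forall s, (s < n)%N -> count_mem s l = 1%N) ->
  perm_eq l (iota 0 n).
Proof.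
move=> /allP ln h; apply/allP => x _ /=; have [xn|nx] := ltnP x n.
  by rewrite h // count_uniq_mem ?iota_uniq // mem_iota xn.
rewrite (count_memPn _) ?(count_memPn _) //; last first.
  by apply/negP => /ln; rewrite ltnNge nx.
by rewrite mem_iota ltnNge nx.
Qed.

Lemma count_pmap_sink s (l : seq vx) :
  count_mem s (pmap sink_of l) = count (pred1 (inl s : vx)) l.
Proof. by elim: l => // -[t|i] l IH //=; rewrite IH. Qed.

Lemma count_sinks_graph n k (g : kgraph n k) (s : 'I_n) :
  #|[set a | target g a == inl s]| = count_mem (s : nat) (sinks (of_graph g)).
Proof.
rewrite /sinks count_pmap_sink /targets count_flatten sumnE big_map big_map big_map big_enum /=.
rewrite -sum1_card (eq_bigl (fun a => target g a == inl s)); last by move=> a; rewrite inE.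
rewrite big_mkcond /= -(pair_bigA _ (fun i b => if target g (i, b) == inl s then 1 else 0)%N) /=.
apply: eq_bigr => i _; rewrite big_bool /target /= addnC addn0.
have e (v : vertex n k) : (of_vertex v == inl (s : nat)) = (v == inl s) by case: v.
by rewrite /map_pair /= !e; case: (_ == _); case: (_ == _).
Qed.

Lemma valid_of_graph n k (g : kgraph n k) :
  one_arrow_per_sink g -> valid n k (of_graph g).
Proof.
move=> /forallP h; apply/and3P; split; first by rewrite size_map size_enum_ord.
  rewrite all_targets all_map; apply/allP => i _ /=.
  by case: (g i) => -[x|x] [y|y]; rewrite /= ?ltn_ord.
apply: perm_iota_count => [|s sn].
  rewrite sinks_flatten -map_comp; apply/allP => x /flatten_mapP[i _ /=].
  by case: (g i) => -[a|a] [b|b] //=; rewrite !inE; [case/orP| |] => /eqP ->.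
by rewrite -(count_sinks_graph g (Ordinal sn)); apply/eqP.
Qed.

Definition flat (s : shadow) : seq nat := flatten [seq [:: p.1; p.2] | p <- s].

Lemma flatK : cancel flat (@pair_up nat).
Proof. by elim=> //= -[a b] s {2}<-. Qed.

Lemma count_flat_shadow c : count (eqn 0) (flat (shadow_of c)) = size (sinks c).
Proof.
by elim: c => // -[[x|x] [y|y]] c IH; rewrite sinks_cons /= -IH.
Qed.

Lemma mem_sorted_pairs v i a b : ([:: a; b] \in sorted_pairs v i) =
  [&& (a <= v)%N, (b <= v)%N, a != i.+1, b != i.+1 &
      (a < b)%N || (a == 0%N) && (b == 0%N)].
Proof.
have memr x : (x \in iota 0 v.+1) = (x <= v)%N by rewrite mem_iota add0n ltnS.
rewrite /sorted_pairs; move: (iota 0 v.+1) memr => r memr.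
by rewrite mem_filter mem_seqprod /= !memr andbT andbC -!andbA.
Qed.

Lemma mem_sorted_triples v i a b c : ([:: a; b; c] \in sorted_triples v i) =
  [&& (a <= v)%N, (b <= v)%N, (c <= v)%N, a != i.+1, b != i.+1, c != i.+1,
      (a < b)%N || (a == 0%N) && (b == 0%N) &
      (b < c)%N || (b == 0%N) && (c == 0%N)].
Proof.
have memr x : (x \in iota 0 v.+1) = (x <= v)%N by rewrite mem_iota add0n ltnS.
rewrite /sorted_triples; move: (iota 0 v.+1) memr => r memr.
by rewrite mem_filter mem_seqprod /= !memr andbT andbC -!andbA.
Qed.

Lemma all2_cat_eq (S T : Type) (r : S -> T -> bool) s1 s2 t1 t2 : size s1 = size t1 ->
  all2 r (s1 ++ s2) (t1 ++ t2) = all2 r s1 t1 && all2 r s2 t2.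
Proof. by elim: s1 t1 => [|x s1 IH] [|y t1] //= [/IH ->]; rewrite andbA. Qed.

Lemma all2_mem_map (T : eqType) (F : nat -> T) (G : nat -> seq T) (s : seq nat) :
    (forall i, i \in s -> F i \in G i) ->
  all2 (fun x l => x \in l) [seq F i | i <- s] [seq G i | i <- s].
Proof.
elim: s => //= i s IH h; rewrite h ?mem_head //=; apply: IH => k ks.
by apply: h; rewrite inE ks orbT.
Qed.

Lemma relab_code_id k c : size c = k -> all (in_range k) (targets c) ->
  relab_code (iota 0 k) c = c.
Proof.
move=> sc cin; apply: (@eq_from_nth _ vx0); first by rewrite size_map size_iota.
rewrite size_map size_iota => i ik; rewrite (nth_map 0%N) ?size_iota // nth_iota // add0n.
have /andP[] := nth_in_range i cin; case: (nth vx0 c i) => a b /=.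
have e v : in_range k v -> relab (iota 0 k) v = v.
  case: v => //= x xk; have e : nth 0%N (iota 0 k) x = x by rewrite nth_iota.
  by rewrite -{1}e index_uniq ?size_iota ?iota_uniq.
by move=> ha hb; rewrite /map_pair /= !e.
Qed.

(** Unless two arrows of a vertex coincide, which kills the class, sorting each pair gives a strict
    increase or a pair of sinks. *)
Lemma multivector_class (R : realFieldType) n k (g : kgraph n.+1 k.+1) :
  is_multivector g -> skew (gen R g) = 0 \/
  exists2 s, s \in shadows n.+1 k.+1 &
    exists b : bool, skew (gen R g) = (-1) ^+ b *: class R n k (pair_up s).
Proof.
case/andP=> /valid_of_graph vg /forallP tad.
have -> : skew (gen R g) = vec R n k (of_graph g) by rewrite /vec of_graphK.
have cE := nth_of_graph g; move: (of_graph g) vg cE => c vg cE.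
have /and3P[/eqP sc cin ps] := vg.
have [/existsP[i /eqP e]|nex] := boolP [exists i : 'I_k.+1, (nth vx0 c i).1 == (nth vx0 c i).2].
  by left; apply: (@vec_zero _ _ _ _ i).
right; exists (flat (shadow_of [seq sort_pair p | p <- c])).
  rewrite mem_filter; apply/andP; split.
    by rewrite count_flat_shadow (perm_size (sinks_flip _ _)) (perm_size ps) size_iota.
  apply: map_f; rewrite mem_seqprod.
  have -> : [seq [:: p.1; p.2] | p <- shadow_of [seq sort_pair p | p <- c]] =
      [seq (let p := sort_pair (nth vx0 c i) in [:: shv p.1; shv p.2]) | i <- iota 0 k.+1].
    by rewrite -[in LHS](mkseq_nth vx0 c) sc /mkseq /shadow_of -!map_comp.
  apply: all2_mem_map => i; rewrite mem_iota => /andP[_]; rewrite add0n => ik.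
  have := tad (Ordinal ik, false); have := tad (Ordinal ik, true); rewrite /target /=.
  have /andP[] := nth_in_range i cin.
  move: nex; rewrite negb_exists => /forallP/(_ (Ordinal ik)) /=.
  rewrite -[i]/(val (Ordinal ik)) cE /map_pair.
  case: (g _) => x y /=; rewrite mem_sorted_pairs /sort_pair /unsorted.
  case: x y => [a|a] [b|b] //=; rewrite ?ltn_ord.
  - move=> _ _ _ h _; rewrite /= ?eqSS ?andbT.
    by apply: contra h => /eqP e; apply/eqP; congr inr; apply: ord_inj.
  - move=> _ _ _ _ h; rewrite /= ?ltn_ord ?eqSS ?andbT.
    by apply: contra h => /eqP e; apply/eqP; congr inr; apply: ord_inj.
  move=> ab _ _ h1 h2.
  have ha : (a != i :> nat)%N by apply: contra h2 => /eqP e; apply/eqP; congr inr; apply: ord_inj.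
  have hb : (b != i :> nat)%N by apply: contra h1 => /eqP e; apply/eqP; congr inr; apply: ord_inj.
  have {}ab : (a != b :> nat)%N by apply: contra ab => /eqP ->.
  by case: (ltnP b.+1 a.+1) => /= hlt; have := ltn_ord a; have := ltn_ord b; lia.
exists (normal_form (iota 0 k.+1) c).1.
rewrite flatK (class_normal_form R (perm_refl _) vg); congr (_ *: class _ _ _ _).
by rewrite -[LHS]/(shadow_of [seq sort_pair p | p <- relab_code (iota 0 k.+1) c]) relab_code_id.
Qed.

Section LeibnizNormalForm.
Variables (n m j : nat).
Implicit Type L : lgraph n m j.

Definition lsv (v : lvertex n m j) : nat := shv (of_lvertex v).

Lemma lsv_inj v w : lsv v = lsv w -> lsv v != 0%N -> v = w.
Proof.
case: v w => [x|[p|q]] [y|[p'|q']] //= [e] _; rewrite /lsv /= in e.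
- by congr (inr (inl _)); apply: ord_inj; lia.
- by have := ltn_ord p; lia.
- by have := ltn_ord p'; lia.
by congr (inr (inr _)); apply: ord_inj; lia.
Qed.

Lemma lsv_le v : (lsv v <= m + j)%N.
Proof.
by case: v => [x|[p|q]] //=; rewrite /lsv /=; [have := ltn_ord p|have := ltn_ord q]; lia.
Qed.

Lemma count_sinks_lgraph L (s : 'I_n) :
  #|[set a | L a == inl s]| = count_mem (s : nat) (pmap sink_of (lcode L)).
Proof.
have [arr idxK arrK] := arrow_ord_bij m j.
rewrite count_pmap_sink (lcodeE _ idxK arrK) count_map -sum1_count big_enum_cond /= -sum1_card.
rewrite (reindex arr) /=; last by apply: onW_bij; exists (@arrow_ord m j).
apply: eq_bigl => i; rewrite !inE /=.
by case: (L (arr i)) => [x|[p|q]].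
Qed.

Lemma lcode_sinks L : [forall s : 'I_n, #|[set a | L a == inl s]| == 1%N] ->
  perm_eq (pmap sink_of (lcode L)) (iota 0 n).
Proof.
move=> /forallP h; apply: perm_iota_count => [|s sn].
  have [arr idxK arrK] := arrow_ord_bij m j.
  rewrite (lcodeE _ idxK arrK); elim: (enum _) => //= i e IH.
  by case: (L (arr i)) => [x|[p|q]] //=; rewrite ltn_ord.
by rewrite -(count_sinks_lgraph L (Ordinal sn)); apply/eqP.
Qed.

Lemma lcode_act (s : 'S_n) l L : perm_eq l (iota 0 n) ->
    (forall i : 'I_n, nth 0%N l i = (s^-1)%g i) ->
  lcode (act_lgraph s [ffun=> false] [ffun=> 1%g] L) =
  [seq relab_sinks l v | v <- lcode L].
Proof.
move=> pl sE; have [arr idxK arrK] := arrow_ord_bij m j.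
rewrite !(lcodeE _ idxK arrK) -map_comp; apply: eq_map => i /=.
rewrite ffunE (_ : act_arrow _ _ _ = arr i); last first.
  by case: (arr i) => -[p b] /=; rewrite ffunE ?perm1.
case: (L (arr i)) => [x|[p|q]] //=.
by rewrite (index_list_perm pl sE) invgK.
Qed.

End LeibnizNormalForm.

Lemma fill_flat_shv l (c : seq vx) : uniq (l ++ pmap sink_of c) ->
  fill_flat (size l) [seq shv v | v <- c] =
  [seq relab_sinks (l ++ pmap sink_of c) v | v <- c].
Proof.
elim: c l => // -[s|i] c IH l /= u; last by rewrite IH.
have := IH (l ++ [:: s]); rewrite -catA size_cat addn1 => -> //; congr (inl _ :: _).
move: u; rewrite cat_uniq => /and3P[_ /hasPn h _].
by rewrite index_cat (negPf (h s _)) ?mem_head //= eqxx addn0.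
Qed.

Lemma flatten_pairs (T : Type) (F : nat -> T) m :
  [seq F i | i <- iota 0 (2 * m)] = flatten [seq [:: F (2 * p)%N; F (2 * p).+1] | p <- iota 0 m].
Proof.
elim: m => // m IH; rewrite (_ : 2 * m.+1 = 2 * m + 2)%N; last lia.
have -> : iota 0 m.+1 = iota 0 m ++ [:: m] by rewrite -addn1 iotaD.
by rewrite iotaD !map_cat flatten_cat -IH /= add0n.
Qed.

Lemma flatten_triples (T : Type) (F : nat -> T) j :
  [seq F i | i <- iota 0 (3 * j)] =
  flatten [seq [:: F (3 * q)%N; F (3 * q).+1; F (3 * q).+2] | q <- iota 0 j].
Proof.
elim: j => // j IH; rewrite (_ : 3 * j.+1 = 3 * j + 3)%N; last lia.
have -> : iota 0 j.+1 = iota 0 j ++ [:: j] by rewrite -addn1 iotaD.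
by rewrite iotaD !map_cat flatten_cat -IH /= add0n.
Qed.

Lemma sort3 (F : 'I_3 -> nat) : exists s : 'S_3, (F (s 0%R) <= F (s 1%R) <= F (s 2%R))%N.
Proof.
pose F' a := F (inord a); pose le a b := (F' a <= F' b)%N.
have ps : perm_eq (sort le (iota 0 3)) (iota 0 3) by rewrite perm_sort.
have ss : sorted le (sort le (iota 0 3)).
  by apply: sort_sorted => a b; apply: leq_total.
have [p pE] := list_perm ps; exists p.
have e (i : 'I_3) : F (p i) = F' (nth 0%N (sort le (iota 0 3)) i).
  by rewrite pE /F' inord_val.
rewrite !e; move: (perm_size ps) ss.
by case: (sort _ _) => [|a [|b [|c [|d l]]]] //= _; rewrite andbT.
Qed.

Lemma act_arrows_card n m j f pi (L : lgraph n m j) x :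
  #|[set a | act_lgraph 1 f pi L a == inl x]| = #|[set a | L a == inl x]|.
Proof.
rewrite -[RHS](card_preimset _ (@act_arrow_inj _ _ f pi)); apply: eq_card => a.
by rewrite !inE ffunE; case: (L _) => [y|v] //=; rewrite perm1.
Qed.

(** The arrows of a Jacobiator are distinct by definition; at an ordinary vertex a coincidence makes
    the expansion vanish. Otherwise targets can be sorted everywhere and the sinks renumbered in
    reading order, at the cost of a sign. *)
Lemma lgraph_normal_form (R : realFieldType) n m j (L : lgraph n.+1 m j) :
    is_leibniz_multivector L -> skew (expand R L) = 0 \/
  exists2 s, s \in lshadows n.+1 m j &
  exists2 L' : lgraph n.+1 m j, lcode L' = fill_flat 0 s &
  exists b : bool, skew (expand R L) = (-1) ^+ b *: skew (expand R L').
Proof.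
case/and5P=> _ hs /forallP hp /forallP hJ /forallP hq.
have [/existsP[p /eqP e]|nex] :=
    boolP [exists p : 'I_m, L (inl (p, 0)) == L (inl (p, 1))].
  (* Flipping only at [p] fixes [L] and has sign -1. *)
  left; pose f : {ffun 'I_m -> bool} := [ffun p' => p' == p].
  have := skew_expand_act R 1 f [ffun=> 1%g] L.
  have -> : act_lgraph 1 f [ffun=> 1%g] L = L.
    apply/ffunP => -[[p' b]|[q b]]; rewrite ffunE /= !ffunE.
      have -> : L (inl (p', if p' == p then b + 1 else b)) = L (inl (p', b)).
        case: eqP => // -> {p'}; case: b => [[|[|//]] hb].
          by rewrite (_ : Ordinal hb = 0) ?add0r ?e //; apply: val_inj.
        rewrite (_ : Ordinal hb = 1); last exact: val_inj.
        by rewrite (_ : 1 + 1 = 0 :> 'I_2) ?e //; apply: val_inj.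
      by case: (L _) => [x|v] //=; rewrite perm1.
    by rewrite perm1; case: (L _) => [x|v] //=; rewrite perm1.
  have -> : @tsign R n.+1 (m + (j + j)) 1 (act_flips f [ffun=> 1%g]) = -1.
    rewrite /tsign odd_perm1 mul1r (bigD1 (lshift (j + j) p)) //= big1 ?mulr1.
      by rewrite ffunE splitl ffunE eqxx.
    move=> i; rewrite ffunE; case: (split_ordP i) => [p'|i'] ->.
      by rewrite ffunE (inj_eq (@lshift_inj _ _)) => /negPf ->.
    case: (split_ordP i') => q _ //; rewrite ffunE /rev3 !perm1 add0r eqxx //.
  move/eqP; rewrite scaleN1r -addr_eq0 -mulr2n -scaler_nat scaler_eq0 pnatr_eq0 /=.
  by move/eqP.
right.
have [pi piE] := fin_all_exists (fun q : 'I_j => sort3 (fun b => lsv (L (inr (q, b))))).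
pose f : {ffun 'I_m -> bool} := [ffun p => lsv (L (inl (p, 1%R))) < lsv (L (inl (p, 0%R)))]%N.
(* [L1] has sorted targets at every vertex; [L'] then numbers its sinks as [fill_flat] does. *)
pose L1 := act_lgraph 1 f [ffun q => pi q] L.
pose l := pmap sink_of (lcode L1).
have pl : perm_eq l (iota 0 n.+1).
  apply: lcode_sinks; apply/forallP => x; rewrite act_arrows_card.
  exact: (forallP hs).
have [p pE] := list_perm pl.
pose L' := act_lgraph (p^-1)%g [ffun=> false] [ffun=> 1%g] L1.
have lsv1 (v : lvertex n.+1 m j) : lsv (act_lvertex 1 v) = lsv v by case: v.
exists [seq shv v | v <- lcode L1]; last first.
  exists L'.
    rewrite /L' (lcode_act _ pl) ?invgK //.
    by have := @fill_flat_shv [::] (lcode L1); rewrite /= => ->; rewrite // (perm_uniq pl) iota_uniq.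
  have sgn (s : 'S_n.+1) (F : {ffun 'I_(m + (j + j)) -> bool}) :
      exists b : bool, tsign R s F = (-1) ^+ b.
    have /eqP := tsign_sq R s F; rewrite -expr2 sqrf_eq1.
    by case/orP => /eqP ->; [exists false|exists true].
  have [b1 e1] := sgn 1%g (act_flips f [ffun q => pi q]).
  have [b2 e2] := sgn (p^-1)%g (act_flips [ffun=> false] [ffun=> 1%g]).
  exists (b1 (+) b2); rewrite /L' skew_expand_act e2 /L1 skew_expand_act e1 !scalerA.
  by rewrite -!signr_addb; case: b1 {e1}; case: b2 {e2}; rewrite /= ?scale1r.
have size1 := size_lcode L1.
have L1p (p0 : 'I_m) : (lsv (L1 (inl (p0, 0%R))) < lsv (L1 (inl (p0, 1%R))))%N ||
    (lsv (L1 (inl (p0, 0%R))) == 0%N) && (lsv (L1 (inl (p0, 1%R))) == 0%N).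
  have ne : L (inl (p0, 0)) != L (inl (p0, 1)).
    by move: nex; rewrite negb_exists => /forallP/(_ p0).
  rewrite /L1 !ffunE !lsv1 /= !ffunE add0r (_ : 1 + 1 = 0 :> 'I_2); last exact: val_inj.
  case: (ltngtP (lsv (L (inl (p0, 1%R)))) (lsv (L (inl (p0, 0%R))))) => [->|->|e] //.
  rewrite e ltnn /= andbb; apply: contraT => nz; rewrite (lsv_inj (esym e) nz) eqxx in ne.
  by [].
have L1q (q : 'I_j) : [&& (lsv (L1 (inr (q, 0%R))) < lsv (L1 (inr (q, 1%R))))%N ||
    (lsv (L1 (inr (q, 0%R))) == 0%N) && (lsv (L1 (inr (q, 1%R))) == 0%N) &
    (lsv (L1 (inr (q, 1%R))) < lsv (L1 (inr (q, 2%R))))%N ||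
    (lsv (L1 (inr (q, 1%R))) == 0%N) && (lsv (L1 (inr (q, 2%R))) == 0%N)].
  have key (b c : 'I_3) : b != c -> (lsv (L (inr (q, b))) <= lsv (L (inr (q, c))))%N ->
     (lsv (L (inr (q, b))) < lsv (L (inr (q, c))))%N ||
     (lsv (L (inr (q, b))) == 0%N) && (lsv (L (inr (q, c))) == 0%N).
    move=> bc; rewrite leq_eqVlt => /orP[/eqP e|->//].
    rewrite e ltnn andbb /=; apply: contraT; rewrite -e => nz.
    by move/injectiveP: (hJ q) => /(_ _ _ (lsv_inj e nz)) /eqP; rewrite (negPf bc).
  have /andP[h1 h2] := piE q; rewrite /L1 !ffunE !lsv1 /= !ffunE.
  by rewrite !key // (inj_eq perm_inj).
have nth1 a : nth 0%N [seq shv v | v <- lcode L1] (arrow_index a) = lsv (L1 a).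
  by rewrite (nth_map (inl 0%N)) ?size1 ?arrow_index_lt // nth_lcode.
set sh := [seq _ | _ <- _] in nth1 *.
have ssh : size sh = (2 * m + 3 * j)%N by rewrite size_map.
(* The flat list is cut into the pairs and triples from which [lshadows] is assembled. *)
have blocks : sh = flatten
    ([seq [:: nth 0%N sh (2 * p)%N; nth 0%N sh (2 * p).+1] | p <- iota 0 m] ++
     [seq [:: nth 0%N sh (2 * m + 3 * q)%N; nth 0%N sh (2 * m + (3 * q).+1)%N;
             nth 0%N sh (2 * m + (3 * q).+2)%N] | q <- iota 0 j]).
  rewrite flatten_cat -flatten_pairs.
  rewrite -(flatten_triples (fun i => nth 0%N sh (2 * m + i)%N)).
  rewrite -{1}[sh](mkseq_nth 0%N) ssh /mkseq iotaD map_cat; congr (_ ++ _).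
  by rewrite add0n -[in LHS](addn0 (2 * m)%N) iotaDl -map_comp.
rewrite mem_filter; apply/andP; split.
  have -> : count (eqn 0) sh = size l.
    by rewrite /sh /l; elim: (lcode L1) => // -[s|i] c /= ->.
  by rewrite (perm_size pl) size_iota.
rewrite [X in X \in _]blocks; apply: map_f; rewrite mem_seqprod all2_cat_eq ?size_map //.
have ord_lt i k : (i < k)%N -> exists x : 'I_k, i = x by move=> h; exists (Ordinal h).
apply/andP; split.
  apply: all2_mem_map => i; rewrite mem_iota => /andP[_ /ord_lt[p0 ->]].
  have /= := nth1 (inl (p0, 0)); have /= := nth1 (inl (p0, 1)).
  rewrite addn0 addn1 => -> ->; rewrite mem_sorted_pairs !lsv_le L1p andbT /=.
  have ne1 b : lsv (L1 (inl (p0, b))) != p0.+1.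
    rewrite ffunE lsv1 /=; set b' := if _ then _ else _; apply/eqP => e.
    have := forallP (hp p0) b'.
    by rewrite (@lsv_inj _ _ _ _ (inr (inl p0)) e) ?e // eqxx.
  by rewrite !ne1.
have -> : iota m j = [seq (m + q)%N | q <- iota 0 j] by rewrite -iotaDl addn0.
rewrite -map_comp; apply: all2_mem_map => i; rewrite mem_iota => /andP[_ /ord_lt[q ->]].
have e0 : nth 0%N sh (2 * m + 3 * q)%N = lsv (L1 (inr (q, 0))) by rewrite -nth1 /= addn0.
have e1 : nth 0%N sh (2 * m + (3 * q).+1)%N = lsv (L1 (inr (q, 1))).
  by rewrite -nth1 addnS -addn1.
have e2 : nth 0%N sh (2 * m + (3 * q).+2)%N = lsv (L1 (inr (q, 2))).
  by rewrite -nth1 !addnS -addn2.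
rewrite e0 e1 e2.
rewrite mem_sorted_triples !lsv_le L1q andbT /=.
have ne1 b : lsv (L1 (inr (q, b))) != (m + q).+1.
  rewrite ffunE lsv1 /= ffunE; apply/eqP => e.
  have := forallP (hq q) (pi q b).
  by rewrite (@lsv_inj _ _ _ _ (inr (inr q)) e) ?e // eqxx.
by rewrite !ne1.
Qed.

Lemma leibniz_type_sub (R : realFieldType) n m j (U : {vspace gsum R n.+1 (m + (j + j))}) :
    (forall s (L : lgraph n.+1 m j), s \in lshadows n.+1 m j ->
       lcode L = fill_flat 0 s -> skew (expand R L) \in U) ->
  (leibniz_type R n.+1 m j <= U)%VS.
Proof.
move=> h; apply/span_subvP => v /mapP[L]; rewrite mem_enum => vL ->.
have [->|[s sin [L' e [b ->]]]] := lgraph_normal_form R vL; first exact: mem0v.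
by rewrite memvZ // (h s).
Qed.

(** Putting the label of the Jacobiator into the [uniq] test expresses at once that its targets are
    distinct and that none is itself. *)
Definition lvalid n m j (c : seq vx) : bool :=
  [&& size c == (2 * m + 3 * j)%N, all (ok_vx n (m + j)) c,
      perm_eq (pmap sink_of c) (iota 0 n),
      all (fun p => let x := nth (inl 0%N : vx) c in
             ~~ eqvx (x (2 * p)%N) (inr p) && ~~ eqvx (x (2 * p).+1) (inr p)) (iota 0 m)
    & all (fun q => let x := nth (inl 0%N : vx) c in
             let a := x (2 * m + 3 * q)%N in let b := x (2 * m + 3 * q).+1 in
             let d := x (2 * m + 3 * q).+2 in
             uniq [:: a; b; d; inr (m + q)%N]) (iota 0 j)].

Section CodeToLeibniz.
Variables (n m j : nat).

Definition to_lvertex (v : vx) : lvertex n.+1 m j.+1 :=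
  match v with
  | inl s => inl (inord s)
  | inr i => if insub i is Some p then inr (inl p) else inr (inr (inord (i - m)))
  end.

Lemma to_lvertexK v : ok_vx n.+1 (m + j.+1) v -> of_lvertex (to_lvertex v) = v.
Proof.
case: v => [s|i] /= h; first by rewrite inordK.
case: insubP => [p _ <- //|]; rewrite -leqNgt => mi /=.
by rewrite inordK ?subnKC //; lia.
Qed.

Lemma of_lvertex_inj : injective (@of_lvertex n.+1 m j.+1).
Proof.
move=> [x|[p|q]] [y|[p'|q']] //= [e].
- by rewrite (ord_inj e).
- by rewrite (ord_inj e).
- by have := ltn_ord p; lia.
- by have := ltn_ord p'; lia.
by congr (inr (inr _)); apply: ord_inj; lia.
Qed.

Lemma lgraph_of_code c : lvalid n.+1 m j.+1 c ->
  exists2 L : lgraph n.+1 m j.+1, is_leibniz_multivector L & lcode L = c.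
Proof.
case/and5P=> /eqP sc okc ps hp hq.
pose L : lgraph n.+1 m j.+1 := [ffun a => to_lvertex (nth (inl 0%N) c (arrow_index a))].
have LE a : of_lvertex (L a) = nth (inl 0%N) c (arrow_index a).
  by rewrite ffunE to_lvertexK //; apply: (allP okc); rewrite mem_nth // sc arrow_index_lt.
have cE : lcode L = c.
  have [arr idxK arrK] := arrow_ord_bij m j.+1.
  apply: (@eq_from_nth _ (inl 0%N)); first by rewrite size_lcode sc.
  rewrite size_lcode => i iN; have e : i = arrow_index (arr (Ordinal iN)).
    by rewrite -[LHS]/(val (Ordinal iN)) -{1}[Ordinal iN]arrK.
  by rewrite {1}e nth_lcode LE -e.
have xE (u v : vx) : eqvx u v = (u == v) by apply/eqvxP/eqP.
exists L => //; apply/and5P; split=> //.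
- apply/forallP => s; rewrite count_sinks_lgraph cE (seq.permP ps).
  by rewrite count_uniq_mem ?iota_uniq // mem_iota ltn_ord.
- apply/forallP => p; apply/forallP => b.
  have pm : (p : nat) \in iota 0 m by rewrite mem_iota ltn_ord.
  have /andP[h0 h1] := allP hp _ pm.
  rewrite -(inj_eq of_lvertex_inj) LE /=; rewrite !xE in h0 h1.
  by case: b => [[|[|//]] hb] /=; rewrite ?addn0 ?addn1.
- apply/forallP => q; apply/injectiveP => b b' /(congr1 (@of_lvertex _ _ _)).
  have qm : (q : nat) \in iota 0 j.+1 by rewrite mem_iota ltn_ord.
  rewrite !LE /=; move: (allP hq _ qm) => /=; rewrite !inE !negb_or -!andbA.
  case/and5P=> n1 n2 n3 n4 /and3P[n5 n6 _].
  by case: b b' => [[|[|[|//]]] hb] [[|[|[|//]]] hb'] /=; rewrite ?addn0 ?addn1 ?addn2 => e;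
    apply: val_inj => //=; move: n1 n2 n4; rewrite e eqxx.
apply/forallP => q; apply/forallP => b; rewrite -(inj_eq of_lvertex_inj) LE /=.
have qm : (q : nat) \in iota 0 j.+1 by rewrite mem_iota ltn_ord.
move: (allP hq _ qm) => /=; rewrite !inE !negb_or -!andbA.
case/and5P=> n1 n2 n3 n4 /and3P[n5 n6 _].
by case: b => [[|[|[|//]]] hb] /=; rewrite ?addn0 ?addn1 ?addn2.
Qed.

End CodeToLeibniz.

Lemma skew_expand_vec (R : realFieldType) n k m j (L : lgraph n.+1 m j)
    (e : (m + (j + j) = k.+1)%N) :
  ecast k' (gsum R n.+1 k') e (skew (expand R L)) =
  evc R n k [seq (1 : int, c) | c <- expand_terms m j (lcode L)].
Proof.
have [gs -> <-] := expand_codes R L; move: (m + (j + j))%N e gs => K e gs; subst K.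
rewrite skew_sum /evc -map_comp big_map; apply: eq_bigr => g _ /=.
by rewrite scale1r /vec of_graphK.
Qed.

(** * Certificates and their soundness *)

Definition isz0 (x : int) : bool := if x is Posz 0 then true else false.
Definition lincomb (l : seq (int * poly)) : poly :=
  foldr (fun x p => foldr (fun y q => padd (intRing.mulz x.1 y.1) y.2 q) p x.2) [::] l.
Definition null_poly (p : poly) : bool := all (fun x => isz0 x.1) p.
Definition entries (tbl : seq shadow) (l : seq (int * nat)) : poly :=
  [seq (x.1, nth [::] tbl x.2) | x <- l].

Definition terms_ok n k (m j : nat) (s : seq nat) : bool :=
  all (valid n k) (expand_terms m j (fill_flat 0 s)).

(* A certificate is a list of pairs (functional on tri-vectors, bi-vector); the
   functionals annihilate Leibniz graphs, and the map sum phi_i(-) * b_i retracts the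
   bracket modulo the claimed solutions. *)
Definition annihilates n k (cert : seq (poly * poly)) (m j : nat) : bool :=
  all (fun s => terms_ok n k m j s &&
    (let p := leibniz_poly m j s in
     all (fun x => canonical n k x.2) p && all (fun z => isz0 (dot p z.1)) cert))
  (lshadows n m j).

Definition covers n k (basis : seq shadow) : bool :=
  all (fun s => let c := fill 0 (pair_up s) in
         valid n k c && (if canon c is Some (_, t) then has (eqsh t) basis else true))
      (shadows n k).

Definition bracket_ok n k (s : shadow) : bool :=
  valid n k (fill 0 s) && all (fun x => valid n.+1 k.+1 x.2) (bracket_terms n (fill 0 s)).

Definition separates n k (cert : seq (poly * poly)) : bool :=
  all (fun z => all (fun x => separating n k x.2) z.1) cert.

Lemma isz0P x : isz0 x -> x = 0.
Proof. by case: x => [[]|]. Qed.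

Lemma mem_zip2 (S T : eqType) (s : seq S) (t : seq T) y : y \in zip s t -> y.2 \in t.
Proof.
elim: s t => [|a s IH] [|b t] //=; rewrite !inE => /orP[/eqP ->|/IH ->].
  by rewrite eqxx.
by rewrite orbT.
Qed.

Section Final.
Variable R : realFieldType.

Lemma ev_lincomb n k l : ev R n k (lincomb l) = \sum_(x <- l) x.1%:~R *: ev R n k x.2.
Proof.
elim: l => [|[c p] l IH] /=; first by rewrite /ev !big_nil.
rewrite big_cons -IH /=; elim: p => [|[d s] p IHp] /=.
  by rewrite {2}/ev big_nil scaler0 add0r.
have -> : ev R n k ((d, s) :: p) = d%:~R *: class R n k s + ev R n k p.
  by rewrite /ev big_cons.
rewrite ev_padd IHp scalerDr scalerA addrA; congr (_ *: _ + _ + _).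
by rewrite -[intRing.mulz c d]/(c * d) intrM.
Qed.

Lemma null_polyP n k p : null_poly p -> ev R n k p = 0.
Proof.
by move=> /allP h; rewrite /ev big1_seq // => x /andP[_ /h/isz0P ->]; rewrite scale0r.
Qed.

Lemma bracket_class n k s : bracket_ok n.+1 k.+1 s ->
  bracket_P R n k.+1 (class R n k s) = ev R n.+1 k.+1 (bracket_poly n.+1 s).
Proof. by case/andP=> v1 v2; rewrite /class vec_bracket // reduce_sound. Qed.

Lemma bracket_ev n k p : all (fun x => bracket_ok n.+1 k.+1 x.2) p ->
  bracket_P R n k.+1 (ev R n k p) =
  ev R n.+1 k.+1 (lincomb [seq (x.1, bracket_poly n.+1 x.2) | x <- p]).
Proof.
move=> /allP h; rewrite ev_lincomb big_map /ev linear_sum; apply: eq_big_seq => x xp.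
by rewrite linearZ /= bracket_class ?h.
Qed.

Lemma multivectors_sub n k basis (U : {vspace gsum R n.+1 k.+1}) :
    covers n.+1 k.+1 basis -> (forall s, s \in basis -> class R n k s \in U) ->
  (multivectors R n.+1 k.+1 <= U)%VS.
Proof.
move=> /allP cov bU; apply/span_subvP => v /mapP[g]; rewrite mem_enum => mg ->.
have [->|[s sin [b ->]]] := multivector_class R mg; first exact: mem0v.
have /andP[vs] := cov _ sin; rewrite /class (canon_sound R vs).
case: canon => [[b' t]|] h; last by rewrite scaler0 mem0v.
by rewrite !memvZ //; case/hasP: h => t' t'in /eqshP ->; apply: bU.
Qed.

Lemma class_multivector n k s : is_multivector (to_graph n k (fill 0 s)) ->
  class R n k s \in multivectors R n.+1 k.+1.
Proof. by move=> h; apply: memv_span; apply: map_f; rewrite mem_enum. Qed.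

(** [leibniz] recovers the number of ordinary vertices as k - 2j, which is m here; the casts agree
    because equality proofs between numbers are unique. *)
Lemma leibniz_type_le n m j k (e : (m + (j + j) = k)%N) :
  (ecast k' {vspace gsum R n k'} e (leibniz_type R n m j) <= leibniz R n k)%VS.
Proof.
subst k; have jk : (j < (m + (j + j)).+1)%N by lia.
rewrite /leibniz (bigD1 (Ordinal jk)) //=; apply: subv_trans (addvSl _ _).
case: eqP => [e|]; last by rewrite addnK.
by move: e; rewrite addnK => e; rewrite (eq_irrelevance e erefl).
Qed.

Lemma leibniz_mem n m j k (L : lgraph n m j) (e : (m + (j + j) = k)%N) :
    is_leibniz_multivector L ->
  ecast k' (gsum R n k') e (skew (expand R L)) \in leibniz R n k.
Proof.
move=> vL; apply: (subvP (leibniz_type_le n e)); subst k => /=.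
by apply: memv_span; apply: map_f; rewrite mem_enum.
Qed.

Lemma leibniz_poly_mem n m j k s : (m + (j.+1 + j.+1) = k.+1)%N ->
    lvalid n.+1 m j.+1 (fill_flat 0 s) -> terms_ok n.+1 k.+1 m j.+1 s ->
  ev R n k (leibniz_poly m j.+1 s) \in leibniz R n.+1 k.+1.
Proof.
move=> e /lgraph_of_code[L vL eL] ok; have := leibniz_mem e vL.
by rewrite skew_expand_vec eL reduce_sound // all_map.
Qed.

(** Quantifying over [V] pulls [U] back along the cast, so that span arguments can be run in the
    uncast space. *)
Lemma ecast_le n K k (e : K = k) (A : {vspace gsum R n K}) (U : {vspace gsum R n k}) :
    (forall V : {vspace gsum R n K},
      (forall v, ecast k' (gsum R n k') e v \in U -> v \in V) -> (A <= V)%VS) ->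
  (ecast k' {vspace gsum R n k'} e A <= U)%VS.
Proof. by subst k => h; apply: h. Qed.

Lemma leibniz_type0 n m j : j = 0%N -> leibniz_type R n m j = 0%VS.
Proof.
move=> ->; apply/eqP; rewrite -subv0; apply/span_subvP => v /mapP[L].
by rewrite mem_enum => /and5P[].
Qed.

Lemma leibniz_sub n k (U : {vspace gsum R n.+1 k.+1}) :
    (forall m j s, (m + (j + j) = k.+1)%N -> (0 < j)%N -> s \in lshadows n.+1 m j ->
       terms_ok n.+1 k.+1 m j s /\ ev R n k (leibniz_poly m j s) \in U) ->
  (leibniz R n.+1 k.+1 <= U)%VS.
Proof.
move=> h; apply/subv_sumP => j _; case: eqP => [e|_]; last exact: sub0v.
apply: ecast_le => V hV.
have [j0|jp] := posnP (nat_of_ord j); first by rewrite leibniz_type0 // sub0v.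
apply: leibniz_type_sub => s L sin eL; apply: hV.
have [ok sU] := h _ _ _ e jp sin.
by rewrite skew_expand_vec eL reduce_sound // all_map.
Qed.

(** The division by [d] keeps the functionals and the vectors of a certificate integral. *)
Definition retraction (d : int) n k n' k' (cert : seq (poly * poly))
    (v : gsum R n.+1 k.+1) : gsum R n'.+1 k'.+1 :=
  \sum_(z <- cert) (d%:~R^-1 * functional z.1 v) *: ev R n' k' z.2.

Lemma retraction_is_linear d n k n' k' cert : linear (@retraction d n k n' k' cert).
Proof.
move=> a u v; rewrite /retraction scaler_sumr -big_split; apply: eq_bigr => z _ /=.
have -> : functional z.1 (a *: u + v) = a * functional z.1 u + functional z.1 v.
  exact: functional_is_linear.
by rewrite mulrDr scalerDl scalerA mulrCA.
Qed.

HB.instance Definition _ d n k n' k' cert :=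
  GRing.isLinear.Build R (gsum R n.+1 k.+1) (gsum R n'.+1 k'.+1) _
    (@retraction d n k n' k' cert) (@retraction_is_linear d n k n' k' cert).

Lemma annihilates_leibniz d n k n' k' cert : separates n.+1 k.+1 cert ->
    (forall m j, (m + (j + j) = k.+1)%N -> (0 < j)%N -> annihilates n.+1 k.+1 cert m j) ->
  forall v, v \in leibniz R n.+1 k.+1 -> @retraction d n k n' k' cert v = 0.
Proof.
move=> /allP sep ann v vin.
suff: (leibniz R n.+1 k.+1 <= lker (linfun (@retraction d n k n' k' cert)))%VS.
  by move=> /subvP/(_ v vin); rewrite memv_ker lfunE /= => /eqP.
apply: leibniz_sub => m j s e j0 sin.
have /andP[ok /andP[can /allP z0]] := allP (ann _ _ e j0) _ sin.
split=> //; rewrite memv_ker lfunE /= /retraction big1_seq // => z /andP[_ zin].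
by rewrite functional_ev ?sep // (isz0P (z0 _ zin)) mulr0 scale0r.
Qed.

(* The check behind [solutions_sub]: up to the factor d, each basis class is the
   combination of certificate vectors prescribed by its bracket plus a combination of [vs]. *)
Definition solves n k (d : int) cert (vs : seq poly) (basis : seq shadow)
    (coords : seq (seq int)) : bool :=
  all (fun x : shadow * seq int =>
    let p := bracket_poly n x.1 in
    [&& bracket_ok n k x.1, all (fun y => canonical n.+1 k.+1 y.2) p
      & null_poly (lincomb ((intZmod.oppz d, [:: (1, x.1)]) ::
          [seq (dot p z.1, z.2) | z <- cert] ++ zip x.2 vs))]) (zip basis coords).

Lemma solutions_sub d cert (vs : seq poly) basis coords k (U : {vspace gsum R 2 k.+1}) :
    d != 0 -> separates 3 k.+2 cert ->
    (forall m j, (m + (j + j) = k.+2)%N -> (0 < j)%N -> annihilates 3 k.+2 cert m j) ->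
    covers 2 k.+1 basis -> size basis = size coords -> solves 2 k.+1 d cert vs basis coords ->
    (forall p, p \in vs -> ev R 1 k p \in U) ->
  (solutions R k.+1 <= U)%VS.
Proof.
move=> d0 sep ann cov sz /allP sol vU; apply/subvP => x; rewrite memv_cap => /andP[xm].
rewrite -memv_preim => xb.
have d0' : d%:~R != 0 :> R by rewrite intr_eq0.
have flin : linear (fun v : gsum R 2 k.+1 => v - @retraction d 2 k.+1 1 k cert (bracket_P R 1 k.+1 v)).
  move=> a u v; have -> : @retraction d 2 k.+1 1 k cert (bracket_P R 1 k.+1 (a *: u + v)) =
      a *: retraction d 1 k cert (bracket_P R 1 k.+1 u) +
      retraction d 1 k cert (bracket_P R 1 k.+1 v).
    by rewrite (linearP (bracket_P R 1 k.+1)); apply: retraction_is_linear.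
  by rewrite scalerBr opprD addrACA.
pose F : {linear gsum R 2 k.+1 -> gsum R 2 k.+1} :=
  HB.pack (fun v : gsum R 2 k.+1 => v - @retraction d 2 k.+1 1 k cert (bracket_P R 1 k.+1 v))
    (GRing.isLinear.Build _ _ _ _ _ flin).
have : x \in (linfun F @^-1: U)%VS.
  (* By linearity only the spanning classes matter, and for them [solves] provides the identity. *)
  move: x xm {xb}; apply/subvP; apply: (multivectors_sub cov) => s sin.
  rewrite -memv_preim lfunE /=.
  have si : (index s basis < size basis)%N by rewrite index_mem.
  have := sol (nth ([::], [::]) (zip basis coords) (index s basis)).
  rewrite mem_nth ?size_zip -?sz ?minnn // => /(_ isT).
  rewrite nth_zip //= nth_index // => /and3P[ok can /null_polyP e].
  have {e} := e 1%N k; rewrite ev_padd ev_lincomb big_cat big_map /=.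
  rewrite -[intRing.mulz _ _]/(- d * 1) mulr1 intrN scaleNr => e.
  rewrite bracket_class // /retraction.
  have -> : \sum_(z <- cert) (d%:~R^-1 * functional z.1 (ev R 2 k.+1 (bracket_poly 2 s))) *:
      ev R 1 k z.2 =
      d%:~R^-1 *: \sum_(z <- cert) (dot (bracket_poly 2 s) z.1)%:~R *: ev R 1 k z.2.
    rewrite scaler_sumr; apply: eq_big_seq => z zin.
    by rewrite functional_ev ?(allP sep) // scalerA.
  have {}e := subr0_eq (etrans (addrC _ _) e).
  rewrite -[class R 1 k s](scalerK d0') -e scalerDr addrAC subrr add0r.
  apply: memvZ; rewrite big_seq; apply: memv_suml => y yin; apply: memvZ; apply: vU.
  exact: mem_zip2 yin.
(* On a solution the retraction of the bracket is 0, so the map [F] fixes it. *)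
by rewrite -memv_preim lfunE /= (@annihilates_leibniz d 2 k.+1 1 k cert sep ann _ xb) subr0.
Qed.

Lemma notin_span (V : vectType R) (f : {linear V -> R^o}) (v : V) (U : {vspace V}) :
  f v != 0 -> (forall w, w \in U -> f w = 0) -> v \notin U.
Proof. by move=> fv fU; apply: contra fv => /fU ->. Qed.

Lemma encoded_graph n k (c : seq (nat * nat)) (d : code) :
    size c = k.+1 ->
    d = [seq map_pair (fun x => if (x < n.+1)%N then inl x else inr (x - n.+1)%N : vx) p | p <- c] ->
    all (fun p => (p.1 < n.+1 + k.+1) && (p.2 < n.+1 + k.+1))%N c ->
  encoded n k.+1 c = to_graph n k d.
Proof.
move=> sc -> cin; apply/ffunP => i; rewrite !ffunE (nth_map (0, 0)%N) ?sc //.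
have labE x : (x < n.+1 + k.+1)%N -> @split n.+1 k.+1 (inord x) =
    to_vertex n k (if (x < n.+1)%N then inl x else inr (x - n.+1)%N).
  move=> xlt; case: ltnP => xn.
    rewrite (_ : inord x = lshift k.+1 (inord x : 'I_n.+1)) ?splitl //.
    by apply: ord_inj; rewrite /= !inordK.
  transitivity (@split n.+1 k.+1 (rshift n.+1 (inord (x - n.+1) : 'I_k.+1))); last first.
    exact: (unsplitK (inr (inord (x - n.+1)) : 'I_n.+1 + 'I_k.+1)).
  by congr split; apply: ord_inj; rewrite /= !inordK ?subnKC //; lia.
have ic : (i < size c)%N by rewrite sc.
by have /andP[a b] := allP cin _ (mem_nth (0, 0)%N ic); rewrite /map_pair /= !labE.
Qed.

Lemma has_2cycle_transform n k s t f (g : kgraph n k) :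
  has_2cycle (transform s t f g) -> has_2cycle g.
Proof.
have tE a : target (transform s t f g) a =
    rename s t (target g ((t^-1)%g a.1, a.2 (+) f ((t^-1)%g a.1))).
  by rewrite /target ffunE /=; case: (f _); case: (a.2).
have rE v i : rename s t v = inr i -> v = inr ((t^-1)%g i).
  by case: v => //= y [<-]; rewrite permK.
case/existsP => a /existsP[b /and3P[ab /eqP]]; rewrite !tE => /rE e1 /eqP/rE e2.
apply/existsP; exists ((t^-1)%g a.1, a.2 (+) f ((t^-1)%g a.1)).
apply/existsP; exists ((t^-1)%g b.1, b.2 (+) f ((t^-1)%g b.1)).
by rewrite e1 e2 !eqxx !andbT /= (inj_eq perm_inj).
Qed.

(** The support of a skew-symmetrised graph lies in its orbit, and a 2-cycle anywhere in the orbit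
    gives one in [g]. *)
Lemma skew_without_2cycles n k (g : kgraph n k) :
  ~~ has_2cycle g -> without_2cycles (skew (gen R g)).
Proof.
move=> ng h ch; rewrite skew_gen /skew_graph ffunE.
rewrite sum_ffunE big1 ?scaler0 // => s _; rewrite sum_ffunE big1 // => t _.
rewrite sum_ffunE big1 // => f _; rewrite !ffunE; case: eqP => [e|_]; last by rewrite scaler0.
by rewrite e in ch; rewrite (has_2cycle_transform ch) in ng.
Qed.

Definition code_2cycle (c : code) : bool :=
  has (fun i => has (fun j => [&& i != j,
      has (eqvx (inr j)) [:: (nth vx0 c i).1; (nth vx0 c i).2] &
      has (eqvx (inr i)) [:: (nth vx0 c j).1; (nth vx0 c j).2]]) (iota 0 (size c)))
    (iota 0 (size c)).

Lemma has_2cycle_code n k c : size c = k.+1 -> all (in_range k.+1) (targets c) ->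
  has_2cycle (to_graph n k c) -> code_2cycle c.
Proof.
move=> sc cin /existsP[a /existsP[b /and3P[ab /eqP ta /eqP tb]]].
have key (x : 'I_k.+1 * bool) (y : 'I_k.+1) : target (to_graph n k c) x = inr y ->
    has (eqvx (inr (y : nat))) [:: (nth vx0 c x.1).1; (nth vx0 c x.1).2].
  have /andP[r1 r2] := nth_in_range x.1 cin.
  have vE v : in_range k.+1 v -> to_vertex n k v = inr y -> eqvx (inr (y : nat)) v.
    by case: v => //= i ik [<-]; rewrite inordK // eqnE.
  rewrite /target !ffunE; case: ifP => _ h; apply/hasP.
    by exists (nth vx0 c x.1).2; [rewrite !inE eqxx orbT|apply: (vE _ r2 h)].
  by exists (nth vx0 c x.1).1; [rewrite !inE eqxx|apply: (vE _ r1 h)].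
apply/hasP; exists (a.1 : nat); first by rewrite mem_iota sc ltn_ord.
apply/hasP; exists (b.1 : nat); first by rewrite mem_iota sc ltn_ord.
by rewrite (key _ _ ta) (key _ _ tb) !andbT.
Qed.

End Final.

(** * Certificate data: spanning shadows, functionals and factorisations *)

Definition basis24 : seq shadow := [seq pair_up s | s <- [::
   [:: 0; 2; 3; 4; 2; 4; 0; 3]; [:: 0; 4; 3; 4; 0; 4; 2; 3]; [:: 0; 4; 3; 4; 2; 4; 0; 3];
   [:: 2; 3; 0; 4; 1; 4; 0; 3]; [:: 2; 3; 3; 4; 0; 4; 0; 1]; [:: 2; 3; 3; 4; 0; 4; 0; 2];
   [:: 2; 3; 3; 4; 1; 4; 0; 0]; [:: 2; 4; 0; 3; 1; 4; 0; 3]; [:: 2; 4; 0; 4; 0; 4; 1; 3];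
   [:: 2; 4; 1; 4; 0; 4; 0; 3]; [:: 2; 4; 3; 4; 0; 4; 0; 1]; [:: 2; 4; 3; 4; 0; 4; 0; 3];
   [:: 2; 4; 3; 4; 1; 4; 0; 0]; [:: 3; 4; 0; 0; 1; 4; 2; 3]; [:: 3; 4; 0; 1; 2; 4; 0; 3];
   [:: 3; 4; 0; 3; 1; 4; 0; 2]; [:: 3; 4; 0; 3; 2; 4; 0; 1]; [:: 3; 4; 0; 4; 0; 4; 2; 3];
   [:: 3; 4; 0; 4; 1; 2; 0; 3]; [:: 3; 4; 0; 4; 2; 4; 0; 3]; [:: 3; 4; 3; 4; 0; 4; 0; 2];
   [:: 3; 4; 3; 4; 2; 4; 0; 0]]%N].

(** The tri-vector shadows at which the functionals of [certificate4] read coordinates. *)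
Definition support35 : seq shadow := [seq pair_up s | s <- [::
   [:: 0; 2; 4; 5; 4; 5; 3; 5; 0; 0]; [:: 0; 3; 0; 5; 4; 5; 3; 5; 0; 4];
   [:: 0; 3; 4; 5; 4; 5; 2; 3; 0; 0]; [:: 0; 4; 0; 5; 4; 5; 3; 5; 0; 4];
   [:: 0; 5; 3; 4; 0; 5; 2; 5; 0; 4]; [:: 0; 5; 3; 4; 4; 5; 0; 5; 0; 2];
   [:: 0; 5; 3; 4; 4; 5; 2; 5; 0; 0]; [:: 0; 5; 3; 5; 0; 4; 2; 5; 0; 4];
   [:: 0; 5; 3; 5; 0; 5; 0; 5; 2; 4]; [:: 0; 5; 3; 5; 4; 5; 0; 0; 2; 4];
   [:: 0; 5; 3; 5; 4; 5; 0; 5; 0; 2]; [:: 0; 5; 3; 5; 4; 5; 2; 5; 0; 0];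
   [:: 0; 5; 4; 5; 0; 0; 3; 5; 2; 4]; [:: 0; 5; 4; 5; 0; 2; 3; 5; 0; 4];
   [:: 0; 5; 4; 5; 0; 4; 2; 5; 0; 3]; [:: 0; 5; 4; 5; 0; 5; 0; 2; 3; 4];
   [:: 0; 5; 4; 5; 0; 5; 2; 3; 0; 4]; [:: 2; 4; 1; 4; 0; 5; 0; 5; 0; 3];
   [:: 2; 4; 3; 4; 1; 5; 0; 5; 0; 0]; [:: 2; 4; 4; 5; 0; 5; 1; 3; 0; 0];
   [:: 2; 5; 1; 5; 0; 5; 0; 0; 3; 4]; [:: 2; 5; 3; 5; 4; 5; 0; 0; 0; 4];
   [:: 2; 5; 3; 5; 4; 5; 0; 1; 0; 0]; [:: 2; 5; 4; 5; 0; 0; 3; 5; 0; 4];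
   [:: 2; 5; 4; 5; 4; 5; 0; 0; 0; 3]; [:: 3; 4; 0; 5; 4; 5; 0; 3; 0; 2];
   [:: 3; 4; 0; 5; 4; 5; 0; 5; 0; 3]; [:: 3; 4; 0; 5; 4; 5; 0; 5; 0; 4];
   [:: 3; 4; 3; 5; 4; 5; 0; 5; 0; 0]; [:: 3; 4; 4; 5; 0; 1; 0; 5; 0; 2];
   [:: 3; 4; 4; 5; 0; 5; 1; 2; 0; 0]; [:: 3; 4; 4; 5; 4; 5; 0; 5; 0; 0];
   [:: 3; 5; 0; 4; 4; 5; 3; 5; 0; 0]; [:: 3; 5; 4; 5; 0; 4; 2; 5; 0; 0];
   [:: 3; 5; 4; 5; 0; 5; 0; 5; 0; 2]; [:: 4; 5; 0; 4; 4; 5; 0; 5; 0; 3];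
   [:: 4; 5; 0; 4; 4; 5; 3; 5; 0; 0]; [:: 4; 5; 0; 5; 0; 0; 2; 5; 3; 4];
   [:: 4; 5; 0; 5; 0; 5; 0; 5; 3; 4]; [:: 4; 5; 3; 5; 0; 4; 2; 5; 0; 0];
   [:: 4; 5; 4; 5; 0; 2; 3; 5; 0; 0]; [:: 4; 5; 4; 5; 0; 5; 3; 5; 0; 0];
   [:: 4; 5; 4; 5; 4; 5; 0; 5; 0; 0]]%N].

Definition basis23 : seq shadow := [seq pair_up s | s <- [::
   [:: 0; 3; 0; 3; 1; 2]; [:: 2; 3; 0; 3; 0; 1]; [:: 2; 3; 0; 3; 0; 2]; [:: 2; 3; 1; 3; 0; 0]]%N].

Definition support34 : seq shadow := [seq pair_up s | s <- [::
   [:: 0; 2; 3; 4; 0; 4; 0; 3]; [:: 0; 3; 0; 4; 2; 4; 0; 3]; [:: 0; 3; 3; 4; 2; 4; 0; 0];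
   [:: 0; 4; 0; 3; 2; 4; 0; 3]; [:: 0; 4; 3; 4; 0; 4; 0; 2]; [:: 2; 3; 0; 4; 0; 4; 0; 3];
   [:: 2; 3; 3; 4; 0; 4; 0; 0]; [:: 2; 4; 3; 4; 0; 1; 0; 0]; [:: 3; 4; 0; 3; 2; 4; 0; 0];
   [:: 3; 4; 3; 4; 0; 4; 0; 0]]%N].

(** It has 17 entries: the 22 shadows of [basis24] less the five solutions. *)
Definition certificate4 : seq (poly * poly) :=
  [seq (entries support35 x.1, entries basis24 x.2) | x <- [::
   ([:: (1, 25%N); (1, 38%N)],
    [:: (1, 17%N)]);
   ([:: (1, 8%N); (1, 34%N)],
    [:: (1, 8%N)]);
   ([:: (1, 37%N); (1, 41%N)],
    [:: (2, 19%N)]);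
   ([:: (1, 10%N); (2, 22%N)],
    [:: (1, 10%N)]);
   ([:: (1, 17%N); ((-2), 20%N)],
    [:: (1, 9%N)]);
   ([:: (1, 15%N); (1, 29%N)],
    [:: ((-1), 16%N)]);
   ([:: (2, 24%N); (1, 27%N); (1, 35%N)],
    [:: (1, 4%N); (1, 11%N)]);
   ([:: (1, 3%N); ((-2), 9%N); ((-2), 21%N); (2, 24%N); (1, 35%N)],
    [:: ((-1), 0%N); (1, 1%N); ((-1), 3%N); (1, 5%N); ((-1), 15%N); (1, 18%N)]);
   ([:: (1, 3%N); ((-2), 12%N); ((-2), 23%N); ((-1), 27%N)],
    [:: (1, 0%N); ((-1), 1%N); (1, 2%N); (1, 15%N)]);
   ([:: ((-1), 5%N); ((-6), 11%N); (2, 18%N); (2, 21%N); (1, 27%N)],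
    [:: ((-1), 4%N)]);
   ([:: (1, 9%N); (1, 21%N); ((-1), 31%N); ((-1), 36%N); ((-2), 42%N)],
    [:: ((-2), 0%N); (2, 1%N); ((-2), 3%N); (2, 5%N); ((-1), 6%N); ((-2), 15%N); (2, 18%N)]);
   ([:: (2, 0%N); (2, 12%N); (1, 14%N); (2, 23%N); (1, 27%N); (2, 33%N); ((-2), 36%N)],
    [:: (1, 15%N)]);
   ([:: ((-1), 3%N); (2, 6%N); (2, 9%N); (1, 16%N); ((-2), 19%N)],
    [:: (1, 18%N)]);
   ([:: (1, 1%N); ((-1), 3%N); ((-1), 7%N); ((-2), 32%N); (2, 36%N); ((-2), 39%N)],
    [:: ((-1), 0%N)]);
   ([:: (1, 3%N); (1, 7%N); ((-1), 26%N); ((-2), 28%N); ((-2), 36%N); (2, 39%N)],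
    [:: ((-1), 0%N); (1, 7%N)]);
   ([:: ((-1), 3%N); (1, 13%N); (1, 26%N); (2, 28%N); (2, 36%N); (2, 40%N); ((-2), 41%N)],
    [:: ((-1), 0%N); ((-1), 3%N); (1, 5%N); (1, 7%N)]);
   ([:: (2, 2%N); (1, 4%N); (1, 26%N); (2, 28%N); (2, 30%N); (2, 32%N)],
    [:: (1, 3%N)])]].

Definition certificate3 : seq (poly * poly) :=
  [seq (entries support34 x.1, entries basis23 x.2) | x <- [::
   ([:: (1, 4%N); (2, 7%N)], [:: (4, 1%N); ((-2), 2%N)]);
   ([:: (1, 3%N); (2, 8%N)], [:: (2, 0%N)]);
   ([:: (2, 0%N); (1, 1%N); ((-1), 5%N); (2, 9%N)], [:: (2, 2%N); (1, 3%N)]);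
   ([:: ((-2), 0%N); ((-1), 1%N); (2, 2%N); (1, 5%N); (2, 6%N)], [:: (1, 3%N)])]].

(** Each row expresses twice a shadow of [basis24], modulo the correction terms, in the tetrahedral,
    the trivial and the three improper solutions. A zero row means that the class is recovered from
    its bracket alone. *)
Definition coordinates4 : seq (seq int) := [::
   [:: 0; 0; 0; 0; 0];
   [:: 0; 0; 0; 0; 0];
   [:: 0; 0; 0; 0; 0];
   [:: 0; 0; 0; 0; 0];
   [:: 0; 0; 0; 0; 0];
   [:: 0; 0; 0; 0; 0];
   [:: 0; 0; 0; 0; 0];
   [:: 0; 0; 0; 0; 0];
   [:: 0; 0; 0; 0; 0];
   [:: 0; 0; 0; 0; 0];
   [:: 0; 0; 0; 0; 0];
   [:: 0; 0; 0; 0; 0];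
   [:: (-2); 0; 0; 0; 0];
   [:: 0; (-2); 0; 0; 0];
   [:: 0; 0; 2; 0; 0];
   [:: 0; 0; 0; 0; 0];
   [:: 0; 0; 0; 0; 0];
   [:: 0; 0; 0; 0; 0];
   [:: 0; 0; 0; 0; 0];
   [:: 0; 0; 0; 0; 0];
   [:: 0; 0; 2; 2; 0];
   [:: 0; (-2); 0; 0; (-2)]].

(** Three times the bracket of the tetrahedral flow as a combination of eight Leibniz graphs. In the
    target lists 1, 2, 3 are the ordinary vertices, 4 is the Jacobiator and 0 a sink. *)
Definition tetra_factor : seq (int * seq nat) := [::
   (18, [:: 0; 0; 0; 1; 1; 2; 1; 2; 3]%N);
   ((-18), [:: 0; 0; 1; 3; 1; 4; 0; 1; 2]%N);
   (12, [:: 0; 2; 0; 3; 0; 1; 1; 2; 3]%N);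
   (36, [:: 0; 2; 0; 3; 1; 4; 0; 1; 2]%N);
   (36, [:: 0; 2; 0; 4; 1; 2; 0; 1; 3]%N);
   (18, [:: 0; 2; 3; 4; 1; 4; 0; 0; 1]%N);
   ((-18), [:: 0; 4; 1; 3; 1; 4; 0; 0; 2]%N);
   (2, [:: 2; 4; 3; 4; 1; 4; 0; 0; 0]%N)].

Definition trivial_factor : seq (int * seq nat) := [::
   ((-6), [:: 0; 2; 1; 3; 1; 2; 0; 0; 1]%N);
   ((-6), [:: 0; 2; 1; 3; 1; 2; 0; 0; 2]%N);
   ((-6), [:: 0; 2; 1; 3; 1; 2; 0; 0; 3]%N);
   ((-2), [:: 2; 3; 1; 3; 1; 4; 0; 0; 0]%N)].

Definition improper1_factor : seq (int * seq nat) := [::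
   (1, [:: 0; 0; 3; 4; 1; 2; 0; 2; 3]%N);
   ((-2), [:: 0; 2; 1; 4; 0; 1; 0; 1; 2]%N);
   ((-2), [:: 0; 3; 0; 3; 1; 4; 0; 1; 3]%N);
   (2, [:: 0; 4; 0; 3; 2; 4; 0; 2; 3]%N); (1, [:: 3; 4; 0; 0; 0; 1; 1; 2; 3]%N)].

Definition improper2_factor : seq (int * seq nat) := [::
   ((-1), [:: 0; 0; 1; 4; 2; 4; 0; 2; 3]%N);
   ((-1), [:: 0; 0; 3; 4; 0; 4; 1; 2; 3]%N);
   ((-2), [:: 0; 4; 1; 4; 0; 1; 0; 1; 2]%N);
   ((-2), [:: 0; 4; 1; 4; 0; 2; 0; 1; 2]%N);
   ((-2), [:: 0; 4; 1; 4; 0; 4; 0; 1; 2]%N)].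

Definition improper3_factor : seq (int * seq nat) := [::
   (2, [:: 0; 2; 3; 4; 2; 4; 0; 0; 3]%N);
   ((-2), [:: 2; 4; 1; 4; 0; 0; 0; 2; 3]%N);
   (2, [:: 2; 4; 1; 4; 0; 4; 0; 0; 2]%N); (2, [:: 3; 4; 0; 1; 1; 4; 0; 0; 1]%N)].

(** The two graphs with coefficient -3 have the same class: they differ by an exchange of the sinks,
    a flip and a relabelling. Hence the 6, up to the sign of the canonical representative. *)
Definition tetra_poly : poly := entries basis24 [:: (-1, 12%N); (6, 4%N)].
Definition trivial_poly : poly := bracket_poly 1 [:: (2, 3); (1, 3); (0, 2)]%N.
Definition improper_shadows : seq (seq nat) :=
  [:: [:: 0; 2; 1; 3; 0; 1; 2]; [:: 0; 3; 1; 3; 0; 1; 2]; [:: 2; 3; 1; 3; 0; 0; 1]]%N.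
Definition improper_poly (i : nat) : poly := leibniz_poly 2 1 (nth [::] improper_shadows i).
Definition improper_polys : seq poly := [:: improper_poly 0; improper_poly 1; improper_poly 2].
Arguments improper_poly : simpl never.
Arguments trivial_poly : simpl never.
Arguments tetra_poly : simpl never.
Arguments dot : simpl never.

Definition factors_check k m (d : int) (p : poly) (fs : seq (int * seq nat)) : bool :=
  [&& all (fun x => bracket_ok 2 k x.2) p,
      all (fun f => lvalid 3 m 1 (fill_flat 0 f.2) && terms_ok 3 k.+1 m 1 f.2) fs
    & null_poly (lincomb ([seq (intZmod.oppz (intRing.mulz d x.1), bracket_poly 2 x.2) | x <- p] ++
                          [seq (f.1, leibniz_poly m 1 f.2) | f <- fs]))].

(** * Verification of the data by evaluation in the kernel *)

Lemma separates4 : separates 3 5 certificate4.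
Proof. by vm_cast_no_check (erefl true). Qed.
Lemma separates3 : separates 3 4 certificate3.
Proof. by vm_cast_no_check (erefl true). Qed.
(** Five internal vertices leave m + 2j = 5: three ordinary vertices with one Jacobiator, or one
    with two, as in [annihilates4b]. *)
Lemma annihilates4a : annihilates 3 5 certificate4 3 1.
Proof. by vm_cast_no_check (erefl true). Qed.
Lemma annihilates4b : annihilates 3 5 certificate4 1 2.
Proof. by vm_cast_no_check (erefl true). Qed.
Lemma annihilates3a : annihilates 3 4 certificate3 2 1.
Proof. by vm_cast_no_check (erefl true). Qed.
Lemma annihilates3b : annihilates 3 4 certificate3 0 2.
Proof. by vm_cast_no_check (erefl true). Qed.
Lemma covers24 : covers 2 4 basis24.
Proof. by vm_cast_no_check (erefl true). Qed.
Lemma covers23 : covers 2 3 basis23.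
Proof. by vm_cast_no_check (erefl true). Qed.
Lemma solves4 : solves 2 4 2 certificate4 (tetra_poly :: trivial_poly :: improper_polys) basis24 coordinates4.
Proof. by vm_cast_no_check (erefl true). Qed.
(** With no solution listed, the brackets alone must recover all four classes; here the common
    denominator is 8. *)
Lemma solves3 : solves 2 3 8 certificate3 [::] basis23 (nseq 4 [::]).
Proof. by vm_cast_no_check (erefl true). Qed.
Lemma tetra_factors : factors_check 4 3 3 tetra_poly tetra_factor.
Proof. by vm_cast_no_check (erefl true). Qed.
Lemma trivial_factors : factors_check 4 3 3 trivial_poly trivial_factor.
Proof. by vm_cast_no_check (erefl true). Qed.
Lemma improper1_factors : factors_check 4 3 1 (improper_poly 0) improper1_factor.
Proof. by vm_cast_no_check (erefl true). Qed.
Lemma improper2_factors : factors_check 4 3 1 (improper_poly 1) improper2_factor.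
Proof. by vm_cast_no_check (erefl true). Qed.
Lemma improper3_factors : factors_check 4 3 1 (improper_poly 2) improper3_factor.
Proof. by vm_cast_no_check (erefl true). Qed.

(** * Membership and independence of the claimed solutions *)

Definition tadpole_free_code (c : code) : bool :=
  all (fun i => ~~ has (eqvx (inr i)) [:: (nth vx0 c i).1; (nth vx0 c i).2]) (iota 0 (size c)).
Definition multivector_code n k (s : shadow) : bool :=
  valid n k (fill 0 s) && tadpole_free_code (fill 0 s).

Lemma to_graphK n k c : valid n.+1 k.+1 c -> of_graph (to_graph n k c) = c.
Proof.
move=> vc; have /and3P[/eqP sc _ _] := vc; have := valid_ok vc; rewrite all_targets => /allP ok.
apply: (@eq_from_nth _ vx0); first by rewrite size_map size_enum_ord.
rewrite size_map size_enum_ord => i ik; rewrite -[i]/(val (Ordinal ik)) nth_of_graph ffunE /=.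
have ic : (i < size c)%N by rewrite sc.
have vE v : ok_vx n.+1 k.+1 v -> of_vertex (to_vertex n k v) = v.
  by case: v => x /= h; rewrite inordK.
have /andP[a b] := ok _ (mem_nth vx0 ic).
by rewrite /map_pair /= !vE //; case: (nth vx0 c i).
Qed.

Lemma target_code n k c (x : 'I_k.+1 * bool) (y : 'I_k.+1) :
    all (in_range k.+1) (targets c) -> target (to_graph n k c) x = inr y ->
  has (eqvx (inr (y : nat))) [:: (nth vx0 c x.1).1; (nth vx0 c x.1).2].
Proof.
move=> cin; have /andP[r1 r2] := nth_in_range x.1 cin.
have vE v : in_range k.+1 v -> to_vertex n k v = inr y -> eqvx (inr (y : nat)) v.
  by case: v => //= i ik [<-]; rewrite inordK // eqnE.
rewrite /target !ffunE; case: ifP => _ h; apply/hasP.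
  by exists (nth vx0 c x.1).2; [rewrite !inE eqxx orbT|apply: (vE _ r2 h)].
by exists (nth vx0 c x.1).1; [rewrite !inE eqxx|apply: (vE _ r1 h)].
Qed.

Lemma is_multivector_code n k s : multivector_code n.+1 k.+1 s ->
  is_multivector (to_graph n k (fill 0 s)).
Proof.
case/andP=> vc tf; have /and3P[/eqP sc cin ps] := vc; apply/andP; split.
  apply/forallP => x; rewrite count_sinks_graph to_graphK // (seq.permP ps).
  by rewrite count_uniq_mem ?iota_uniq // mem_iota ltn_ord.
apply/forallP => a; apply/eqP => /(target_code cin).
have am : (a.1 : nat) \in iota 0 (size (fill 0 s)) by rewrite mem_iota sc ltn_ord.
by rewrite (negPf (allP tf _ am)).
Qed.

Section Solutions.
Variable R : realFieldType.

Lemma ev_multivector n k p : all (fun x => multivector_code n.+1 k.+1 x.2) p ->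
  ev R n k p \in multivectors R n.+1 k.+1.
Proof.
move=> /allP h; rewrite /ev big_seq; apply: memv_suml => x /h mx; apply: memvZ.
by apply: class_multivector; apply: is_multivector_code.
Qed.

(** The check exhibits d times the bracket as a combination of expanded Leibniz graphs, and d is
    invertible in [R]. *)
Lemma factors_leibniz k m d p fs : (m + 2 = k.+2)%N -> d != 0 ->
    factors_check k.+1 m d p fs ->
  bracket_P R 1 k.+1 (ev R 1 k p) \in leibniz R 3 k.+2.
Proof.
move=> e d0 /and3P[okp /allP okf /null_polyP].
move=> /(_ R 2%N k.+1); rewrite ev_lincomb big_cat !big_map /=.
rewrite bracket_ev // ev_lincomb big_map /=.
pose B := \sum_(x <- p) x.1%:~R *: ev R 2 k.+1 (bracket_poly 2 x.2); rewrite -/B.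
have -> : \sum_(x <- p) (intZmod.oppz (intRing.mulz d x.1))%:~R *:
    ev R 2 k.+1 (bracket_poly 2 x.2) = - (d%:~R *: B).
  rewrite scaler_sumr -sumrN; apply: eq_bigr => x _.
  by rewrite -[intZmod.oppz _]/(- (d * x.1)) intrN intrM scaleNr scalerA.
move=> h; have {}h := subr0_eq (etrans (addrC _ _) h).
have d0' : d%:~R != 0 :> R by rewrite intr_eq0.
rewrite -[B](scalerK d0') -h; apply: memvZ; rewrite big_seq; apply: memv_suml => f fin.
have /andP[v1 v2] := okf _ fin; apply: memvZ.
exact: (@leibniz_poly_mem R 2 m 0 k.+1).
Qed.

Lemma functional_indep n k phi p ps :
    all (fun x => separating n.+1 k.+1 x.2) phi ->
    all (fun q => all (fun x => canonical n.+1 k.+1 x.2) q) (p :: ps) ->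
    ~~ isz0 (dot p phi) -> all (fun q => isz0 (dot q phi)) ps ->
  ev R n k p \notin <<[seq ev R n k q | q <- ps]>>%VS.
Proof.
move=> sep /andP[cp /allP cps] dp /allP dps.
apply: (@notin_span _ _ (@functional R n k phi)).
  rewrite /= functional_ev // intr_eq0; apply: contra dp => /eqP ->.
  by [].
pose f : {linear gsum R n.+1 k.+1 -> R^o} := @functional R n k phi.
move=> w; suff /subvP h : (<<[seq ev R n k q | q <- ps]>> <= lker (linfun f))%VS.
  by move/h; rewrite memv_ker lfunE => /eqP.
apply/span_subvP => v /mapP[q qin ->]; rewrite memv_ker lfunE /= functional_ev ?cps //.
by rewrite (isz0P (dps _ qin)).
Qed.

Lemma ev_eq n k p q (d : int) : null_poly (lincomb [:: (1, p); (intZmod.oppz d, q)]) ->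
  ev R n k p = d%:~R *: ev R n k q.
Proof.
move/null_polyP => /(_ R n k); rewrite ev_lincomb !big_cons big_nil addr0 /= scale1r.
by rewrite -[intZmod.oppz d]/(- d) intrN scaleNr => /subr0_eq.
Qed.

Lemma multivectors0 n k : covers n.+1 k.+1 [::] -> multivectors R n.+1 k.+1 = 0%VS.
Proof. by move=> cov; apply/eqP; rewrite -subv0; apply: (multivectors_sub cov). Qed.

Lemma leibniz0 n k :
    (forall m j, (m + (j + j) = k.+1)%N -> (0 < j)%N -> lshadows n.+1 m j = [::]) ->
  leibniz R n.+1 k.+1 = 0%VS.
Proof.
by move=> h; apply/eqP; rewrite -subv0; apply: leibniz_sub => m j s e j0; rewrite h.
Qed.

Lemma tetraE : tetrahedral_flow R = ev R 1 3 tetra_poly.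
Proof.
(* The label 2 + i of the encoding becomes [inr i]. *)
pose c1 : code := [:: (inl 0, inl 1); (inr 0, inr 2); (inr 0, inr 3); (inr 0, inr 1)]%N.
pose c2 : code := [:: (inl 0, inr 1); (inl 1, inr 2); (inr 0, inr 3); (inr 0, inr 1)]%N.
pose c3 : code := [:: (inl 0, inr 1); (inr 2, inr 3); (inl 1, inr 0); (inr 0, inr 2)]%N.
rewrite /tetrahedral_flow (@encoded_graph 1 3 _ c1) // (@encoded_graph 1 3 _ c2) //.
rewrite (@encoded_graph 1 3 _ c3) // skewB skewZ.
transitivity (evc R 1 3 [:: (1, c1); (-3, c2); (-3, c3)]).
  rewrite /evc !big_cons big_nil addr0 scale1r; congr (_ + _).
  rewrite -scalerDr intrN scaleNr; congr (- (_ *: _)).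
  exact: linearD.
rewrite reduce_sound; last by vm_compute.
by rewrite (@ev_eq 1 3 _ tetra_poly 1) ?scale1r //; vm_compute.
Qed.

Lemma wedge_class : wedge R = class R 1 0 [:: (0, 0)%N].
Proof.
rewrite wedgeE /class /vec; congr (skew (gen R _)); apply/ffunP => i.
rewrite !ffunE (ord1 i) /map_pair /=; congr (inl _, inl _); apply: ord_inj;
  by rewrite /= inordK.
Qed.

End Solutions.

(** * Orientations of the tetrahedron *)

Definition arrows_code (E : seq (nat * nat)) (a b : nat) (o : seq bool) : seq (nat * vx) :=
  [:: (a, inl 0%N : vx); (b, inl 1%N : vx)] ++
  [seq (let e := flip x.2 x.1 in (e.1, inr e.2 : vx)) | x <- zip E o].
Definition out_code (A : seq (nat * vx)) (i : nat) : seq vx := [seq a.2 | a <- A & eqn a.1 i].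
Definition balanced (k : nat) (A : seq (nat * vx)) : bool :=
  all (fun i => eqn (size (out_code A i)) 2) (iota 0 k).
Definition oriented_code (k : nat) (A : seq (nat * vx)) : code :=
  [seq (nth (inl 0%N : vx) (out_code A i) 0, nth (inl 0%N : vx) (out_code A i) 1) | i <- iota 0 k].
Definition orient_terms (k : nat) (E : seq (nat * nat)) : seq (int * code) :=
  [seq (if perm_parity (unzip1 A) then -1 else 1 : int, oriented_code k A)
  | A <- flatten [seq flatten [seq [seq arrows_code E a b o
                                   | o <- seqprod (nseq (size E) [:: false; true])]
                              | b <- iota 0 k] | a <- iota 0 k] & balanced k A].

(** Repetitions are allowed in [s]: in the list of sources of a balanced orientation each vertex
    occurs twice. *)
Lemma odd_inversions s : odd (inversions s) = perm_parity s.
Proof.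
elim: s => [|x s IH]; first by rewrite /inversions big_ord0.
rewrite /= -IH -oddD; congr odd; rewrite /inversions /= big_ord_recl /=; congr (_ + _)%N.
  rewrite big_mkcond big_ord_recl /= add0n -sum1_count (big_nth 0%N) big_mkord [RHS]big_mkcond /=.
  by apply: eq_bigr => i _; rewrite ?add0n; case: ltnP.
apply: eq_bigr => p _; rewrite big_mkcond big_ord_recl /= add0n [RHS]big_mkcond /=.
by apply: eq_bigr => q _; rewrite /bump /= !add1n ltnS.
Qed.

Lemma sum_tuple_seqprod (V : nmodType) m (G : seq bool -> V) :
  \sum_(o : m.-tuple bool) G o = \sum_(l <- seqprod (nseq m [:: false; true])) G l.
Proof.
rewrite -(big_map (@tval m bool) xpredT G); apply: perm_big; apply: uniq_perm.
- by rewrite map_inj_uniq ?index_enum_uniq //; apply: val_inj.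
- by apply: seqprod_uniq; apply/allP => l /nseqP[-> _].
move=> l; rewrite mem_seqprod; apply/mapP/idP => [[o _ ->]|h].
  case: o => /= o /eqP <-; elim: o => //= b o ->; by case: b.
have sl : size l == m by move: h; rewrite all2E size_nseq => /andP[].
by exists (Tuple sl) => //; rewrite mem_index_enum.
Qed.

Section Orientation.
Variables (R : realFieldType) (k : nat).

Definition enc_arrow (a : 'I_k.+1 * vertex 2 k.+1) : nat * vx := (val a.1, of_vertex a.2).

Lemma map_outgoing A (i : 'I_k.+1) :
  [seq of_vertex v | v <- outgoing A i] = out_code [seq enc_arrow a | a <- A] i.
Proof. by rewrite /outgoing /out_code filter_map -!map_comp. Qed.

Lemma nth_map_default (S T : Type) (h : S -> T) x0 l i : nth (h x0) (map h l) i = h (nth x0 l i).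
Proof. by elim: l i => [|x l IH] [|i] //=. Qed.

Lemma of_oriented A :
  of_graph (oriented A) = oriented_code k.+1 [seq enc_arrow a | a <- A].
Proof.
rewrite /of_graph /oriented_code -val_enum_ord -map_comp; apply: eq_map => i /=.
rewrite ffunE /map_pair /= -map_outgoing.
by rewrite -!(nth_map_default (@of_vertex 2 k.+1)).
Qed.

Lemma balancedE A :
  [forall i : 'I_k.+1, size (outgoing A i) == 2%N] = balanced k.+1 [seq enc_arrow a | a <- A].
Proof.
rewrite /balanced; apply/forallP/allP => [h i|h i].
  rewrite mem_iota => /andP[_ ik]; rewrite -[i]/(val (Ordinal (ik : i < k.+1)%N)).
  by rewrite -map_outgoing size_map eqnE.
have := h i; rewrite mem_iota ltn_ord => /(_ isT).
by rewrite -map_outgoing size_map eqnE.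
Qed.

Lemma enc_arrows (E : seq ('I_k.+1 * 'I_k.+1)) s (o : (size E).-tuple bool) :
  [seq enc_arrow a | a <- arrows s o] =
  arrows_code [seq (val e.1, val e.2) | e <- E] (val s.1) (val s.2) o.
Proof.
rewrite /arrows /arrows_code map_cat; congr (_ ++ _); rewrite -map_comp.
move: (tval o); elim: E {o} => [|e E IH] [|b l] //=; rewrite IH; congr (_ :: _).
by case: b e => -[].
Qed.

Lemma orientE (E : seq ('I_k.+1 * 'I_k.+1)) :
  orient R E = evc R 1 k (orient_terms k.+1 [seq (val e.1, val e.2) | e <- E]).
Proof.
set E' := [seq _ | _ <- E]; have sE : size E' = size E by rewrite size_map.
pose G (A : seq (nat * vx)) : gsum R 2 k.+1 := if balanced k.+1 A then
  (-1) ^+ perm_parity (unzip1 A) *: vec R 1 k (oriented_code k.+1 A) else 0.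
transitivity (\sum_(s : 'I_k.+1 * 'I_k.+1) \sum_(o : (size E).-tuple bool)
    G (arrows_code E' (val s.1) (val s.2) o)).
  rewrite /orient skew_sum; apply: eq_bigr => s _; rewrite skew_sum big_mkcond.
  apply: eq_bigr => o _; rewrite balancedE enc_arrows /G; case: ifP => // _.
  rewrite skewZ -enc_arrows -of_oriented -signr_odd odd_inversions.
  by rewrite /unzip1 -map_comp /vec of_graphK.
rewrite -(pair_bigA _ (fun a b => \sum_(o : (size E).-tuple bool)
   G (arrows_code E' (val a) (val b) o))) /=.
rewrite /evc /orient_terms big_map big_filter big_mkcond big_flatten big_map.
rewrite sum_iota; apply: eq_bigr => a _; rewrite big_flatten big_map sum_iota.
apply: eq_bigr => b _; rewrite big_map sE (sum_tuple_seqprod (size E) (fun o => G (arrows_code E' a b o))).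
rewrite [RHS]big_mkcond; apply: eq_bigr => o _; rewrite /G /=; case: ifP => // _; congr (_ *: _).
by move: (odd _ (+) _) => -[].
Qed.

End Orientation.

(** Origin of the 8: both sinks hang on one of four vertices and the opposite triangle is oriented
    cyclically in two ways, which gives eight copies of the first graph. The 12 ordered pairs of
    distinct sink-bearing vertices, with four orientations each, give the remaining 48 = 8 times
    6. *)
Lemma orient_gamma3 (R : realFieldType) : orient R gamma3 = 8 *: tetrahedral_flow R.
Proof.
rewrite orientE tetraE.
have -> : [seq (val e.1, val e.2) | e <- gamma3] =
    [:: (0, 1); (0, 2); (0, 3); (1, 2); (1, 3); (2, 3)]%N.
  by rewrite /gamma3 /= !inordK.
rewrite reduce_sound; last by vm_compute.
by rewrite (@ev_eq R 1 3 _ tetra_poly 8) //; vm_compute.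
Qed.

(* Functionals dual to tetra_poly, trivial_poly, improper_polys up to triangularity. *)
Definition dual4 : seq poly := [seq entries basis24 l | l <-
  [:: [:: (1, 12%N)]; [:: (1, 13%N); (1, 21%N)]; [:: (1, 5%N)]; [:: (1, 11%N)]; [:: (1, 21%N)]]].

Lemma dual4_separating : all (all (fun x => separating 2 4 x.2)) dual4.
Proof. by vm_cast_no_check (erefl true). Qed.

Lemma solutions4_canonical :
  all (all (fun x => canonical 2 4 x.2)) (tetra_poly :: trivial_poly :: improper_polys).
Proof. by vm_cast_no_check (erefl true). Qed.

Lemma solutions4_multivectors :
  all (all (fun x => multivector_code 2 4 x.2)) (tetra_poly :: trivial_poly :: improper_polys).
Proof. by vm_cast_no_check (erefl true). Qed.

(** Stronger than a span condition: each Leibniz bi-vector shadow expands to plus or minus one of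
    the three chosen ones. *)
Definition improper_check : bool :=
  all (fun s => terms_ok 2 4 2 1 s && (let p := leibniz_poly 2 1 s in
    has (fun q => null_poly (lincomb [:: (1, p); (-1, q)]) ||
                  null_poly (lincomb [:: (1, p); (1, q)])) improper_polys)) (lshadows 2 2 1).

Lemma improper_checked : improper_check.
Proof. by vm_cast_no_check (erefl true). Qed.

(** * The solution spaces on one to four vertices *)

Section MainTheorem.
Variable R : realFieldType.

Notation V4 p := (ev R 1 3 p).

(** Every Jacobiator expands to two vertices, so fewer than six vertices hold at most two of
    them. *)
Lemma two_jacobiators m j k : (m + (j + j) = k)%N -> (0 < j)%N -> (k < 6)%N ->
  (j = 1%N /\ k = m.+2) \/ (j = 2%N /\ k = m.+4).
Proof. by case: j => [|[|[|j]]] // e _ k6; [left|right|]; lia. Qed.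

Lemma solutions4_sub (U : {vspace gsum R 2 4}) :
    (forall p, p \in tetra_poly :: trivial_poly :: improper_polys -> V4 p \in U) ->
  (solutions R 4 <= U)%VS.
Proof.
move=> vU.
apply: (@solutions_sub R 2 certificate4 _ basis24 coordinates4 3 U _ separates4 _ covers24 _ solves4 vU);
  [by []| |by []].
move=> m j e j0; have [[ej em]|[ej em]] := two_jacobiators e j0 isT; rewrite ej.
  have -> : m = 3%N by lia.
  exact: annihilates4a.
have -> : m = 1%N by lia.
exact: annihilates4b.
Qed.

Lemma solutions3 : solutions R 3 = 0%VS.
Proof.
apply/eqP; rewrite -subv0.
apply: (@solutions_sub R 8 certificate3 [::] basis23 (nseq 4 [::]) 2 0%VS _ separates3 _ covers23
  _ solves3); [by []| |by []|by []].
move=> m j e j0; have [[ej em]|[ej em]] := two_jacobiators e j0 isT; rewrite ej.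
  have -> : m = 2%N by lia.
  exact: annihilates3a.
have -> : m = 0%N by lia.
exact: annihilates3b.
Qed.

Lemma solutions4_mem p : p \in tetra_poly :: trivial_poly :: improper_polys ->
  V4 p \in solutions R 4.
Proof.
move=> pin; rewrite memv_cap -memv_preim; apply/andP; split.
  exact: ev_multivector (allP solutions4_multivectors _ pin).
have fac d fs : d != 0 -> factors_check 4 3 d p fs ->
    bracket_P R 1 4 (V4 p) \in leibniz R 3 5.
  exact: (@factors_leibniz R 3 3 d p fs erefl).
move: pin fac; rewrite in_cons => /predU1P[-> fac|].
  exact: (fac 3 _ isT tetra_factors).
rewrite in_cons => /predU1P[-> fac|]; first exact: (fac 3 _ isT trivial_factors).
rewrite in_cons => /predU1P[-> fac|]; first exact: (fac 1 _ isT improper1_factors).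
rewrite in_cons => /predU1P[-> fac|]; first exact: (fac 1 _ isT improper2_factors).
by rewrite mem_seq1 => /eqP -> fac; exact: (fac 1 _ isT improper3_factors).
Qed.

Lemma poisson_trivial3 : poisson_trivial R 3 = <[V4 trivial_poly]>%VS.
Proof.
pose x0 : shadow := [:: (2, 3); (1, 3); (0, 2)]%N.
rewrite /poisson_trivial; have -> : multivectors R 1 3 = <[class R 0 2 x0]>%VS.
  apply/eqP; rewrite eqEsubv; apply/andP; split.
    apply: (@multivectors_sub R 0 2 [:: x0]); first by vm_compute.
    by move=> s; rewrite inE => /eqP ->; exact: memv_line.
  by rewrite -memvE class_multivector // is_multivector_code //; vm_compute.
rewrite limg_line /trivial_poly -/x0; congr (<[_]>)%VS.
have ok : bracket_ok 1 3 x0 by vm_compute.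
exact: (@bracket_class R 0 2 x0 ok).
Qed.

Lemma improper4 : improper R 4 = <<[seq V4 p | p <- improper_polys]>>%VS.
Proof.
apply/eqP; rewrite eqEsubv; apply/andP; split.
  apply: leibniz_sub => m j s e j0; have [[ej em]|[ej em]] := two_jacobiators e j0 isT; rewrite ej.
    have -> : m = 2%N by lia.
    move=> sin; have /andP[ok /hasP[q qin h]] := allP improper_checked _ sin; split; first exact: ok.
    have qU : V4 q \in <<[seq V4 p | p <- improper_polys]>>%VS by apply: memv_span; apply: map_f.
    case/orP: h => h; first by rewrite (@ev_eq R 1 3 _ q 1 h) memvZ.
    by rewrite (@ev_eq R 1 3 _ q (-1) h) memvZ.
  have -> : m = 0%N by lia.
  (* Two Jacobiators without ordinary vertices can send only one arrow each to one another, so they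
     would need four sinks. *)
  by have -> : lshadows 2 0 2 = [::] by vm_compute.
have ok : all (fun i => let s := nth [::] improper_shadows i in
    lvalid 2 2 1 (fill_flat 0 s) && terms_ok 2 4 2 1 s) [:: 0; 1; 2]%N by vm_compute.
have mem i : i \in [:: 0; 1; 2]%N -> V4 (improper_poly i) \in improper R 4.
  move=> /(allP ok)/andP[v1 v2]; exact: (@leibniz_poly_mem R 1 2 0 3 _ erefl v1 v2).
apply/span_subvP => v /mapP[p pin ->].
have /mapP[i iin ->] : p \in [seq improper_poly i | i <- [:: 0; 1; 2]%N] := pin.
exact: mem.
Qed.

Lemma dual4_notin i p ps : (i < 5)%N ->
    all (fun q => q \in tetra_poly :: trivial_poly :: improper_polys) (p :: ps) ->
    ~~ isz0 (dot p (nth [::] dual4 i)) -> all (fun q => isz0 (dot q (nth [::] dual4 i))) ps ->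
  V4 p \notin <<[seq V4 q | q <- ps]>>%VS.
Proof.
move=> i5 /allP pin; apply: functional_indep.
  exact: (allP dual4_separating _ (@mem_nth _ [::] dual4 i i5)).
apply/allP => q /pin qin; exact: (allP solutions4_canonical _ qin).
Qed.

Lemma solutions1 : solutions R 1 = <[wedge R]>%VS.
Proof.
have mvE : multivectors R 2 1 = <[wedge R]>%VS.
  rewrite wedge_class; apply/eqP; rewrite eqEsubv; apply/andP; split.
    apply: (@multivectors_sub R 1 0 [:: [:: (0, 0)%N]]); first by vm_compute.
    by move=> s; rewrite inE => /eqP ->; exact: memv_line.
  by rewrite -memvE class_multivector // is_multivector_code //; vm_compute.
apply/eqP; rewrite eqEsubv; apply/andP; split; first by rewrite -mvE capvSl.
rewrite -memvE memv_cap mvE memv_line -memv_preim /= wedge_class.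
have -> : class R 1 0 [:: (0, 0)%N] = ev R 1 0 [:: (1, [:: (0, 0)%N])].
  by rewrite /ev big_seq1 scale1r.
(* The bracket of the wedge with itself has four terms and the Jacobiator three, all equal to one
   class up to sign; hence the factors 3 and -4. *)
by apply: (@factors_leibniz R 0 0 3 _ [:: (-4, [:: 0; 0; 0]%N)]).
Qed.

Lemma wedge_neq0 : wedge R != 0.
Proof.
have sep : separating 2 1 [:: (0, 0)%N] by vm_compute.
by apply: contraNneq (class_diag R sep) => e; rewrite -wedge_class e ffunE.
Qed.

Lemma multivectors10 : multivectors R 1 0 = 0%VS.
Proof.
apply/eqP; rewrite -subv0; apply/span_subvP => v /mapP[g].
rewrite mem_enum => /andP[/forallP/(_ ord0)]; rewrite (_ : [set _ | _] = set0) ?cards0 //.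
by apply/setP => -[[]].
Qed.

End MainTheorem.

Theorem theorem3 (R : realFieldType) :
  (* k = 1 *)
  [/\ wedge R != 0,
      solutions R 1 = <[wedge R]>%VS,
      wedge R \notin poisson_trivial R 0
    & wedge R \notin improper R 1] /\
  (* k = 2 *)
  [/\ solutions R 2 = 0%VS, poisson_trivial R 1 = 0%VS & improper R 2 = 0%VS] /\
  (* k = 3 *)
  [/\ solutions R 3 = 0%VS, poisson_trivial R 2 = 0%VS & improper R 3 = 0%VS] /\
  (* k = 4 *)
  [/\ tetrahedral_flow R \notin (poisson_trivial R 3 + improper R 4)%VS,
      solutions R 4 =
        (<[tetrahedral_flow R]> + (poisson_trivial R 3 + improper R 4))%VS
    & exists2 c : R, c != 0 & orient R gamma3 = c *: tetrahedral_flow R] /\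
  [/\ \dim (poisson_trivial R 3) = 1%N,
      \dim (improper R 4) = 3%N
    & (poisson_trivial R 3 :&: improper R 4)%VS = 0%VS] /\
  (* the nontrivial and proper solutions above have no 2-cycles *)
  without_2cycles (wedge R) /\ without_2cycles (tetrahedral_flow R).
Proof.
have no_improper n k : (k < 3)%N ->
    (forall m, (m + 2 = k.+1)%N -> lshadows n.+1 m 1 = [::]) -> leibniz R n.+1 k.+1 = 0%VS.
  move=> k3 h; apply: leibniz0 => m j e j0; have k6 : (k.+1 < 6)%N by lia.
  have [[ej em]|[ej em]] := two_jacobiators e j0 k6; last by lia.
  by rewrite ej h //; lia.
have im1 : improper R 1 = 0%VS by apply: no_improper => // m; lia.
(* A lone Jacobiator has three distinct targets, but there are only two sinks. *)
have im2 : improper R 2 = 0%VS.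
  by apply: no_improper => // m em; have -> : m = 0%N by lia.
(* The Jacobiator must point to both sinks and to the ordinary vertex, whose two arrows would then
   form a double edge. *)
have im3 : improper R 3 = 0%VS.
  by apply: no_improper => // m em; have -> : m = 1%N by lia.
have XL : (poisson_trivial R 3 + improper R 4)%VS =
    <<[seq ev R 1 3 p | p <- trivial_poly :: improper_polys]>>%VS.
  by rewrite /= span_cons poisson_trivial3 improper4.
have Xn : ev R 1 3 trivial_poly \notin improper R 4.
  by rewrite improper4; apply: (@dual4_notin R 1 _ improper_polys); vm_compute.
split; first split=> //.
- exact: wedge_neq0.
- exact: solutions1.
- by rewrite /poisson_trivial multivectors10 limg0 memv0 wedge_neq0.
- by rewrite im1 memv0 wedge_neq0.
split; first split=> //.
(* All bi-vector classes on two vertices vanish: the only graph without a double edge is the 2-cycle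
   with one sink at each vertex, and exchanging its vertices together with its sinks is an odd
   symmetry. *)
- apply/eqP; rewrite -subv0 -(@multivectors0 R 1 1) ?capvSl //.
- by rewrite /poisson_trivial (@multivectors0 R 0 0) ?limg0.
split; first split=> //.
- exact: solutions3.
- by rewrite /poisson_trivial (@multivectors0 R 0 1) ?limg0.
split; first split.
- by rewrite XL tetraE; apply: (@dual4_notin R 0 _ (trivial_poly :: improper_polys)); vm_compute.
- apply/eqP; rewrite eqEsubv; apply/andP; split.
    rewrite XL tetraE -span_cons; apply: solutions4_sub => p pin.
    by apply: memv_span; rewrite -map_cons map_f.
  rewrite XL tetraE -span_cons; apply/span_subvP => v; rewrite -map_cons => /mapP[p pin ->].
  exact: solutions4_mem.
- by exists 8; [rewrite pnatr_eq0|exact: orient_gamma3].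
split; first split.
- rewrite poisson_trivial3 dim_vline; apply/eqP; rewrite eqb1.
  by apply: contraNneq Xn => ->; exact: mem0v.
- apply/eqP; rewrite improper4 -[3%N]/(size [seq ev R 1 3 p | p <- improper_polys]).
  rewrite -/(free _) !free_cons nil_free andbT.
  apply/and3P; split.
  + by apply: (@dual4_notin R 2 _ (behead improper_polys)); vm_compute.
  + by apply: (@dual4_notin R 3 _ (behead (behead improper_polys))); vm_compute.
  by apply: (@dual4_notin R 4 _ [::]); vm_compute.
- apply/eqP; rewrite -subv0; apply/subvP => x; rewrite memv_cap poisson_trivial3.
  case/andP=> /vlineP[a ->] ax; rewrite memv0; apply: contraR Xn => nz.
  have a0 : a != 0 by apply: contraNneq nz => ->; rewrite scale0r.
  by rewrite -[ev _ _ _ _](scalerK a0) memvZ.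
split.
- move=> g /existsP[a /existsP[b /and3P[]]]; by rewrite [a.1]ord1 [b.1]ord1 eqxx.
rewrite tetraE => g cg; rewrite /ev sum_ffunE big1_seq // => x /andP[_ xin].
rewrite ffunE skew_without_2cycles ?scaler0 //.
have nc : all (fun x => [&& valid 2 4 (fill 0 x.2) & ~~ code_2cycle (fill 0 x.2)]) tetra_poly.
  by vm_compute.
have /andP[/and3P[/eqP sc cin _] nx] := allP nc _ xin.
by apply: contra nx; apply: has_2cycle_code.
Qed.
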